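(* Let $d=1$, $M_1=M_2\equiv1$, $H\in(0,1/2)$ and $\lambda(d\rho)=c_H\rho^{-H-1/2}d\rho$ on $\mathbb{R}_+$ with $c_H=\frac1{\Gamma(H+1/2)\Gamma(1/2-H)}$, so that $G_1(t)=G_2(t)=\int_{\mathbb{R}_+}e^{-\rho t}\lambda(d\rho)=\frac{t^{H-1/2}}{\Gamma(H+1/2)}$. Let $T>0$. For $K>0$, $n\in\mathbb{N}^*$ and $1\le i\le n$ let $I^K_{i,n}=[\frac{i-1}nK,\frac inK)$ and $$\rho^K_{i,n}=\frac{\int_{I^K_{i,n}}\rho\,\lambda(d\rho)}{\lambda(I^K_{i,n})}.$$ Let $X$ be the solution of $X_t=x_0+\int_0^tG_1(t-s)b(X_s)ds+\int_0^tG_2(t-s)\sigma(X_s)dW_s$, and let $\hat X^K$ denote the solution of the same equation with $G_1,G_2$ replaced by approximating kernels $\hat G^K_1,\hat G^K_2$. (1) Let $\hat\lambda=\sum_{i=1}^n\lambda(I^K_{i,n})\delta_{\rho^K_{i,n}}$ and $\hat G^K_1(t)=\hat G^K_2(t)=\int e^{-\rho t}\hat\lambda(d\rho)$. If $K=K_n\sim n^{4/5}$ as $n\to\infty$, then $$\exists C>0,\ \forall t\in[0,T],\quad \mathbb{E}[|\hat X^K_t-X_t|^2]\le C\,n^{-2H\times\frac45}.$$ (2) Let $J\ge2$ be an even integer, $\beta=\frac{4J+12-2HJ}{5J+12-2HJ}$, $K=n^{\frac4{5\beta+2H(1-\beta)}}$, and let $\hat G^K_1(t)=\hat G^K_2(t)=\int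 e^{-\rho t}\hat\lambda^{NC}(d\rho)$ with $$\hat\lambda^{NC}=\sum_{i=1}^n\lambda(I^{K^\beta}_{i,n})\,\delta_{\rho^{K^\beta}_{i,n}}+\frac{c_H(K-K^\beta)}n\sum_{i=1}^n\sum_{m=0}^Jc^J_m\,(\rho^{K,J}_{i,n,m})^{-H-\frac12}\,\delta_{\rho^{K,J}_{i,n,m}},$$ where $\rho^{K,J}_{i,n,m}=K^\beta+\frac{K-K^\beta}n(i-1+\frac mJ)$, $(c^J_m)_{0\le m\le J}$ are the Newton–Cotes weights, $I^{K^\beta}_{i,n}=[\frac{i-1}nK^\beta,\frac inK^\beta)$ and $\rho^{K^\beta}_{i,n}=\frac{\int_{I^{K^\beta}_{i,n}}\rho\,\lambda(d\rho)}{\lambda(I^{K^\beta}_{i,n})}$ for $1\le i\le n$. Then $$\exists C>0,\ \forall t\in[0,T],\quad \mathbb{E}[|\hat X^K_t-X_t|^2]\le C\,n^{-2H\times\frac{5J+12-2HJ}{5J+15-2HJ}} .$$ In particular, for Simpson's rule ($J=2$), $\sup_{t\in[0,T]}\mathbb{E}[|\hat X^K_t-X_t|^2]=O\big(n^{-2H\times\frac{22-4H}{25-4H}}\big)$. In both cases the constant $C$ does not depend on $n$.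
   Context: $x_0\in\mathbb{R}$ is deterministic, $W$ is a standard one-dimensional Brownian motion on a filtered probability space, $b,\sigma:\mathbb{R}\to\mathbb{R}$ are globally Lipschitz, $\mathbb{R}_+=[0,\infty)$ and $\delta_x$ is the Dirac mass at $x$. For an even integer $J\ge2$, the Newton–Cotes weights are $c^J_m=\int_0^1\prod_{0\le l\le J,\,l\ne m}\frac{Jx-l}{m-l}\,dx$, $0\le m\le J$; they are such that for any smooth $f:[a,b]\to\mathbb{R}$ one has $\int_a^bf(x)dx=(b-a)\sum_{m=0}^Jc^J_mf(a+m\frac{b-a}J)+\tilde c^J(b-a)^{J+3}f^{(J+2)}(\xi)$ for some $\xi\in(a,b)$, with a constant $\tilde c^J$ depending only on $J$; $J=2$ is Simpson's rule. A solution of a stochastic Volterra equation is an adapted measurable process with second moments bounded on compact time intervals satisfying the equation almost surely for each $t$; existence and uniqueness of strong solutions under these assumptions is known (X. Zhang). *)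

(* Defs.v *)
From HB Require Import structures.
From mathcomp Require Import all_boot all_order all_algebra.
From mathcomp Require Import all_classical all_reals all_analysis.
From mathcomp Require Import measurable_realfun.
Import Order.TTheory GRing.Theory Num.Theory.
Import numFieldNormedType.Exports.

Set Implicit Arguments.
Unset Strict Implicit.
Unset Printing Implicit Defensive.

Local Open Scope classical_set_scope.
Local Open Scope ring_scope.

Section stochastic_calculus.
Context {R : realType} {d : measure_display} {Omega : measurableType d}.
Variables (P : probability Omega R) (F : R -> set (set Omega)).
Local Notation mu := (@lebesgue_measure R).

(* Only the values F t with 0 <= t matter; completeness and right-continuity
   are not required. *)
Definition filtration : Prop :=
  [/\ forall t : R, 0 <= t -> sigma_algebra setT (F t),
      forall t : R, 0 <= t -> F t `<=` measurable
    & forall s t : R, 0 <= s -> s <= t -> F s `<=` F t].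

Definition rv_measurable (G : set (set Omega)) (Y : Omega -> R) : Prop :=
  forall B : set R, measurable B -> G (Y @^-1` B).

Definition adapted (X : R -> Omega -> R) : Prop :=
  forall t : R, 0 <= t -> rv_measurable (F t) (X t).

(* Joint measurability of (s, w) |-> X s w on D * Omega. *)
Definition jointly_measurable (D : set R) (X : R -> Omega -> R) : Prop :=
  measurable_fun (D `*` [set: Omega])
    (fun z : measurableTypeR R * Omega => X z.1 z.2).

Definition increment (W : R -> Omega -> R) (s t : R) (w : Omega) : R :=
  W t w - W s w.

(* Standard Brownian motion relative to the filtration F. *)
Definition brownian_motion (W : R -> Omega -> R) : Prop :=
  [/\ adapted W,
      {ae P, forall w, W 0 w = 0},
      {ae P, forall w, {within `[0, +oo[, continuous (fun t => W t w)}},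
      forall s t : R, 0 <= s -> s < t -> forall B : set R, measurable B ->
        P (increment W s t @^-1` B) = normal_prob 0 (Num.sqrt (t - s)) B
    & forall s t : R, 0 <= s -> s < t -> forall (A : set Omega) (B : set R),
        F s A -> measurable B ->
        P (A `&` increment W s t @^-1` B)
        = (P A * P (increment W s t @^-1` B))%E].

(* Simple predictable integrands on [0, t]: finite sums
   \sum_j xi_j(w) * 1_(a_j, b_j](s) with xi_j bounded and F_(a_j)-measurable.
   The intervals may overlap; this is the same class of processes as with
   a partition of [0, t]. *)
Record simple_process (t : R) := SimpleProcess {
  sp_size : nat;
  sp_left : nat -> R;
  sp_right : nat -> R;
  sp_coef : nat -> Omega -> R;
  sp_interval : forall j, (j < sp_size)%N ->
    [/\ 0 <= sp_left j, sp_left j <= sp_right j & sp_right j <= t];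
  sp_coef_measurable : forall j, (j < sp_size)%N ->
    rv_measurable (F (sp_left j)) (sp_coef j);
  sp_coef_bounded : forall j, (j < sp_size)%N ->
    exists M : R, forall w, `|sp_coef j w| <= M
}.

Definition sp_value t (phi : simple_process t) (s : R) (w : Omega) : R :=
  \sum_(j < sp_size phi)
    sp_coef phi j w * \1_(`]sp_left phi j, sp_right phi j]) s.

Definition sp_integral (W : R -> Omega -> R) t (phi : simple_process t)
    (w : Omega) : R :=
  \sum_(j < sp_size phi)
    sp_coef phi j w * increment W (sp_left phi j) (sp_right phi j) w.

(* I is (a version of) the Ito integral of Phi over [0, t] with respect to W:
   the L^2(P)-limit of the integrals of simple processes approximating Phi in
   L^2(P * ds). It is a relation since I is determined up to P-null sets. *)
Definition is_ito_integral (W : R -> Omega -> R) (t : R)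
    (Phi : R -> Omega -> R) (I : Omega -> R) : Prop :=
  [/\ forall s : R, 0 <= s <= t -> rv_measurable (F s) (Phi s),
      jointly_measurable `[0, t] Phi,
      (\int[P]_w \int[mu]_(s in `[0%R, t]) ((Phi s w) ^+ 2)%R%:E < +oo)%E,
      measurable_fun setT I
    & exists phi : nat -> simple_process t,
        ((\int[P]_w \int[mu]_(s in `[0%R, t])
            ((sp_value (phi k) s w - Phi s w) ^+ 2)%R%:E)%E
          @[k --> \oo] --> 0%E) /\
        ('E_P[fun w => ((sp_integral W (phi k) w - I w) ^+ 2)%R]%E
          @[k --> \oo] --> 0%E)].

(* X solves
     X_t = x0 + \int_0^t G1(t-s) b(X_s) ds + \int_0^t G2(t-s) sigma(X_s) dW_s
   on [0, +oo[. For locally integrable G1 and b of linear growth, the moment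
   bound makes the drift integral converge almost surely. *)
Definition volterra_solution (W : R -> Omega -> R) (x0 : R)
    (b sigma : R -> R) (G1 G2 : R -> R) (X : R -> Omega -> R) : Prop :=
  [/\ adapted X,
      jointly_measurable `[0, +oo[ X,
      forall T : R, 0 <= T -> exists M : R, forall t : R, 0 <= t <= T ->
        ('E_P[fun w => (`|X t w| ^+ 2)%R] <= M%:E)%E
    & forall t : R, 0 <= t -> exists I : Omega -> R,
        is_ito_integral W t (fun s w => G2 (t - s) * sigma (X s w)) I /\
        {ae P, forall w, X t w =
           x0 + \int[mu]_(s in `[0, t]) (G1 (t - s) * b (X s w)) + I w}].

End stochastic_calculus.

Section lambda_measure.
Context {R : realType}.
Local Notation mu := (@lebesgue_measure R).

Definition Gamma (x : R) : R :=
  \int[mu]_(t in `]0, +oo[) (t `^ (x - 1) * expR (- t)).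

Definition c_ (H : R) : R := (Gamma (H + 2^-1) * Gamma (2^-1 - H))^-1.

Definition lambda_density (H rho : R) : R :=
  c_ H * rho `^ (- H - 2^-1) * \1_(`[0, +oo[ : set R) rho.

Definition lambda (H : R) : set _ -> \bar R := fun A =>
  (\int[mu]_(rho in A) (lambda_density H rho)%:E)%E.

Lemma Gamma_ge0 x : 0 <= Gamma x.
Proof.
by apply: Rintegral_ge0 => t _; rewrite mulr_ge0 ?powR_ge0 ?expR_ge0.
Qed.

Lemma lambda_density_ge0 H rho : 0 <= lambda_density H rho.
Proof.
by rewrite !mulr_ge0 ?powR_ge0 // invr_ge0 mulr_ge0 // Gamma_ge0.
Qed.

Lemma measurable_lambda_density H : measurable_fun setT (lambda_density H).
Proof.
apply: measurable_funM; last exact: measurable_indic.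
by apply: measurable_funM => //; exact: measurable_powR.
Qed.

Let lambda0 H : lambda H set0 = 0%E.
Proof. exact: integral_set0. Qed.

Let lambda_ge0 H A : (0 <= lambda H A)%E.
Proof.
by apply: integral_ge0 => x _; rewrite lee_fin lambda_density_ge0.
Qed.

Let lambda_sigma_additive H : semi_sigma_additive (lambda H).
Proof.
apply: (@semi_sigma_additive_nng_induced _ _ _ mu
  (EFin \o lambda_density H)).
  by apply/measurable_EFinP; exact: measurable_lambda_density.
by move=> x; rewrite lee_fin lambda_density_ge0.
Qed.

HB.instance Definition _ (H : R) := isMeasure.Build _ _ _
  (lambda H) (lambda0 H) (@lambda_ge0 H) (@lambda_sigma_additive H).

End lambda_measure.

Section kernel.
Context {R : realType}.
Local Notation mu := (@lebesgue_measure R).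

Definition G_frac (H t : R) : R :=
  \int[lambda H]_(rho in `[0, +oo[) expR (- rho * t).

(* The index i runs from 1 to n. *)
Definition cell (K : R) (n i : nat) : set R :=
  `[(i%:R - 1) / n%:R * K, i%:R / n%:R * K[.

Definition cell_mass (H K : R) (n i : nat) : R := fine (lambda H (cell K n i)).

Definition cell_mean (H K : R) (n i : nat) : R :=
  (\int[lambda H]_(rho in cell K n i) rho) / cell_mass H K n i.

(* A finite signed combination \sum_k w_k \delta_(x_k) is encoded by the list
   of the pairs (w_k, x_k). *)
Definition atomic_laplace (m : seq (R * R)) (t : R) : R :=
  \sum_(a <- m) a.1 * expR (- a.2 * t).

Definition hat_lambda (H K : R) (n : nat) : seq (R * R) :=
  [seq (cell_mass H K n i, cell_mean H K n i) | i <- iota 1 n].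

Definition newton_cotes_weight (J m : nat) : R :=
  \int[mu]_(x in `[0, 1])
    \prod_(0 <= l < J.+1 | l != m) ((J%:R * x - l%:R) / (m%:R - l%:R)).

Definition nc_node (K L : R) (J n i m : nat) : R :=
  L + (K - L) / n%:R * (i%:R - 1 + m%:R / J%:R).

(* Barycentric atoms on [0, K^beta], composite Newton-Cotes atoms on
   [K^beta, K]. *)
Definition hat_lambda_NC (H K beta : R) (J n : nat) : seq (R * R) :=
  let L := K `^ beta in
  hat_lambda H L n ++
  [seq (c_ H * (K - L) / n%:R * newton_cotes_weight J m
          * nc_node K L J n i m `^ (- H - 2^-1),
        nc_node K L J n i m) | i <- iota 1 n, m <- iota 0 J.+1].

Definition beta_ (H : R) (J : nat) : R :=
  (4 * J%:R + 12 - 2 * H * J%:R) / (5 * J%:R + 12 - 2 * H * J%:R).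

Definition K_NC (H : R) (J n : nat) : R :=
  let beta := beta_ H J in
  n%:R `^ (4 / (5 * beta + 2 * H * (1 - beta))).

Definition hatG (H K : R) (n : nat) : R -> R :=
  atomic_laplace (hat_lambda H K n).

Definition hatG_NC (H : R) (J n : nat) : R -> R :=
  atomic_laplace (hat_lambda_NC H (K_NC H J n) (beta_ H J) J n).

End kernel.

(* Main.v *)
(* The difference of two solutions driven by the same Brownian motion satisfies,
   by Cauchy-Schwarz for the drift and the Ito isometry for the diffusion,
     u t <= A \int_0^t Gh (t - s)^2 u s ds + B \int_0^T (Gh - G)^2,
   where u t = E[|Xh t - X t|^2]. After multiplication by exp (- theta t) with
   theta large, Gh^2 has small integral, so that u is bounded by a multiple of
   the squared L^2 distance of the kernels. This distance is split at a frequency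
   K. Frequencies above K contribute K^(-2H). On a cell of length K / n, the
   barycentre kills the first-order term of exp (- rho t), which leaves
   K^(5 - 2H) n^(-4) in the square; K = n^(4/5) balances both terms.
   For an even J the Newton-Cotes rule is exact on polynomials of degree J + 1, by
   symmetry, so that comparing rho^(-H - 1/2) exp (- rho t) with its Taylor
   polynomial on each cell gives an error L^(-H - 1/2) (K / n)^(J + 2) K on [L, K],
   and the exponents of K and L = K^beta balance the three contributions. *)
Require Import Defs.
From mathcomp Require Import all_boot all_order all_algebra.
From mathcomp Require Import all_classical all_reals all_analysis.
From mathcomp Require Import measurable_realfun unstable ring lra zify.
Import Order.TTheory GRing.Theory Num.Theory.
Import numFieldNormedType.Exports.
Local Open Scope classical_set_scope.
Local Open Scope ring_scope.

Set Implicit Arguments.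
Unset Strict Implicit.
Unset Printing Implicit Defensive.

(** * Measure-theoretic preliminaries *)

(** The obstacle is uniformity in n. The definition of a solution bounds the second moments of Xh by
    a constant that may depend on its kernel, so only the moments of X may enter the final constant.
    This is why Gh f(Xh) - G f(X) is split as Gh (f(Xh) - f(X)) + (Gh - G) f(X), with the
    approximating kernel on the unknown distance; the price is that the damping theta has to suit
    Gh. The moments of Xh serve only to know that u is finite, which starts the iteration. Constants
    are never sharp, and this shortens three arguments: two Ito integrals are compared through
    simple processes up to the factor 9 [kappa], without constructing the integral; the Taylor
    bounds carry no factorials; and the Newton-Cotes error is bounded through any polynomial of
    degree J + 1 close to the integrand, so that no Peano kernel is computed. *)

Section density.
Local Open Scope ereal_scope.
Context d (T : measurableType d) (R : realType).
Variables (mu nu : {measure set T -> \bar R}) (g : T -> R).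
Hypothesis g0 : forall x, (0 <= g x)%R.
Hypothesis mg : measurable_fun setT g.
Hypothesis nuE : forall A, measurable A -> nu A = \int[mu]_(x in A) (g x)%:E.

Import HBNNSimple.

(** Monotone convergence along simple functions reduces the identity to indicators, where it is
    [nuE]. It serves both for the Gaussian law and for [lambda]. *)
Lemma ge0_integral_density D (f : T -> \bar R) :
  measurable D -> measurable_fun D f -> (forall x, D x -> 0 <= f x) ->
  \int[nu]_(x in D) f x = \int[mu]_(x in D) (f x * (g x)%:E).
Proof.
move=> mD mf f0.
pose h := nnsfun_approx mD mf.
have fE x : D x -> f x = limn (fun n => (h n x)%:E).
  by move=> Dx; apply/esym/cvg_lim => //; exact: cvg_nnsfun_approx.
transitivity (limn (fun n => \int[nu]_(x in D) (h n x)%:E)).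
  rewrite -monotone_convergence//.
  - by apply: eq_integral => x /[!inE] /fE.
  - by move=> n; exact/measurable_EFinP/measurable_funP.
  - by move=> n x _; rewrite lee_fin.
  - by move=> x _ m n mn; rewrite lee_fin; exact/lefP/nd_nnsfun_approx.
transitivity (limn (fun n => \int[mu]_(x in D) ((h n x)%:E * (g x)%:E))); last first.
  rewrite -monotone_convergence//.
  - apply: eq_integral => x /[!inE] Dx; apply/cvg_lim => //.
    by apply: cvgeZr => //; exact: cvg_nnsfun_approx.
  - move=> n; apply: emeasurable_funM; apply: measurable_funTS.
      exact/measurable_EFinP/measurable_funP.
    exact/measurable_EFinP.
  - by move=> n x _; rewrite mule_ge0 ?lee_fin.
  - move=> x _ m n mn; rewrite lee_wpmul2r ?lee_fin//.
    exact/lefP/nd_nnsfun_approx.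
congr (limn _); apply/funext => n.
have mh y : measurable (h n @^-1` [set y]) by [].
transitivity (\sum_(y \in range (h n))
    \int[nu]_(x in D) (y * \1_(h n @^-1` [set y]) x)%:E).
  rewrite -ge0_integral_fsum//.
  - by apply: eq_integral => x _; rewrite fsumEFin// -fimfunE.
  - by move=> y; exact/measurable_EFinP/measurable_funM.
  - by move=> y x _; rewrite nnfun_muleindic_ge0.
transitivity (\sum_(y \in range (h n))
    \int[mu]_(x in D) ((y * \1_(h n @^-1` [set y]) x)%:E * (g x)%:E)); last first.
  rewrite -ge0_integral_fsum//.
  - apply: eq_integral => x _; rewrite fimfunE -fsumEFin//.
    by rewrite ge0_mule_fsuml// => y; exact: nnfun_muleindic_ge0.
  - move=> y; apply: emeasurable_funM; apply: measurable_funTS.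
      exact/measurable_EFinP/measurable_funM.
    exact/measurable_EFinP.
  - move=> y x _; rewrite mule_ge0 ?lee_fin//.
    by rewrite -lee_fin nnfun_muleindic_ge0.
apply: eq_fsbigr => y _.
have [y0|y0] := ltP y 0%R.
  under eq_integral do rewrite preimage_nnfun0// indic0 mulr0.
  under [RHS]eq_integral do rewrite preimage_nnfun0// indic0 mulr0 mul0e.
  by rewrite !integral0.
rewrite integralZl_indic_nnsfun// integral_indic//.
under [RHS]eq_integral do rewrite EFinM -muleA.
rewrite ge0_integralZl//; last 2 first.
- apply: emeasurable_funM; apply: measurable_funTS; exact/measurable_EFinP.
- by move=> x _; rewrite mule_ge0 ?lee_fin.
congr (_ * _); rewrite nuE//; last exact: measurableI.
rewrite setIC integral_mkcondr; apply: eq_integral => x _.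
rewrite patchE indicE; case: ifPn => // _; first by rewrite mul1e.
by rewrite mul0e.
Qed.

End density.

(** * Affine changes of variable in Lebesgue integrals *)

Section affine.
Local Open Scope ereal_scope.
Context {R : realType}.
Local Notation mu := (@lebesgue_measure R).

Definition affine (a c x : measurableTypeR R) : measurableTypeR R := (a + c * x)%R.

Lemma measurable_affine a c : measurable_fun setT (affine a c).
Proof. by apply: measurable_funD => //; exact: measurable_funM. Qed.

(** By uniqueness of Lebesgue measure it is enough that c times the image measure gives every
    interval ]l, r] its length. *)
Lemma lebesgue_measure_affine (a c : R) (A : set R) : (0 < c)%R ->
  measurable A -> mu (affine a c @^-1` A) = c^-1%:E * mu A.
Proof.
move=> c0 mA.
suff -> : mu A = mscale (NngNum (ltW c0)) (pushforward mu (affine a c)) A.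
- exact: measurable_affine.
- by move=> mf; rewrite /mscale/= muleA -EFinM mulVf ?gt_eqF// mul1e.
move=> mf; apply: lebesgue_measure_unique mA => _ [[l r]] _ <-.
rewrite -[RHS]/(c%:E * mu (affine a c @^-1` `]l, r])).
rewrite [X in _ = _ * mu X](_ : _ = `]((l - a) / c)%R, ((r - a) / c)%R]%classic); last first.
  apply/seteqP; split => x /=; rewrite !in_itv/= /affine => /andP[h1 h2];
    apply/andP; split.
  - by rewrite ltr_pdivrMr// ltrBlDl mulrC.
  - by rewrite ler_pdivlMr// lerBrDl mulrC.
  - by rewrite -ltrBlDl mulrC -ltr_pdivrMr.
  - by rewrite -lerBrDl mulrC -ler_pdivlMr.
rewrite !lebesgue_measure_itv/= !lte_fin ltr_pM2r ?invr_gt0// ltrD2r.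
case: ifPn => // _; last by rewrite mule0.
by rewrite -!EFinB -EFinM; congr EFin; field; rewrite gt_eqF.
Qed.

Lemma ge0_integral_affine (a c : R) (f : R -> \bar R) : (0 < c)%R ->
  measurable_fun setT f -> (forall x, 0 <= f x) ->
  \int[mu]_x f (a + c * x)%R = c^-1%:E * \int[mu]_x f x.
Proof.
move=> c0 mf f0; have cV0 : (0 <= c^-1)%R by rewrite invr_ge0 ltW.
transitivity (\int[pushforward mu (affine a c)]_x f x).
  by rewrite (ge0_integral_pushforward (measurable_affine a c)).
transitivity (\int[mscale (NngNum cV0) mu]_x f x).
  apply: eq_measure_integral => [|mc A mA _]; first exact: measurable_affine.
  exact: lebesgue_measure_affine.
by rewrite ge0_integral_mscale.
Qed.

Lemma ge0_integral_opp (f : R -> \bar R) :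
  measurable_fun setT f -> (forall x, 0 <= f x) ->
  \int[mu]_x f (- x)%R = \int[mu]_x f x.
Proof.
move=> mf f0.
have mN : measurable_fun setT (-%R : measurableTypeR R -> measurableTypeR R) by [].
transitivity (\int[pushforward mu (-%R : measurableTypeR R -> measurableTypeR R)]_x f x).
  by rewrite (ge0_integral_pushforward mN).
by apply: eq_measure_integral => // A mA _; exact: lebesgue_measureN.
Qed.

(** The reflection of [0, t] is the opposite followed by the translation by t, applied to the
    extension of f by 0. It turns integrals of k (t - s) into integrals of k s. *)
Lemma ge0_integral_reflect (t : R) (f : R -> \bar R) :
  measurable_fun `[0%R, t] f -> (forall x, `[0%R, t]%classic x -> 0 <= f x) ->
  \int[mu]_(s in `[0%R, t]) f (t - s)%R = \int[mu]_(s in `[0%R, t]) f s.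
Proof.
move=> mf f0; rewrite [RHS]integral_mkcond [LHS]integral_mkcond.
have mg : measurable_fun setT (f \_ `[0%R, t]) by exact/(measurable_restrictT _ _).1.
have g0 x : 0 <= (f \_ `[0%R, t]) x by apply: erestrict_ge0.
transitivity (\int[mu]_s (f \_ `[0%R, t]) (t + 1 * (- s))%R).
  apply: eq_integral => s _; rewrite !patchE mul1r !mem_setE !in_itv/=.
  by rewrite subr_ge0 lerBlDr lerDl andbC.
rewrite (@ge0_integral_opp (fun s => (f \_ `[0%R, t]) (t + 1 * s)%R)).
- by rewrite ge0_integral_affine// invr1 mul1e.
- exact: (measurableT_comp mg (measurable_affine t 1%R)).
- by move=> x; exact: g0.
Qed.

End affine.

(** * Exchange of time integral and expectation *)

Section tonelli.
Local Open Scope ereal_scope.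
Context d (Omega : measurableType d) (R : realType).
Variable P : probability Omega R.
Local Notation mu := (@lebesgue_measure R).
Variables (D : set R) (h : R -> Omega -> R).
Hypotheses (mD : measurable D) (mh : jointly_measurable D h).
Hypothesis h0 : forall s w, D s -> (0 <= h s w)%R.

(** Extension by 0 outside D, so that Tonelli applies on the whole product. *)
Let hT (z : measurableTypeR R * Omega) : \bar R :=
  ((fun z => (h z.1 z.2)%:E) \_ (D `*` setT)) z.

Let mhT : measurable_fun setT hT.
Proof.
apply/(measurable_restrictT _ _).1; first exact: measurableX.
exact/measurable_EFinP.
Qed.

Let hT0 z : 0 <= hT z.
Proof. by apply: erestrict_ge0 => -[s w] [/= Ds _]; rewrite lee_fin h0. Qed.

Let hTE s w : hT (s, w) = ((fun s => (h s w)%:E) \_ D) s.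
Proof. by rewrite /hT !patchE in_setX in_setT andbT. Qed.

Lemma measurable_integral_time :
  measurable_fun setT (fun w => \int[mu]_(s in D) (h s w)%:E).
Proof.
have := measurable_fun_fubini_tonelli_G (m1 := mu) hT mhT hT0.
apply: eq_measurable_fun => w _; rewrite /fubini_G [RHS]integral_mkcond.
by apply: eq_integral => s _; rewrite hTE.
Qed.

Lemma measurable_integral_proba :
  measurable_fun D (fun s => \int[P]_w (h s w)%:E).
Proof.
have [_] := measurable_restrictT (fun s : measurableTypeR R => \int[P]_w (h s w)%:E) mD; apply.
rewrite (_ : _ \_ _ = fubini_F P hT).
  exact: measurable_fun_fubini_tonelli_F.
apply/funext => s; rewrite /fubini_F patchE.
under [RHS]eq_integral do rewrite hTE patchE.
by case: ifPn => // _; rewrite integral0.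
Qed.

Lemma tonelli_swap : \int[P]_w \int[mu]_(s in D) (h s w)%:E =
  \int[mu]_(s in D) \int[P]_w (h s w)%:E.
Proof.
transitivity (\int[P]_w \int[mu]_s hT (s, w)).
  apply: eq_integral => w _; rewrite [LHS]integral_mkcond.
  by apply: eq_integral => s _; rewrite hTE.
rewrite -(fubini_tonelli (m1 := mu) (m2 := P) hT mhT hT0).
rewrite [RHS]integral_mkcond; apply: eq_integral => s _; rewrite patchE.
under eq_integral do rewrite hTE patchE.
by case: ifPn => // _; rewrite integral0.
Qed.

End tonelli.

Section joint_sections.
Context d (Omega : measurableType d) (R : realType).
Variables (D : set R) (h : R -> Omega -> R).
Hypotheses (mD : measurable D) (mh : jointly_measurable D h).

Lemma jointly_measurable_path w : measurable_fun D (h^~ w).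
Proof.
have := measurable_comp (F := D `*` setT) (f := fun z : measurableTypeR R * Omega => h z.1 z.2) (g := fun s : measurableTypeR R => (s, w)) (E := D).
apply.
- exact: measurableX.
- by move=> _ [s Ds <-].
- exact: mh.
- apply: measurable_funTS. exact: pair2_measurable.
Qed.

Lemma jointly_measurable_at s : D s -> measurable_fun setT (h s).
Proof.
move=> Ds.
have := measurable_comp (F := D `*` setT) (f := fun z : measurableTypeR R * Omega => h z.1 z.2) (g := fun w : Omega => (s : measurableTypeR R, w)) (E := setT).
apply.
- exact: measurableX.
- by move=> _ [w _ <-].
- exact: mh.
- exact: pair1_measurable.
Qed.

End joint_sections.

(** * Expectation of a product of independent variables *)

Section independence.
Local Open Scope ereal_scope.
Context d (Omega : measurableType d) (R : realType).
Variables (P : probability Omega R) (Y Z : {mfun Omega >-> R}).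
Hypothesis indepYZ : forall A B : set R, measurable A -> measurable B ->
  P (Y @^-1` A `&` Z @^-1` B) = P (Y @^-1` A) * P (Z @^-1` B).

Let YZ w := (Y w, Z w).

Let mYZ : measurable_fun setT YZ.
Proof. exact: measurable_fun_pair. Qed.

Let lawYZ (A : set (R * R)) : measurable A ->
  (distribution P Y \x distribution P Z) A = pushforward P YZ A.
Proof.
by apply: product_measure_unique.
Qed.

(** The joint law and the product of the laws agree on rectangles, hence everywhere. Tonelli for
    absolute values gives integrability first, which Fubini for the signed product requires. *)
Lemma indep_integrableM : P.-integrable setT (EFin \o Y) ->
  P.-integrable setT (EFin \o Z) ->
  P.-integrable setT (fun w => (Y w * Z w)%:E) /\
  \int[P]_w (Y w * Z w)%:E = \int[P]_w (Y w)%:E * \int[P]_w (Z w)%:E.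
Proof.
move=> iY iZ.
have mM : measurable_fun setT (fun p : R * R => (p.1 * p.2)%:E).
  by apply/measurable_EFinP; exact: measurable_funM.
have absE : \int[P]_w `|(Y w * Z w)%:E| =
    \int[P]_w `|(Y w)%:E| * \int[P]_w `|(Z w)%:E|.
  transitivity (\int[pushforward P YZ]_p `|(p.1 * p.2)%:E|).
    by rewrite (ge0_integral_pushforward mYZ)//; exact: measurableT_comp.
  transitivity (\int[distribution P Y \x distribution P Z]_p `|(p.1 * p.2)%:E|).
    by apply: eq_measure_integral => // A mA _; exact/esym/lawYZ.
  rewrite fubini_tonelli1//; last exact: measurableT_comp.
  transitivity (\int[distribution P Y]_y (`|y%:E| * \int[P]_w `|(Z w)%:E|)).
    apply: eq_integral => y _; rewrite /fubini_F/=.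
    under eq_integral do rewrite normrM EFinM.
    rewrite ge0_integralZl//; last exact/measurable_EFinP.
    by rewrite ge0_integral_distribution//; exact: measurableT_comp.
  rewrite ge0_integralZr//; last 2 first.
    exact: measurableT_comp.
    exact: integral_ge0.
  by rewrite ge0_integral_distribution//; exact: measurableT_comp.
have iYZ : P.-integrable setT (fun w => (Y w * Z w)%:E).
  apply/integrableP; split.
    by apply/measurable_EFinP; exact: measurable_funM.
  rewrite absE lte_mul_pinfty//; first exact: integral_ge0.
    apply/fin_numPlt; case/integrableP : iY => _ ->; rewrite andbT.
    by rewrite (lt_le_trans _ (integral_ge0 _ _)).
  by case/integrableP : iZ.
split => //.
have iprod : (distribution P Y \x distribution P Z).-integrable setT (fun p => (p.1 * p.2)%:E).
  apply/integrable12ltyP => //.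
  rewrite -(fubini_tonelli1 (m1 := distribution P Y) (m2 := distribution P Z)
    (fun p : R * R => `|(p.1 * p.2)%:E|))//; last exact: measurableT_comp.
  rewrite [ltLHS](_ : _ = \int[pushforward P YZ]_p `|(p.1 * p.2)%:E|); last first.
    by apply: eq_measure_integral => // A mA _; exact/lawYZ.
  rewrite (ge0_integral_pushforward mYZ)//; last exact: measurableT_comp.
  by case/integrableP : iYZ.
transitivity (\int[pushforward P YZ]_p (p.1 * p.2)%:E).
  by rewrite (integral_pushforward mYZ).
transitivity (\int[distribution P Y \x distribution P Z]_p (p.1 * p.2)%:E).
  by apply: eq_measure_integral => // A mA _; exact/esym/lawYZ.
rewrite -integral12_prod_meas1//.
transitivity (\int[distribution P Y]_y (y%:E * \int[P]_w (Z w)%:E)).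
  apply: eq_integral => y _; rewrite /fubini_F/=.
  under eq_integral do rewrite EFinM.
  have iZd : (distribution P Z).-integrable setT (EFin \o idfun).
    apply/integrableP; split; first by apply/measurable_EFinP; exact: measurable_id.
    rewrite (ge0_integral_distribution Z (f := abse \o (EFin \o idfun)))//.
      by case/integrableP : iZ.
    by apply: measurableT_comp => //; apply/measurable_EFinP; exact: measurable_id.
    by move=> x; exact: abse_ge0.
  by rewrite integralZl// (integral_distribution (X := Z)).
have iYd : (distribution P Y).-integrable setT (EFin \o idfun).
  apply/integrableP; split; first by apply/measurable_EFinP; exact: measurable_id.
    rewrite (ge0_integral_distribution Y (f := abse \o (EFin \o idfun)))//.
      by case/integrableP : iY.
    by apply: measurableT_comp => //; apply/measurable_EFinP; exact: measurable_id.
    by move=> x; exact: abse_ge0.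
have /fineK <- : \int[P]_w (Z w)%:E \is a fin_num by exact: integrable_fin_num.
by rewrite integralZr// (integral_distribution (X := Y)).
Qed.

End independence.

(** * Square integrable functions on a bounded interval *)

Section square_integral.
Context {R : realType}.
Local Notation mu := (@lebesgue_measure R).

(** On a set of finite measure, |f| <= 1 + f^2, because (|f| - 1)^2 >= 0. *)
Lemma integrable_sqr (D : set R) (f : R -> R) : measurable D ->
  (mu D < +oo)%E -> measurable_fun D f ->
  (\int[mu]_(x in D) (f x ^+ 2)%:E < +oo)%E -> mu.-integrable D (EFin \o f).
Proof.
move=> mD Doo mf foo.
have i1 : mu.-integrable D (fun x => (1 + f x ^+ 2)%:E).
  have -> : (fun x => (1 + f x ^+ 2)%:E) = cst 1%E \+ (fun x => (f x ^+ 2)%:E).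
    by apply/funext => x; rewrite EFinD.
  apply: integrableD => //.
    apply/integrableP; split => //.
    by under eq_integral do rewrite /= normr1; rewrite integral_cst// mul1e.
  apply/integrableP; split; first by apply/measurable_EFinP; exact: measurable_funX.
  by under eq_integral do rewrite gee0_abs ?lee_fin ?sqr_ge0//.
apply: le_integrable i1 => //; first exact/measurable_EFinP.
move=> x _ /=; rewrite lee_fin [leRHS]ger0_norm ?addr_ge0 ?sqr_ge0//.
have := sqr_ge0 (`|f x| - 1); rewrite -(real_normK (num_real (f x))).
by have := normr_ge0 (f x); nra.
Qed.

(** Cauchy-Schwarz against the constant 1, obtained by integrating (f - m / t)^2 >= 0, where m / t
    is the mean of f. *)
Lemma sqr_Rintegral_le (t : R) (f : R -> R) : 0 <= t ->
  mu.-integrable `[0, t] (EFin \o f) ->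
  (((\int[mu]_(s in `[0, t]) f s) ^+ 2)%:E <=
   t%:E * \int[mu]_(s in `[0%R, t]) (f s ^+ 2)%:E)%E.
Proof.
move=> t0 fi; set m := \int[mu]_(s in `[0, t]) f s.
have mf : measurable_fun `[0, t] f by move/integrableP : fi => [/measurable_EFinP].
have muE : mu `[0, t]%classic = t%:E.
  rewrite lebesgue_measure_itv/= lte_fin; case: ltP => [_|tle0].
    by rewrite oppr0 adde0.
  by congr EFin; apply/le_anti; rewrite t0.
have [t_eq0|t_neq0] := eqVneq t 0.
  by rewrite /m t_eq0 set_itv1 Rintegral_set1 expr0n/= mul0e.
have tp : 0 < t by rewrite lt0r t_neq0.
set S := (\int[mu]_(s in _) _)%E.
have S0 : (0 <= S)%E by apply: integral_ge0 => x _; rewrite lee_fin sqr_ge0.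
have [->|] := eqVneq S +oo%E; first by rewrite gt0_muley ?leey.
rewrite -ltey => Soo.
have isq : mu.-integrable `[0, t] (EFin \o (fun x => f x ^+ 2)).
  apply/integrableP; split; first by apply/measurable_EFinP; exact: measurable_funX.
  by under eq_integral do rewrite gee0_abs ?lee_fin ?sqr_ge0//.
have SE : S = (\int[mu]_(s in `[0, t]) (f s ^+ 2))%:E.
  by rewrite /Rintegral fineK// ge0_fin_numE.
rewrite SE -EFinM lee_fin.
have ic c : mu.-integrable `[0, t] (EFin \o cst c).
  apply: continuous_compact_integrable; first exact: segment_compact.
  by apply: continuous_subspaceT => x; exact: cvg_cst.
have i2 : mu.-integrable `[0, t] (EFin \o (fun x => 2 * (m / t) * f x)).
  exact: (integrableZl _ (2 * (m / t)) fi).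
have muf : fine (mu `[0, t]%classic) = t by rewrite muE.
have : \int[mu]_(s in `[0, t]) (2 * (m / t) * f s - (m / t) ^+ 2) <=
    \int[mu]_(s in `[0, t]) (f s ^+ 2).
  apply: le_Rintegral => //.
    exact: (integrableB _ i2 (ic ((m / t) ^+ 2))).
  by move=> s _; have := sqr_ge0 (f s - m / t); nra.
rewrite (RintegralB _ i2 (ic ((m / t) ^+ 2)))// RintegralZl// Rintegral_cst// muf -/m => le.
have -> : m ^+ 2 = t * (2 * (m / t) * m - (m / t) ^+ 2 * t).
  by field.
by rewrite ler_wpM2l.
Qed.

End square_integral.

(** * The Ito isometry *)

Section gaussian.
Local Open Scope ereal_scope.
Context {R : realType}.
Local Notation mu := (@lebesgue_measure R).

Definition normal_moment2 : \bar R :=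
  \int[mu]_x (x ^+ 2 * normal_pdf 0%R 1%R x)%:E.

Lemma normal_moment2_ge0 : 0 <= normal_moment2.
Proof.
by apply: integral_ge0 => x _; rewrite lee_fin mulr_ge0 ?sqr_ge0 ?normal_pdf_ge0.
Qed.

(** Since exp u >= 1 + u with u = x^2 / 4, one has x^2 exp (- x^2 / 2) <= 4 exp (- x^2 / 4). The
    right side is proportional to the centred normal density of variance 2, and [c] adjusts the two
    normalizations. *)
Lemma normal_moment2_lty : normal_moment2 < +oo.
Proof.
have s0 : Num.sqrt 2 != 0%R :> R by rewrite gt_eqF// sqrtr_gt0.
have n10 : 1%R != 0%R :> R by rewrite oner_eq0.
pose c : R := (4 * normal_peak 1 / normal_peak (Num.sqrt 2)%R)%R.
have ps0 : (0 < normal_peak (Num.sqrt 2)%R :> R)%R by exact: normal_peak_gt0.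
have c0 : (0 <= c)%R.
  by rewrite /c mulr_ge0 ?invr_ge0 ?normal_peak_ge0// mulr_ge0// normal_peak_ge0.
apply: (@le_lt_trans _ _ (\int[mu]_x (c%:E * (normal_pdf 0%R (Num.sqrt 2)%R x)%:E))).
  apply: ge0_le_integral => //.
  - by move=> x _; rewrite lee_fin mulr_ge0 ?sqr_ge0 ?normal_pdf_ge0.
  - apply/measurable_EFinP; apply: measurable_funM; first exact: measurable_funX.
    exact: measurable_normal_pdf.
  - apply: measurable_funeM; apply/measurable_EFinP; exact: measurable_normal_pdf.
  move=> x _; rewrite -EFinM lee_fin !normal_pdfE//.
  rewrite [leRHS](_ : _ = normal_peak 1%R * (4 * normal_fun 0 (Num.sqrt 2) x))%R; last first.
    by rewrite /c; field; rewrite gt_eqF.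
  rewrite mulrCA ler_wpM2l ?normal_peak_ge0// /normal_fun !subr0 sqr_sqrtr//.
  have -> : (- x ^+ 2 / (1 ^+ 2 *+ 2) = - x ^+ 2 / (2 *+ 2) + - (x ^+ 2 / 4) :> R)%R.
    by field.
  rewrite expRD mulrCA [leRHS]mulrC.
  rewrite ler_wpM2l ?expR_ge0// expRN ler_pdivrMr ?expR_gt0//.
  by have := expR_ge1Dx (x ^+ 2 / 4); lra.
rewrite ge0_integralZl//; last 2 first.
- apply/measurable_EFinP; exact: measurable_normal_pdf.
- by move=> x _; rewrite lee_fin normal_pdf_ge0.
by rewrite integral_normal_pdf mule1 ltry.
Qed.

Lemma normal_pdf_scale (s x : R) : (0 < s)%R ->
  (normal_pdf 0%R s x = s^-1 * normal_pdf 0%R 1%R (s^-1 * x))%R.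
Proof.
move=> s0; have n10 : 1%R != 0%R :> R by rewrite oner_eq0.
rewrite !normal_pdfE ?gt_eqF// mulrA; congr (_ * _)%R.
  rewrite /normal_peak expr1n mul1r -mulrnAr sqrtrM ?sqr_ge0//.
  by rewrite sqrtr_sqr gtr0_norm// invfM.
rewrite /normal_fun !subr0; congr expR; field.
by rewrite gt_eqF.
Qed.

Lemma integral_normal_moment2 (s : R) : (0 < s)%R ->
  \int[mu]_x (x ^+ 2 * normal_pdf 0%R s x)%:E = (s ^+ 2)%:E * normal_moment2.
Proof.
move=> s0.
have m2 : measurable_fun setT (fun x : R => (x ^+ 2 * normal_pdf 0%R 1%R x)%:E).
  apply/measurable_EFinP; apply: measurable_funM; first exact: measurable_funX.
  exact: measurable_normal_pdf.
have p2 (x : R) : 0 <= (x ^+ 2 * normal_pdf 0%R 1%R x)%:E.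
  by rewrite lee_fin mulr_ge0 ?sqr_ge0 ?normal_pdf_ge0.
transitivity (\int[mu]_x (s%:E * ((0 + s^-1 * x)%R ^+ 2 * normal_pdf 0%R 1%R (0 + s^-1 * x)%R)%:E)).
  apply: eq_integral => x _; rewrite -EFinM add0r normal_pdf_scale//; congr EFin.
  by field; rewrite gt_eqF.
rewrite ge0_integralZl//; last 2 first.
- exact: (measurableT_comp m2 (measurable_affine 0%R s^-1%R)).
- by rewrite lee_fin ltW.
rewrite (@ge0_integral_affine _ _ _ (fun x => (x ^+ 2 * normal_pdf 0%R 1%R x)%:E))// ?invr_gt0//.
by rewrite invrK muleA -EFinM.
Qed.

Context d (Omega : measurableType d) (P : probability Omega R).
Variables (X : Omega -> R) (s : R).
Hypotheses (mX : measurable_fun setT X) (s0 : (0 < s)%R).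
Hypothesis lawX : forall B, measurable B -> P (X @^-1` B) = normal_prob 0%R s B.

Lemma ge0_integral_normal (f : R -> \bar R) :
  measurable_fun setT f -> (forall x, 0 <= f x) ->
  \int[P]_w f (X w) = \int[mu]_x (f x * (normal_pdf 0%R s x)%:E).
Proof.
move=> mf f0; transitivity (\int[pushforward P (X : Omega -> measurableTypeR R)]_x f x).
  by rewrite (ge0_integral_pushforward (phi := X : Omega -> measurableTypeR R)).
transitivity (\int[normal_prob 0%R s]_x f x).
  by apply: eq_measure_integral => // A mA _; exact: lawX.
apply: (ge0_integral_density (mu := mu)) => //.
- by move=> x; exact: normal_pdf_ge0.
- exact: measurable_normal_pdf.
Qed.

Lemma normal_variance : \int[P]_w (X w ^+ 2)%:E = (s ^+ 2)%:E * normal_moment2.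
Proof.
rewrite (@ge0_integral_normal (fun x => (x ^+ 2)%:E)).
- by rewrite -integral_normal_moment2//; apply: eq_integral => x _; rewrite EFinM.
- by apply/measurable_EFinP; exact: measurable_funX.
- by move=> x; rewrite lee_fin sqr_ge0.
Qed.

Lemma normal_integrable_sqr : P.-integrable setT (fun w => (X w ^+ 2)%:E).
Proof.
apply/integrableP; split; first by apply/measurable_EFinP; exact: measurable_funX.
under eq_integral do rewrite gee0_abs ?lee_fin ?sqr_ge0//.
rewrite normal_variance lte_mul_pinfty// ?lee_fin ?sqr_ge0//.
exact: normal_moment2_lty.
Qed.

Lemma integrable_of_sqr (Y : Omega -> R) : measurable_fun setT Y ->
  P.-integrable setT (fun w => (Y w ^+ 2)%:E) -> P.-integrable setT (EFin \o Y).
Proof.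
move=> mY iY2.
have i1 : P.-integrable setT (fun w => (1 + Y w ^+ 2)%:E).
  have -> : (fun x => (1 + Y x ^+ 2)%:E) = cst 1%E \+ (fun x => (Y x ^+ 2)%:E).
    by apply/funext => x; rewrite EFinD.
  by apply: integrableD => //; exact: finite_measure_integrable_cst.
apply: le_integrable i1 => //; first exact/measurable_EFinP.
move=> x _ /=; rewrite lee_fin [leRHS]ger0_norm ?addr_ge0 ?sqr_ge0//.
have := sqr_ge0 (`|Y x| - 1)%R; rewrite -(real_normK (num_real (Y x))).
by have := normr_ge0 (Y x); nra.
Qed.

(** The density is even, so the positive and negative parts have the same integral; integrability
    makes this integral finite, so that the difference is 0. *)
Lemma normal_expectation0 : \int[P]_w (X w)%:E = 0.
Proof.
have iX : P.-integrable setT (EFin \o X).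
  by apply: integrable_of_sqr => //; exact: normal_integrable_sqr.
pose f1 (x : R) := (Num.max x 0)%:E.
pose f2 (x : R) := (Num.max (- x) 0)%:E.
have m1 : measurable_fun setT f1.
  by apply/measurable_EFinP; exact: measurable_maxr.
have m2 : measurable_fun setT f2.
  by apply/measurable_EFinP; apply: measurable_maxr => //; exact: measurable_oppr.
have f10 x : 0 <= f1 x by rewrite lee_fin le_max lexx orbT.
have f20 x : 0 <= f2 x by rewrite lee_fin le_max lexx orbT.
rewrite integralE.
have -> : \int[P]_w (fun w => (X w)%:E)^\+ w = \int[P]_w (fun w => (X w)%:E)^\- w.
  transitivity (\int[P]_w f1 (X w)).
    by apply: eq_integral => w _; rewrite funeposE -EFin_max.
  transitivity (\int[P]_w f2 (X w)); last first.
    by apply: eq_integral => w _; rewrite funenegE -EFin_max.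
  rewrite !ge0_integral_normal//.
  rewrite -[LHS]ge0_integral_opp.
  - apply: eq_integral => x _; congr (_ * _%:E).
    by rewrite !normal_pdfE ?gt_eqF// /normal_fun !subr0 sqrrN.
  - by apply: emeasurable_funM => //; apply/measurable_EFinP; exact: measurable_normal_pdf.
  - by move=> x; rewrite mule_ge0// lee_fin normal_pdf_ge0.
rewrite subee//.
exact: (integrable_neg_fin_num _ iX).
Qed.

End gaussian.

Section rv_measurable.
Context {R : realType} {d : measure_display} {Omega : measurableType d}.
Variable (G : set (set Omega)).
Hypothesis sG : sigma_algebra setT G.

(** A sigma-algebra generates itself, so [rv_measurable] is measurability for the structure
    generated by G. This transfers the closure properties of measurable functions. *)
Let rvP (Y : Omega -> R) :
  rv_measurable G Y <-> measurable_fun setT (Y : g_sigma_algebraType G -> R).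
Proof.
split=> [mY _ B mB|mY B mB].
  rewrite setTI; change (<<s G >> (Y @^-1` B)); rewrite sigma_algebra_id//; exact: mY.
have := mY measurableT B mB; rewrite setTI => h.
have : <<s G >> (Y @^-1` B) by exact: h.
by rewrite sigma_algebra_id.
Qed.

Lemma rv_measurableM (Y Z : Omega -> R) : rv_measurable G Y ->
  rv_measurable G Z -> rv_measurable G (fun w => Y w * Z w).
Proof. by move=> /rvP mY /rvP mZ; apply/rvP; exact: measurable_funM. Qed.

Lemma rv_measurableB (Y Z : Omega -> R) : rv_measurable G Y ->
  rv_measurable G Z -> rv_measurable G (fun w => Y w - Z w).
Proof. by move=> /rvP mY /rvP mZ; apply/rvP; exact: measurable_funB. Qed.

Lemma rv_measurableN (Y : Omega -> R) : rv_measurable G Y ->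
  rv_measurable G (fun w => - Y w).
Proof. by move=> /rvP mY; apply/rvP; exact: measurableT_comp. Qed.

End rv_measurable.

(** * Moments of Brownian increments against the past *)

Section brownian.
Context {R : realType} {d : measure_display} {Omega : measurableType d}.
Variables (P : probability Omega R) (F : R -> set (set Omega)).
Variable W : R -> Omega -> R.
Hypotheses (fF : filtration F) (bW : brownian_motion P F W).

Lemma rv_measurable_mono (s t : R) (Y : Omega -> R) : 0 <= s -> s <= t ->
  rv_measurable (F s) Y -> rv_measurable (F t) Y.
Proof. by move=> s0 st mY B mB; have [_ _ sub] := fF; exact/(sub s t s0 st)/mY. Qed.

Lemma rv_measurable_fun (t : R) (Y : Omega -> R) : 0 <= t ->
  rv_measurable (F t) Y -> measurable_fun setT Y.
Proof.
move=> t0 mY _ B mB; rewrite setTI; have [_ sub _] := fF.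
exact/(sub t t0)/mY.
Qed.

Lemma rv_increment (a b : R) : 0 <= a -> a <= b ->
  rv_measurable (F b) (increment W a b).
Proof.
move=> a0 ab; have [sF _ _] := fF; have b0 := le_trans a0 ab.
apply: rv_measurableB; first exact: sF.
- by have [adW _ _ _ _] := bW; exact: adW.
- by apply: (rv_measurable_mono a0 ab); have [adW _ _ _ _] := bW; exact: adW.
Qed.

Lemma measurable_increment (a b : R) : 0 <= a -> a <= b ->
  measurable_fun setT (increment W a b).
Proof.
move=> a0 ab; apply: (@rv_measurable_fun b); first exact: le_trans ab.
exact: rv_increment.
Qed.

Lemma incrementxx a w : increment W a a w = 0.
Proof. by rewrite /increment subrr. Qed.

Lemma integrable_increment_sqr (a b : R) : 0 <= a -> a <= b ->
  P.-integrable setT (fun w => (increment W a b w ^+ 2)%:E).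
Proof.
move=> a0; rewrite le_eqVlt => /predU1P[<-|ab].
  under eq_fun do rewrite incrementxx expr0n/=; exact: integrable0.
have [_ _ _ lawW _] := bW.
apply: (@normal_integrable_sqr _ _ _ _ _ (Num.sqrt (b - a))).
- exact/measurable_increment/ltW.
- by rewrite sqrtr_gt0 subr_gt0.
- exact: lawW.
Qed.

Lemma integrable_increment (a b : R) : 0 <= a -> a <= b ->
  P.-integrable setT (EFin \o increment W a b).
Proof.
move=> a0 ab; apply: integrable_of_sqr; first exact: measurable_increment.
exact: integrable_increment_sqr.
Qed.

(* The value [kappa = 1] is not needed, since constants do not matter for the
   stability estimate; only its finiteness is. *)
Definition kappa : R := fine (@normal_moment2 R).

Lemma kappa_ge0 : 0 <= kappa.
Proof. by rewrite fine_ge0// normal_moment2_ge0. Qed.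

Lemma kappaE : kappa%:E = @normal_moment2 R.
Proof. by rewrite fineK// ge0_fin_numE ?normal_moment2_ge0// normal_moment2_lty. Qed.

Lemma expectation_increment_sqr (a b : R) : 0 <= a -> a <= b ->
  (\int[P]_w (increment W a b w ^+ 2)%:E = (kappa * (b - a))%:E)%E.
Proof.
move=> a0; rewrite le_eqVlt => /predU1P[<-|ab].
  under eq_integral do rewrite incrementxx expr0n/=.
  by rewrite integral0 subrr mulr0.
have [_ _ _ lawW _] := bW.
rewrite (@normal_variance _ _ _ _ _ (Num.sqrt (b - a))).
- by rewrite sqr_sqrtr ?subr_ge0 1?ltW// -kappaE -EFinM mulrC.
- exact/measurable_increment/ltW.
- by rewrite sqrtr_gt0 subr_gt0.
- exact: lawW.
Qed.

Lemma expectation_increment (a b : R) : 0 <= a -> a <= b ->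
  (\int[P]_w (increment W a b w)%:E = 0)%E.
Proof.
move=> a0; rewrite le_eqVlt => /predU1P[<-|ab].
  by under eq_integral do rewrite incrementxx; rewrite integral0.
have [_ _ _ lawW _] := bW.
apply: (@normal_expectation0 _ _ _ _ _ (Num.sqrt (b - a))).
- exact/measurable_increment/ltW.
- by rewrite sqrtr_gt0 subr_gt0.
- exact: lawW.
Qed.

(** Independence of the past and an increment, in product form; g will be the identity and the
    square. The strict inequality a < b is the one under which [brownian_motion] describes
    increments, and the users of the lemma treat a = b apart. *)
Lemma expectation_mul_comp_increment (a b : R) (Y : Omega -> R) (g : R -> R) :
  0 <= a -> a < b -> rv_measurable (F a) Y -> P.-integrable setT (EFin \o Y) ->
  measurable_fun setT g ->
  P.-integrable setT (fun w => (g (increment W a b w))%:E) ->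
  P.-integrable setT (fun w => (Y w * g (increment W a b w))%:E) /\
  (\int[P]_w (Y w * g (increment W a b w))%:E =
   \int[P]_w (Y w)%:E * \int[P]_w (g (increment W a b w))%:E)%E.
Proof.
move=> a0 ab mY iY mg ig.
have mY' := rv_measurable_fun a0 mY.
have mZ : measurable_fun setT (fun w => g (increment W a b w)).
  by apply: (measurableT_comp mg); exact/measurable_increment/ltW.
apply: (@indep_integrableM _ _ _ P (mfun_Sub (mem_set mY')) (mfun_Sub (mem_set mZ))) => //= A B mA mB.
have [_ _ _ _ indepW] := bW.
rewrite -[X in _ `&` X]/(increment W a b @^-1` (g @^-1` B)).
apply: indepW => //; first exact: mY.
by rewrite -[X in measurable X]setTI; exact: mg.
Qed.

Lemma expectation_mul_increment (a b : R) (Y : Omega -> R) :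
  0 <= a -> a <= b -> rv_measurable (F a) Y -> P.-integrable setT (EFin \o Y) ->
  P.-integrable setT (fun w => (Y w * increment W a b w)%:E) /\
  (\int[P]_w (Y w * increment W a b w)%:E = 0)%E.
Proof.
move=> a0 + mY iY; rewrite le_eqVlt => /predU1P[<-|ab].
  under eq_fun do rewrite incrementxx mulr0.
  split; first exact: integrable0.
  by rewrite integral0.
have [|i ->] := @expectation_mul_comp_increment a b Y id a0 ab mY iY (@measurable_id _ _ _).
  exact/integrable_increment/ltW.
by split => //; rewrite (expectation_increment a0 (ltW ab)) mule0.
Qed.

Lemma expectation_mul_increment_sqr (a b : R) (Y : Omega -> R) :
  0 <= a -> a <= b -> rv_measurable (F a) Y -> P.-integrable setT (EFin \o Y) ->
  P.-integrable setT (fun w => (Y w * increment W a b w ^+ 2)%:E) /\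
  (\int[P]_w (Y w * increment W a b w ^+ 2)%:E =
   \int[P]_w (Y w)%:E * (kappa * (b - a))%:E)%E.
Proof.
move=> a0 + mY iY; rewrite le_eqVlt => /predU1P[<-|ab].
  under eq_fun do rewrite incrementxx expr0n mulr0.
  split; first exact: integrable0.
  by rewrite integral0 subrr mulr0 mule0.
have [||i ->] := @expectation_mul_comp_increment a b Y (fun x => x ^+ 2) a0 ab mY iY.
- exact: measurable_funX.
- exact/integrable_increment_sqr/ltW.
by split => //; rewrite (expectation_increment_sqr a0 (ltW ab)).
Qed.

End brownian.

(** * Covariance of two weighted increments *)

Section brownian.
Context {R : realType} {d : measure_display} {Omega : measurableType d}.
Variables (P : probability Omega R) (F : R -> set (set Omega)).
Variable W : R -> Omega -> R.
Hypotheses (fF : filtration F) (bW : brownian_motion P F W).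
Local Notation kappa := (@kappa R).
Local Notation dW := (increment W).

Definition bounded_rv (Y : Omega -> R) := exists M : R, forall w, `|Y w| <= M.

Lemma bounded_rvM (Y Z : Omega -> R) : bounded_rv Y -> bounded_rv Z ->
  bounded_rv (fun w => Y w * Z w).
Proof.
move=> [M YM] [N ZN]; exists (M * N) => w.
by rewrite normrM ler_pM.
Qed.

Lemma bounded_integrableM (Y Z : Omega -> R) : measurable_fun setT Y ->
  bounded_rv Y -> P.-integrable setT (EFin \o Z) ->
  P.-integrable setT (EFin \o (fun w => Y w * Z w)).
Proof.
move=> mY [M YM] iZ; have -> : EFin \o (fun w => Y w * Z w) = ((EFin \o Y) \* (EFin \o Z))%E.
  by apply/funext => w /=; rewrite EFinM.
apply: integrableMr => //; exists `|M|; split => // x Mx w _.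
by apply: (le_trans (YM w)); rewrite (le_trans (ler_norm _))// ltW.
Qed.

Lemma bounded_integrable (Y : Omega -> R) : measurable_fun setT Y ->
  bounded_rv Y -> P.-integrable setT (EFin \o Y).
Proof.
move=> mY bY; have -> : EFin \o Y = EFin \o (fun w => Y w * 1).
  by apply/funext => w /=; rewrite mulr1.
apply: bounded_integrableM => //.
exact: finite_measure_integrable_cst.
Qed.

(** In dW c M = dW c m + dW m M, the second part is centred given time m, and the first leaves the
    square of dW c m. *)
Lemma expectation_nested (c m M : R) (Y : Omega -> R) :
  0 <= c -> c <= m -> m <= M -> rv_measurable (F c) Y -> bounded_rv Y ->
  P.-integrable setT (fun w => (Y w * dW c m w * dW c M w)%:E) /\
  (\int[P]_w (Y w * dW c m w * dW c M w)%:E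
   = \int[P]_w (Y w)%:E * (kappa * (m - c))%:E)%E.
Proof.
move=> c0 cm mM mY bY.
have m0 := le_trans c0 cm.
have mY' := rv_measurable_fun fF c0 mY.
have iY := bounded_integrable mY' bY.
have iYW : P.-integrable setT (EFin \o (fun w => Y w * dW c m w)).
  by apply: bounded_integrableM => //; exact: (integrable_increment fF bW).
have mYW : rv_measurable (F m) (fun w => Y w * dW c m w).
  apply: rv_measurableM; first by have [sF _ _] := fF; exact: sF.
    exact: (rv_measurable_mono fF c0 cm).
  exact: (rv_increment fF bW).
have [i1 e1] := expectation_mul_increment_sqr fF bW c0 cm mY iY.
have [i2 e2] := expectation_mul_increment fF bW m0 mM mYW iYW.
have E : (fun w => (Y w * dW c m w * dW c M w)%:E) =
    ((fun w => (Y w * dW c m w ^+ 2)%:E) \+ (fun w => (Y w * dW c m w * dW m M w)%:E))%E.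
  apply/funext => w; rewrite -EFinD; congr EFin; rewrite /increment; ring.
rewrite E; split; first exact: integrableD.
by rewrite integralD// e1 e2 adde0.
Qed.

(** Length of the intersection of ]a, b] and ]c, e]. The intervals of a simple process may overlap,
    so cross terms contribute to the isometry. *)
Definition overlap (a b c e : R) : R := Num.max 0 (Num.min b e - Num.max a c).

(** The increment on ]a, b] is cut at c: the part before c is known at time c and multiplies a
    centred increment, the rest is nested with dW c e. *)
Let expectation_increments_ordered (a b c e : R) (Y Z : Omega -> R) :
  0 <= a -> a <= b -> c <= e -> a <= c ->
  rv_measurable (F a) Y -> rv_measurable (F c) Z -> bounded_rv Y -> bounded_rv Z ->
  P.-integrable setT (fun w => ((Y w * dW a b w) * (Z w * dW c e w))%:E) /\
  (\int[P]_w ((Y w * dW a b w) * (Z w * dW c e w))%:E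
   = \int[P]_w (Y w * Z w)%:E * (kappa * overlap a b c e)%:E)%E.
Proof.
move=> a0 ab ce ac mY mZ bY bZ.
have c0 := le_trans a0 ac.
have mYZ : rv_measurable (F c) (fun w => Y w * Z w).
  apply: rv_measurableM => //; first by have [sF _ _] := fF; exact: sF.
  exact: (rv_measurable_mono fF a0 ac).
have bYZ := bounded_rvM bY bZ.
have mYZ' := rv_measurable_fun fF c0 mYZ.
have before x : a <= x -> x <= c ->
    P.-integrable setT (fun w => ((Y w * Z w * dW a x w) * dW c e w)%:E) /\
    (\int[P]_w ((Y w * Z w * dW a x w) * dW c e w)%:E = 0)%E.
  move=> ax xc; apply: (expectation_mul_increment fF bW) => //.
    apply: rv_measurableM => //; first by have [sF _ _] := fF; exact: sF.
    apply: (rv_measurable_mono fF (le_trans a0 ax) xc).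
    exact: (rv_increment fF bW).
  by apply: bounded_integrableM => //; exact: (integrable_increment fF bW).
have [bc|cb] := leP b c.
  have -> : overlap a b c e = 0.
    apply/max_idPl; rewrite subr_le0 (max_idPr ac).
    by rewrite (le_trans _ bc)// ge_min lexx.
  rewrite mulr0 mule0.
  have E w : (Y w * dW a b w) * (Z w * dW c e w) = (Y w * Z w * dW a b w) * dW c e w.
    by ring.
  by under eq_fun do rewrite E; exact: before.
have [i1 e1] := before c ac (lexx c).
have -> : overlap a b c e = Num.min b e - c.
  by rewrite /overlap (max_idPr ac); apply/max_idPr; rewrite subr_ge0 le_min (ltW cb) ce.
(* Both increments now start at c, and their product does not change when they are sorted by right
   end. *)
have [||i2 e2] := @expectation_nested c (Num.min b e) (Num.max b e) _ c0 _ _ mYZ bYZ.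
- by rewrite le_min (ltW cb) ce.
- by rewrite ge_min !le_max !lexx orTb.
have E : (fun w => ((Y w * dW a b w) * (Z w * dW c e w))%:E) =
    ((fun w => (Y w * Z w * dW a c w * dW c e w)%:E) \+
    (fun w => (Y w * Z w * dW c (Num.min b e) w * dW c (Num.max b e) w)%:E))%E.
  apply/funext => w; rewrite -EFinD; congr EFin; rewrite /increment.
  by case: leP => _; ring.
rewrite E; split; first exact: integrableD.
by rewrite integralD// e1 e2 add0e.
Qed.

Lemma expectation_increments (a b c e : R) (Y Z : Omega -> R) :
  0 <= a -> a <= b -> 0 <= c -> c <= e ->
  rv_measurable (F a) Y -> rv_measurable (F c) Z -> bounded_rv Y -> bounded_rv Z ->
  P.-integrable setT (fun w => ((Y w * dW a b w) * (Z w * dW c e w))%:E) /\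
  (\int[P]_w ((Y w * dW a b w) * (Z w * dW c e w))%:E
   = \int[P]_w (Y w * Z w)%:E * (kappa * overlap a b c e)%:E)%E.
Proof.
move=> a0 ab c0 ce mY mZ bY bZ.
have [ac|/ltW ca] := leP a c; first exact: expectation_increments_ordered.
have [i e1] := expectation_increments_ordered c0 ce ab ca mZ mY bZ bY.
have E w : (Y w * dW a b w) * (Z w * dW c e w) = (Z w * dW c e w) * (Y w * dW a b w).
  by rewrite mulrC.
under eq_fun do rewrite E.
split => //.
rewrite e1 /overlap (minC e) (maxC c); congr (_ * _)%E.
by apply: eq_integral => w _; rewrite mulrC.
Qed.

(** The same [overlap] as in the covariance of two increments: the isometry thus holds term by
    term. *)
Lemma Rintegral_indic_overlap (t a b c e : R) :
  0 <= a -> b <= t ->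
  (\int[@lebesgue_measure R]_(s in `[0%R, t])
     (\1_`]a, b] s * \1_`]c, e] s)%:E = (overlap a b c e)%:E)%E.
Proof.
move=> a0 bt.
have E : `]a, b]%classic `&` `]c, e]%classic =
    `](Num.max a c), (Num.min b e)]%classic :> set R.
  apply/seteqP; split => x /=; rewrite !in_itv/= gt_max le_min.
    by move=> [/andP[-> ->] /andP[-> ->]].
  by move=> /andP[/andP[-> ->] /andP[-> ->]].
transitivity (\int[@lebesgue_measure R]_(s in `[0%R, t])
    (\1_(`](Num.max a c), (Num.min b e)]) s)%:E)%E.
  by apply: eq_integral => s _; rewrite -E indicI.
rewrite integral_indic//= setIidl; last first.
  move=> x /=; rewrite !in_itv/= gt_max le_min => /andP[/andP[ax _] /andP[xb _]].
  by rewrite (le_trans a0 (ltW ax)) (le_trans xb bt).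
rewrite lebesgue_measure_itv/= lte_fin /overlap.
case: ifPn => [lt|].
  by congr EFin; apply/esym/max_idPr; rewrite subr_ge0 ltW.
by rewrite -leNgt => le; congr EFin; apply/esym/max_idPl; rewrite subr_le0.
Qed.

End brownian.

Section simple_difference.
Context {R : realType} {d : measure_display} {Omega : measurableType d}.
Variables (F : R -> set (set Omega)) (t : R).
Hypothesis fF : filtration F.
Variables phi psi : simple_process F t.

Let n := sp_size phi.

(** The difference of two simple processes: the terms of phi are followed by those of psi with
    opposite coefficients. As intervals may overlap, this concatenation replaces a common refinement
    of the two subdivisions. *)
Definition spB_left j := if (j < n)%N then sp_left phi j else sp_left psi (j - n).
Definition spB_right j := if (j < n)%N then sp_right phi j else sp_right psi (j - n).
Definition spB_coef j w :=
  if (j < n)%N then sp_coef phi j w else - sp_coef psi (j - n) w.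

Let ltB j : (j < n + sp_size psi)%N -> ~~ (j < n)%N -> (j - n < sp_size psi)%N.
Proof. by rewrite -leqNgt => jlt nj; rewrite ltn_subLR. Qed.

Lemma spB_interval j : (j < n + sp_size psi)%N ->
  [/\ 0 <= spB_left j, spB_left j <= spB_right j & spB_right j <= t].
Proof.
rewrite /spB_left /spB_right => jlt; case: ifPn => jn.
  exact: sp_interval.
by apply: sp_interval; exact: ltB.
Qed.

Lemma spB_coef_measurable j : (j < n + sp_size psi)%N ->
  rv_measurable (F (spB_left j)) (spB_coef j).
Proof.
move=> jlt; have [l0 _ _] := spB_interval jlt.
move: l0; rewrite /spB_left /spB_coef => l0.
have [jn|jn] := boolP (j < n)%N; first exact: sp_coef_measurable.
move: l0; rewrite (negbTE jn) => l0.
apply: rv_measurableN; first by have [sF _ _] := fF; exact: sF.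
by apply: sp_coef_measurable; exact: ltB.
Qed.

Lemma spB_coef_bounded j : (j < n + sp_size psi)%N ->
  exists M : R, forall w, `|spB_coef j w| <= M.
Proof.
move=> jlt; rewrite /spB_coef; have [jn|jn] := boolP (j < n)%N.
  exact: sp_coef_bounded.
have [M MP] := sp_coef_bounded (ltB jlt jn).
by exists M => w; rewrite normrN.
Qed.

Definition spB : simple_process F t :=
  SimpleProcess spB_interval spB_coef_measurable spB_coef_bounded.

Lemma sp_valueB s w : sp_value spB s w = sp_value phi s w - sp_value psi s w.
Proof.
rewrite /sp_value/= big_split_ord/= -sumrN; congr (_ + _); apply: eq_bigr => j _.
  by rewrite /spB_coef /spB_left /spB_right ltn_ord.
by rewrite /spB_coef /spB_left /spB_right ltnNge leq_addr/= addKn mulNr.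
Qed.

Lemma sp_integralB (W : R -> Omega -> R) w :
  sp_integral W spB w = sp_integral W phi w - sp_integral W psi w.
Proof.
rewrite /sp_integral/= big_split_ord/= -sumrN; congr (_ + _); apply: eq_bigr => j _.
  by rewrite /spB_coef /spB_left /spB_right ltn_ord.
by rewrite /spB_coef /spB_left /spB_right ltnNge leq_addr/= addKn mulNr.
Qed.

End simple_difference.

(** * The isometry for simple processes, up to the factor [kappa] *)

Section ito.
Context {R : realType} {d : measure_display} {Omega : measurableType d}.
Variables (P : probability Omega R) (F : R -> set (set Omega)).
Variable W : R -> Omega -> R.
Hypotheses (fF : filtration F) (bW : brownian_motion P F W).
Local Notation kappa := (@kappa R).
Local Notation mu := (@lebesgue_measure R).
Local Notation dW := (increment W).

Section simple.
Variables (t : R) (phi : simple_process F t).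
Local Notation ov i j :=
  (overlap (sp_left phi i) (sp_right phi i) (sp_left phi j) (sp_right phi j)).
Local Notation xi := (sp_coef phi).

Lemma measurable_sp_coef j : (j < sp_size phi)%N -> measurable_fun setT (xi j).
Proof.
move=> jn; have [l0 _ _] := sp_interval jn.
exact: (rv_measurable_fun fF l0 (sp_coef_measurable jn)).
Qed.

Lemma measurable_sp_integral : measurable_fun setT (sp_integral W phi).
Proof.
apply: measurable_sum => j; apply: measurable_funM.
  exact: measurable_sp_coef.
have [l0 lr _] := sp_interval (ltn_ord j).
exact: (measurable_increment fF bW).
Qed.

Lemma jointly_measurable_sp_value (D : set R) : jointly_measurable D (sp_value phi).
Proof.
apply: measurable_funTS; apply: measurable_sum => j; apply: measurable_funM.
  exact: (measurableT_comp (measurable_sp_coef (ltn_ord j)) measurable_snd).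
have mi : measurable_fun setT (\1_(`]sp_left phi j, sp_right phi j]) : measurableTypeR R -> R).
  exact: measurable_indic.
exact: (measurableT_comp mi measurable_fst).
Qed.

Lemma Rintegral_sp_value_sqr w :
  (\int[mu]_(s in `[0%R, t]) (sp_value phi s w ^+ 2)%:E =
   (\sum_(i < sp_size phi) \sum_(j < sp_size phi) xi i w * xi j w * ov i j)%:E)%E.
Proof.
pose ind (i : nat) := \1_(`]sp_left phi i, sp_right phi i]) : R -> R.
have E s : (sp_value phi s w ^+ 2)%:E = (\sum_(i < sp_size phi) \sum_(j < sp_size phi)
    ((xi i w * xi j w)%:E * (ind i s * ind j s)%:E))%E.
  rewrite expr2 /sp_value big_distrlr/= -sumEFin; apply: eq_bigr => i _.
  by rewrite -sumEFin; apply: eq_bigr => j _; rewrite -EFinM mulrACA.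
have ii i j : mu.-integrable `[0%R, t] (fun s => (ind i s * ind j s)%:E).
  apply: (integrableS measurableT) => //.
  apply: le_integrable (integrable_indic_itv (sp_left phi j) (sp_right phi j) false false) => //.
    by apply/measurable_EFinP; apply: measurable_funM; exact: measurable_indic.
  move=> s _ /=; rewrite lee_fin normrM ler_piMl// /ind indicE.
  by case: (_ \in _); rewrite ?normr1 ?normr0.
under eq_integral do rewrite E.
rewrite integral_sum//; last first.
  by move=> i; apply: integrable_sum => // j _; exact: integrableZl.
rewrite -sumEFin; apply: eq_bigr => i _.
rewrite integral_sum//; last by move=> j; exact: integrableZl.
rewrite -sumEFin; apply: eq_bigr => j _.
rewrite integralZl// Rintegral_indic_overlap//.
- by have [] := sp_interval (ltn_ord i).
- by have [] := sp_interval (ltn_ord i).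
Qed.

(** Both sides expand into the double sum of E[xi_i xi_j] times the overlap of the intervals i and
    j, the left one with the factor [kappa] from the variance of the increments. *)
Lemma simple_ito_isometry :
  (\int[P]_w (sp_integral W phi w ^+ 2)%:E =
   kappa%:E * \int[P]_w \int[mu]_(s in `[0%R, t]) (sp_value phi s w ^+ 2)%:E)%E.
Proof.
have cross (i j : 'I_(sp_size phi)) := expectation_increments fF bW
  (let: And3 l0 _ _ := sp_interval (ltn_ord i) in l0)
  (let: And3 _ lr _ := sp_interval (ltn_ord i) in lr)
  (let: And3 l0 _ _ := sp_interval (ltn_ord j) in l0)
  (let: And3 _ lr _ := sp_interval (ltn_ord j) in lr)
  (sp_coef_measurable (ltn_ord i)) (sp_coef_measurable (ltn_ord j))
  (sp_coef_bounded (ltn_ord i)) (sp_coef_bounded (ltn_ord j)).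
have ixx (i j : 'I_(sp_size phi)) : P.-integrable setT (fun w => (xi i w * xi j w)%:E).
  apply: bounded_integrable.
    by apply: measurable_funM; exact: measurable_sp_coef.
  by apply: bounded_rvM; exact: sp_coef_bounded.
have ixo (i j : 'I_(sp_size phi)) : P.-integrable setT (fun w => (xi i w * xi j w * ov i j)%:E).
  under eq_fun do rewrite EFinM.
  exact: (integrableZr _ _ (ixx i j)).
pose m (i j : 'I_(sp_size phi)) := fine (\int[P]_w (xi i w * xi j w)%:E)%E.
have mE (i j : 'I_(sp_size phi)) : (\int[P]_w (xi i w * xi j w)%:E = (m i j)%:E)%E.
  by rewrite fineK//; exact: (integrable_fin_num _ (ixx i j)).
have -> : (\int[P]_w \int[mu]_(s in `[0%R, t]) (sp_value phi s w ^+ 2)%:E =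
    (\sum_(i < sp_size phi) \sum_(j < sp_size phi) m i j * ov i j)%:E)%E.
  under eq_integral do rewrite Rintegral_sp_value_sqr -sumEFin.
  rewrite integral_sum//; last first.
    move=> i; under eq_fun do rewrite -sumEFin.
    by apply: integrable_sum => // j _.
  rewrite -sumEFin; apply: eq_bigr => i _.
  under eq_integral do rewrite -sumEFin.
  rewrite integral_sum//.
  rewrite -sumEFin; apply: eq_bigr => j _.
  under eq_integral do rewrite EFinM.
  by rewrite integralZr// mE.
have E w : (sp_integral W phi w ^+ 2)%:E = (\sum_(i < sp_size phi) \sum_(j < sp_size phi)
    (xi i w * dW (sp_left phi i) (sp_right phi i) w *
     (xi j w * dW (sp_left phi j) (sp_right phi j) w))%:E)%E.
  rewrite expr2 /sp_integral big_distrlr/= -sumEFin; apply: eq_bigr => i _.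
  by rewrite -sumEFin.
under eq_integral do rewrite E.
rewrite integral_sum//; last first.
  by move=> i; apply: integrable_sum => // j _; exact: (cross i j).1.
rewrite -EFinM mulr_sumr -sumEFin; apply: eq_bigr => i _.
rewrite integral_sum//; last by move=> j; exact: (cross i j).1.
rewrite mulr_sumr -sumEFin; apply: eq_bigr => j _.
by rewrite (cross i j).2 mE -EFinM mulrCA.
Qed.

End simple.
End ito.

Section sqr3.
Local Open Scope ereal_scope.
Context d (T : measurableType d) (R : realType) (m : {measure set T -> \bar R}).
Variables (D : set T) (mD : measurable D).

Lemma integral_le_sqr3 (f g1 g2 g3 : T -> R) :
  measurable_fun D f ->
  measurable_fun D g1 -> measurable_fun D g2 -> measurable_fun D g3 ->
  (forall x, D x -> f x = g1 x + g2 x + g3 x)%R ->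
  \int[m]_(x in D) (f x ^+ 2)%:E <=
  3%:E * (\int[m]_(x in D) (g1 x ^+ 2)%:E + \int[m]_(x in D) (g2 x ^+ 2)%:E
          + \int[m]_(x in D) (g3 x ^+ 2)%:E).
Proof.
move=> mf m1 m2 m3 fE.
have mS (g : T -> R) : measurable_fun D g -> measurable_fun D (fun x => (g x ^+ 2)%:E).
  by move=> mg; apply/measurable_EFinP; exact: measurable_funX.
have S0 (g : T -> R) x : D x -> 0 <= (g x ^+ 2)%:E by rewrite lee_fin sqr_ge0.
rewrite -!ge0_integralD//; try exact: mS; try by move=> x Dx; exact: S0.
- rewrite -ge0_integralZl_EFin//; last 2 first.
  + by move=> x Dx; rewrite !adde_ge0 ?S0.
  + by apply: emeasurable_funD; [apply: emeasurable_funD|]; exact: mS.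
  apply: ge0_le_integral => //.
  + by move=> x Dx; exact: S0.
  + exact: mS.
  + by apply: measurable_funeM; apply: emeasurable_funD; [apply: emeasurable_funD|]; exact: mS.
  move=> x Dx; rewrite -!EFinD -EFinM lee_fin fE//.
  have := sqr_ge0 (g1 x - g2 x); have := sqr_ge0 (g1 x - g3 x).
  by have := sqr_ge0 (g2 x - g3 x); nra.
- by move=> x Dx; rewrite adde_ge0 ?S0.
- by apply: emeasurable_funD; exact: mS.
Qed.

End sqr3.

(** * Comparison of two Ito integrals *)

Section ito.
Local Open Scope ereal_scope.
Context {R : realType} {d : measure_display} {Omega : measurableType d}.
Variables (P : probability Omega R) (F : R -> set (set Omega)).
Variable W : R -> Omega -> R.
Hypotheses (fF : filtration F) (bW : brownian_motion P F W).
Local Notation kappa := (@kappa R).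
Local Notation mu := (@lebesgue_measure R).

Lemma double_integral_le_sqr3 (D : set R) (f g1 g2 g3 : R -> Omega -> R) :
  measurable D -> jointly_measurable D f ->
  jointly_measurable D g1 -> jointly_measurable D g2 -> jointly_measurable D g3 ->
  (forall s w, f s w = g1 s w + g2 s w + g3 s w)%R ->
  \int[P]_w \int[mu]_(s in D) (f s w ^+ 2)%:E <=
  3%:E * (\int[P]_w \int[mu]_(s in D) (g1 s w ^+ 2)%:E
    + \int[P]_w \int[mu]_(s in D) (g2 s w ^+ 2)%:E
    + \int[P]_w \int[mu]_(s in D) (g3 s w ^+ 2)%:E).
Proof.
move=> mD mf m1 m2 m3 fE.
have mS g : jointly_measurable D g ->
    measurable_fun setT (fun w => \int[mu]_(s in D) (g s w ^+ 2)%:E).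
  move=> mg; apply: (@measurable_integral_time _ _ _ D (fun s w => g s w ^+ 2)%R) => //.
  - exact: measurable_funX.
  - by move=> s w _; exact: sqr_ge0.
have S0 (g : R -> Omega -> R) w : 0 <= \int[mu]_(s in D) (g s w ^+ 2)%:E.
  by apply: integral_ge0 => s _; rewrite lee_fin sqr_ge0.
rewrite -!ge0_integralD//; try exact: mS; try by move=> w _; exact: S0.
- rewrite -ge0_integralZl_EFin//; last 2 first.
  + by move=> w _; apply: adde_ge0; [apply: adde_ge0|]; exact: S0.
  + by apply: emeasurable_funD; [apply: emeasurable_funD|]; exact: mS.
  apply: ge0_le_integral => //.
  + exact: mS.
  + by apply: measurable_funeM; apply: emeasurable_funD; [apply: emeasurable_funD|]; exact: mS.
  by move=> w _; apply: integral_le_sqr3 => //; exact: jointly_measurable_path.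
- by move=> w _; apply: adde_ge0; exact: S0.
- by apply: emeasurable_funD; exact: mS.
Qed.

(** [is_ito_integral] only provides approximations. I - J is compared with the integral of the
    simple process phi_k - psi_k, to which the isometry applies, and that process with Phi - Psi.
    Each comparison splits into three terms and costs a factor 3, hence 9. *)
Lemma ito_integral_difference (t : R) (Phi Psi : R -> Omega -> R) (I J : Omega -> R) :
  is_ito_integral P F W t Phi I -> is_ito_integral P F W t Psi J ->
  \int[P]_w ((I w - J w) ^+ 2)%:E <=
  (9 * kappa)%:E * \int[P]_w \int[mu]_(s in `[0%R, t]) ((Phi s w - Psi s w) ^+ 2)%:E.
Proof.
move=> [_ mPhi _ mI [phi [phiPhi phiI]]] [_ mPsi _ mJ [psi [psiPsi psiJ]]].
set Q := \int[P]_w \int[mu]_(s in _) _.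
have k0 := @kappa_ge0 R.
apply/lee_addgt0Pr => e e0.
(* The approximation errors amount to 3 (eps + eps) for I - J and to 3 [kappa] times 3 (eps + eps)
   for the integrand. *)
have c0 : (0 < 6 + 18 * kappa)%R by rewrite ltr_wpDr// mulr_ge0.
pose eps := (e / (6 + 18 * kappa))%R.
have eps0 : (0 < eps)%R by rewrite divr_gt0.
have small (u : nat -> \bar R) : u k @[k --> \oo] --> 0 -> \forall k \near \oo, u k <= eps%:E.
  move=> /fine_cvgP[finu] /cvgrPdist_le /(_ _ eps0) cu; near=> k.
  have fk : u k \is a fin_num by near: k.
  rewrite -(fineK fk) lee_fin.
  have : (`|0 - fine (u k)| <= eps)%R by near: k.
  by rewrite sub0r normrN; apply: le_trans; exact: ler_norm.
have [k _ /(_ _ (leqnn k)) [[a1 a2] [a3 a4]]] : \forall k \near \oo,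
   ((\int[P]_w \int[mu]_(s in `[0%R, t]) ((sp_value (phi k) s w - Phi s w) ^+ 2)%R%:E <= eps%:E /\
   'E_P[fun w => ((sp_integral W (phi k) w - I w) ^+ 2)%R] <= eps%:E) /\
   (\int[P]_w \int[mu]_(s in `[0%R, t]) ((sp_value (psi k) s w - Psi s w) ^+ 2)%R%:E <= eps%:E /\
   'E_P[fun w => ((sp_integral W (psi k) w - J w) ^+ 2)%R] <= eps%:E)).
  near=> k; do 2 split.
  - by near: k; exact: small phiPhi.
  - by near: k; exact: small phiI.
  - by near: k; exact: small psiPsi.
  - by near: k; exact: small psiJ.
pose S := spB fF (phi k) (psi k).
have mS1 := measurable_sp_integral fF bW (phi k).
have mS2 := measurable_sp_integral fF bW (psi k).
have mSB := measurable_sp_integral fF bW S.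
have jS1 := jointly_measurable_sp_value fF (phi k) (D := `[0%R, t]).
have jS2 := jointly_measurable_sp_value fF (psi k) (D := `[0%R, t]).
have jSB := jointly_measurable_sp_value fF S (D := `[0%R, t]).
have b1 : \int[P]_w ((I w - J w) ^+ 2)%:E <= 3%:E * (eps%:E + eps%:E +
    \int[P]_w (sp_integral W S w ^+ 2)%:E).
  apply: (@le_trans _ _ (3%:E * (\int[P]_w ((sp_integral W (phi k) w - I w) ^+ 2)%:E
      + \int[P]_w ((sp_integral W (psi k) w - J w) ^+ 2)%:E
      + \int[P]_w (sp_integral W S w ^+ 2)%:E))).
    have -> : \int[P]_w ((sp_integral W (phi k) w - I w) ^+ 2)%:E =
        \int[P]_w ((I w - sp_integral W (phi k) w) ^+ 2)%:E.
      by apply: eq_integral => w _; rewrite -sqrrN opprB.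
    apply: integral_le_sqr3 => //; try exact: measurable_funB.
    by move=> w _; rewrite /S sp_integralB; ring.
  by rewrite unlock in a2 a4; apply: lee_wpmul2l => //; rewrite leeD2r// leeD.
rewrite (simple_ito_isometry fF bW) in b1.
have b2 : \int[P]_w \int[mu]_(s in `[0%R, t]) (sp_value S s w ^+ 2)%:E <=
    3%:E * (eps%:E + eps%:E + Q).
  apply: (@le_trans _ _ (3%:E * (
      \int[P]_w \int[mu]_(s in `[0%R, t]) ((sp_value (phi k) s w - Phi s w) ^+ 2)%:E
      + \int[P]_w \int[mu]_(s in `[0%R, t]) ((sp_value (psi k) s w - Psi s w) ^+ 2)%:E
      + Q))).
    have -> : \int[P]_w \int[mu]_(s in `[0%R, t]) ((sp_value (psi k) s w - Psi s w) ^+ 2)%:E =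
        \int[P]_w \int[mu]_(s in `[0%R, t]) ((Psi s w - sp_value (psi k) s w) ^+ 2)%:E.
      by apply: eq_integral => w _; apply: eq_integral => s _; rewrite -sqrrN opprB.
    apply: double_integral_le_sqr3 => //; try exact: measurable_funB.
    by move=> s w; rewrite /S sp_valueB; ring.
  by apply: lee_wpmul2l => //; rewrite leeD2r// leeD.
apply: (le_trans b1).
apply: (@le_trans _ _ (3%:E * (eps%:E + eps%:E + kappa%:E * (3%:E * (eps%:E + eps%:E + Q))))).
  by apply: lee_wpmul2l => //; rewrite leeD2l// lee_wpmul2l// lee_fin.
have Q0 : 0 <= Q.
  by apply: integral_ge0 => w _; apply: integral_ge0 => s _; rewrite lee_fin sqr_ge0.
have -> : e%:E = (6 * eps + 18 * kappa * eps)%:E.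
  by congr EFin; rewrite /eps; field; rewrite gt_eqF.
clear b2; move: Q0; case: Q => [q| |] //= q0.
  by rewrite lee_fin; lra.
(* Q is infinite here. If [kappa] were 0, the convention 0 * +oo = 0 would leave 6 eps on both
   sides; otherwise the right side is +oo. *)
have [->|kp] := eqVneq kappa 0%R.
  by rewrite !(mulr0, mul0r, mul0e, mule0, addr0, adde0, add0e) -!EFinD -EFinM lee_fin; lra.
rewrite [leRHS](_ : _ = +oo) ?leey//.
by rewrite gt0_muley ?addye// lte_fin mulr_gt0// lt0r kp k0.
Unshelve. all: by end_near. Qed.

End ito.

(** * Stability of Volterra equations with respect to the kernel *)

Section gronwall.
Local Open Scope ereal_scope.
Context {R : realType}.
Local Notation mu := (@lebesgue_measure R).

Lemma measurable_expRN (c : R) (D : set R) :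
  measurable_fun D (fun s : R => expR (- (c * s))).
Proof.
apply: measurable_funTS; apply: measurableT_comp => //.
by apply: measurable_funN; apply: measurable_funM.
Qed.

(** Dominated convergence along integer theta: exp (- s)^k tends to 0 for s > 0. The point s = 0,
    where it stays equal to 1, is removed as a null set. *)
Lemma exists_damping (T : R) (g : R -> R) (eta : R) :
  measurable_fun `[0%R, T] g -> (forall s, 0 <= g s)%R ->
  \int[mu]_(s in `[0%R, T]) (g s)%:E < +oo -> (0 < eta)%R ->
  exists2 theta : R, (0 <= theta)%R &
    \int[mu]_(s in `[0%R, T]) (expR (- (theta * s)) * g s)%:E <= eta%:E.
Proof.
move=> mg g0 goo eta0.
have sub : (`]0%R, T]%classic : set R) `<=` `[0%R, T]%classic.
  by apply: subset_itvr; rewrite bnd_simp.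
have mgo : measurable_fun `]0%R, T] g by apply: measurable_funS mg.
have me k : measurable_fun `]0%R, T] (fun s : R => (g s * expR (- s) ^+ k)%R).
  apply: measurable_funM => //; apply: measurable_funTS.
  by apply: measurable_funX; apply: measurableT_comp => //; exact: measurable_oppr.
have ig : mu.-integrable `]0%R, T] (EFin \o g).
  apply/integrableP; split; first exact/measurable_EFinP.
  under eq_integral do rewrite /= ger0_norm//.
  apply: le_lt_trans goo; apply: ge0_subset_integral => //.
    exact/measurable_EFinP.
  by move=> s _; rewrite lee_fin.
have cv : \int[mu]_(s in `]0%R, T]) (g s * expR (- s) ^+ k)%:E @[k --> \oo] -->
    \int[mu]_(s in `]0%R, T]) cst 0 s.
  apply: (@dominated_cvg _ _ _ mu _ _ (fun k s => (g s * expR (- s) ^+ k)%:E) _ (EFin \o g)) => //.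
  - by move=> k; apply/measurable_EFinP; exact: me.
  - move=> s /=; rewrite in_itv/= => /andP[s0 _].
    apply: cvg_EFin; first exact: nearW.
    apply: (@cvg_geometric R (g s) (expR (- s))).
    by rewrite ger0_norm ?expR_ge0// expR_lt1 oppr_lt0.
  - move=> k s /=; rewrite in_itv/= => /andP[s0 _].
    rewrite lee_fin ger0_norm ?mulr_ge0 ?exprn_ge0 ?expR_ge0//.
    rewrite ler_piMr// exprn_ile1 ?expR_ge0// ltW// expR_lt1 oppr_lt0//.
rewrite integral0 in cv.
move/fine_cvgP : cv => [fin] /cvgrPdist_le /(_ _ eta0) cv.
have [k _ /(_ _ (leqnn k)) [fk le]] : \forall k \near \oo,
    \int[mu]_(s in `]0%R, T]) (g s * expR (- s) ^+ k)%:E \is a fin_num /\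
    (`|0 - fine (\int[mu]_(s in `]0%R, T]) (g s * expR (- s) ^+ k)%:E)| <= eta)%R.
  by near=> k; split; near: k.
exists k%:R => //.
rewrite -integral_itv_obnd_cbnd; last first.
  by apply/measurable_EFinP; apply: measurable_funM => //; exact: measurable_expRN.
under eq_integral do rewrite mulrC -mulrN expRM_natl.
rewrite -(fineK fk) lee_fin; move: le; rewrite sub0r normrN.
by apply: le_trans; exact: ler_norm.
Unshelve. all: by end_near. Qed.

(* Each application of the hypothesis halves the part of the bound beyond
   [2 * E], in the norm weighted by [expR (- theta * t)]. *)
Lemma volterra_gronwall (T A E V theta : R) (k : R -> R) (u : R -> \bar R) :
  (0 <= A)%R -> (0 <= E)%R -> (0 <= theta)%R ->
  measurable_fun `[0%R, T] k -> (forall s, 0 <= k s)%R ->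
  measurable_fun `[0%R, T] u ->
  (forall s, (0 <= s <= T)%R -> 0 <= u s) ->
  (forall s, (0 <= s <= T)%R -> u s <= V%:E) ->
  A%:E * \int[mu]_(s in `[0%R, T]) (expR (- (theta * s)) * k s)%:E <= (2^-1)%:E ->
  (forall t, (0 <= t <= T)%R ->
    u t <= A%:E * \int[mu]_(s in `[0%R, t]) ((k (t - s))%:E * u s) + E%:E) ->
  forall t, (0 <= t <= T)%R -> u t <= (2 * E * expR (theta * T))%:E.
Proof.
move=> A0 E0 th0 mk k0 mu_ u0 uV half ineq.
have [V0|V0] := ltP V 0%R.
  move=> t tT; have := le_trans (u0 t tT) (uV t tT).
  by rewrite lee_fin leNgt V0.
(* If u is at most c exp (theta t), then by [half] it is at most (c / 2 + E) exp (theta t); starting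
   from c = 2 E + V, this gives 2 E + V / 2^n after n rounds. *)
have step n : forall t, (0 <= t <= T)%R ->
    u t <= ((2 * E + V / 2 ^+ n) * expR (theta * t))%:E.
  elim: n => [|n IH] t /andP[t0 tT].
    rewrite (le_trans (uV _ _)) ?t0// lee_fin expr0 divr1.
    have : (1 <= expR (theta * t))%R by rewrite -expR0 ler_expR mulr_ge0.
    by nra.
  rewrite (le_trans (ineq _ _)) ?t0//.
  set c := (2 * E + V / 2 ^+ n)%R in IH.
  have c0 : (0 <= c)%R by rewrite addr_ge0 ?mulr_ge0// invr_ge0 exprn_ge0.
  have sub : (`[0%R, t]%classic : set R) `<=` `[0%R, T]%classic.
    by apply: subset_itvl; rewrite bnd_simp.
  have mkt : measurable_fun `[0%R, t] (fun s => k (t - s)%R).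
    apply: (measurable_comp (F := `[0%R, T])) => //.
    - move=> _ [s /= + <-]; rewrite !in_itv/= => /andP[s0 st].
      by rewrite subr_ge0 st (le_trans _ tT)// lerBlDr lerDl.
    - by apply: measurable_funTS; exact: measurable_funB.
  have me : measurable_fun `[0%R, T] (fun s : R => (expR (- (theta * s)) * k s)%R).
    by apply: measurable_funM => //; exact: measurable_expRN.
  have mte : measurable_fun `[0%R, t] (fun s : R => expR (- (theta * (t - s)))).
    apply: (measurable_comp (F := setT) (f := fun s : R => expR (- (theta * s)))
      (g := fun s : R => (t - s)%R)) => //; first exact: measurable_expRN.
    by apply: measurable_funTS; exact: measurable_funB.
  have I1 : \int[mu]_(s in `[0%R, t]) ((k (t - s))%:E * u s) <=
      (c * expR (theta * t))%:E *
      \int[mu]_(s in `[0%R, t]) (expR (- (theta * (t - s))) * k (t - s))%:E.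
    rewrite -ge0_integralZl_EFin//; last 3 first.
    - by move=> s _; rewrite lee_fin mulr_ge0 ?expR_ge0.
    - apply/measurable_EFinP; exact: measurable_funM.
    - by rewrite mulr_ge0 ?expR_ge0.
    apply: ge0_le_integral => //.
    - move=> s /=; rewrite in_itv/= => /andP[s0 st].
      by rewrite mule_ge0 ?lee_fin// u0// s0 (le_trans st).
    - apply: emeasurable_funM; first exact/measurable_EFinP.
      exact: measurable_funS mu_.
    - apply: measurable_funeM; apply/measurable_EFinP; exact: measurable_funM.
    move=> s /=; rewrite in_itv/= => /andP[s0 st].
    (* exp (theta s) = exp (theta t) exp (- theta (t - s)): the weight on u becomes the damping of
       the kernel. *)
    have -> : ((c * expR (theta * t))%:E * (expR (- (theta * (t - s))) * k (t - s))%:E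
        = (k (t - s))%:E * (c * expR (theta * s))%:E).
      rewrite -!EFinM; congr EFin.
      rewrite mulrA -(mulrA c) -expRD mulrC; congr (_ * (_ * expR _))%R.
      by ring.
    by rewrite lee_wpmul2l ?lee_fin// IH// s0 (le_trans st).
  rewrite (ge0_integral_reflect (f := fun s => (expR (- (theta * s)) * k s)%:E)) in I1; last 2 first.
  - by apply: measurable_funS (sub) _ => //; exact/measurable_EFinP.
  - by move=> s _; rewrite lee_fin mulr_ge0 ?expR_ge0.
  have I2 : A%:E * \int[mu]_(s in `[0%R, t]) (expR (- (theta * s)) * k s)%:E <= (2^-1)%:E.
    apply: le_trans half; apply: lee_wpmul2l; first by rewrite lee_fin.
    apply: ge0_subset_integral => //; first exact/measurable_EFinP.
    by move=> s _; rewrite lee_fin mulr_ge0 ?expR_ge0.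
  have I3 : A%:E * \int[mu]_(s in `[0%R, t]) ((k (t - s))%:E * u s) <=
      (c * expR (theta * t) / 2)%:E.
    apply: (le_trans (lee_wpmul2l _ I1)); first by rewrite lee_fin.
    rewrite muleCA [leRHS]EFinM; apply: lee_wpmul2l => //.
    by rewrite lee_fin mulr_ge0 ?expR_ge0.
  apply: (le_trans (leeD2r _ I3)).
  rewrite -EFinD lee_fin /c exprS.
  have e1 : (1 <= expR (theta * t))%R by rewrite -expR0 ler_expR mulr_ge0.
  have -> : (V / (2 * 2 ^+ n) = V / 2 ^+ n / 2)%R by rewrite invfM mulrA mulrAC.
  by move: (V / 2 ^+ n)%R => v; nra.
(* Passage to the limit in n, with V / 2^n brought below e exp (- theta T). *)
move=> t tT; apply/lee_addgt0Pr => e e0.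
have e10 : (0 < e / expR (theta * T))%R by rewrite divr_gt0 ?expR_gt0.
have := @cvg_geometric R V 2^-1.
rewrite ger0_norm// invf_lt1// ltr1n => /(_ isT) /cvgrPdist_le /(_ _ e10) [n _ /(_ _ (leqnn n))].
rewrite sub0r normrN /geometric/= exprVn ger0_norm; last first.
  by rewrite mulr_ge0// invr_ge0 exprn_ge0.
move=> Vn; rewrite (le_trans (step n t tT))// -EFinD lee_fin.
have [t0 tT'] := andP tT.
have : (expR (theta * t) <= expR (theta * T))%R by rewrite ler_expR ler_wpM2l.
have := expR_ge0 (theta * t).
have Vn0 : (0 <= V / 2 ^+ n)%R by rewrite mulr_ge0// invr_ge0 exprn_ge0.
move: Vn; rewrite ler_pdivlMr ?expR_gt0//.
by move: (V / 2 ^+ n)%R Vn0 => v; nra.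
Qed.

End gronwall.

Section lipschitz.
Context {R : realType}.

Definition lipschitz_bound (L : R) (f : R -> R) :=
  forall x y, `|f x - f y| <= L * `|x - y|.

Lemma lipschitz_exists_bound (f : R -> R) : lipschitz f ->
  exists2 L : R, 0 <= L & lipschitz_bound L f.
Proof.
(* [lipschitz] grants the estimate for every constant beyond some real M; |M| + 1 is one of them and
   is nonnegative. *)
move=> [M [_ fM]]; exists (`|M| + 1); first by rewrite addr_ge0.
move=> x y; have := fM (`|M| + 1); rewrite (le_lt_trans (ler_norm M))// ?ltrDl//.
by move=> /(_ isT (x, y)); apply.
Qed.

Lemma lipschitz_bound_continuous (L : R) (f : R -> R) : 0 <= L ->
  lipschitz_bound L f -> continuous f.
Proof.
move=> L0 fL x; apply/cvgrPdist_le => e e0.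
have L1 : 0 < L + 1 by rewrite ltr_wpDl.
near=> y; rewrite (le_trans (fL _ _))//.
have : `|x - y| <= e / (L + 1).
  near: y; apply: cvgr_dist_le; first exact: cvg_id.
  by rewrite divr_gt0.
rewrite ler_pdivlMr//; have := normr_ge0 (x - y); nra.
Unshelve. all: by end_near. Qed.

Lemma lipschitz_bound_measurable (L : R) (f : R -> R) : 0 <= L ->
  lipschitz_bound L f -> measurable_fun setT f.
Proof.
move=> L0 fL; apply: continuous_measurable_fun.
exact: (lipschitz_bound_continuous L0 fL).
Qed.

End lipschitz.

(** * Mean square of the difference of two convolution integrands *)

Section kernel_term.
Local Open Scope ereal_scope.
Context {R : realType} {d : measure_display} {Omega : measurableType d}.
Variables (P : probability Omega R).
Local Notation mu := (@lebesgue_measure R).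

Lemma jointly_measurable_convolution (t : R) (g f : R -> R) (Y : R -> Omega -> R) :
  measurable_fun `[0%R, t] g -> measurable_fun setT f ->
  jointly_measurable `[0%R, t] Y ->
  jointly_measurable `[0%R, t] (fun s w => g (t - s) * f (Y s w))%R.
Proof.
move=> mg mf mY; apply: measurable_funM; last exact: (measurableT_comp mf).
have mgt : measurable_fun `[0%R, t] (fun s => g (t - s)%R).
  apply: (measurable_comp (F := `[0%R, t])) => //.
  - move=> _ [s /= + <-]; rewrite !in_itv/= => /andP[s0 st].
    by rewrite subr_ge0 st lerBlDr lerDl.
  - by apply: measurable_funTS; exact: measurable_funB.
apply: (measurable_comp (F := `[0%R, t] : set (measurableTypeR R))
  (f := fun s : measurableTypeR R => g (t - s)%R)
  (g := fst : measurableTypeR R * Omega -> measurableTypeR R)) => //.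
- by move=> _ [[s w] [/= ? _] <-].
- by apply: measurable_funTS; exact: measurable_fst.
Qed.

Definition sqr_dist (X Y : R -> Omega -> R) (s : R) : \bar R :=
  \int[P]_w ((X s w - Y s w) ^+ 2)%:E.

(** The integrand is h (f(Y) - f(X)) + (h - g) f(X), with the kernels taken at t - s. The Lipschitz
    bound handles the first part, and f(x)^2 <= 2 (c + L^2 x^2) the second. No moment of Y appears,
    which makes the constants uniform over the approximating kernels h. *)
Lemma kernel_term (t L c M : R) (g h f : R -> R) (X Y : R -> Omega -> R) :
  measurable_fun `[0%R, t] g -> measurable_fun `[0%R, t] h ->
  (0 <= L)%R -> lipschitz_bound L f -> (f 0 ^+ 2 <= c)%R ->
  jointly_measurable `[0%R, t] X -> jointly_measurable `[0%R, t] Y ->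
  (forall s, (0 <= s <= t)%R -> \int[P]_w (X s w ^+ 2)%:E <= M%:E) ->
  \int[P]_w \int[mu]_(s in `[0%R, t])
    ((h (t - s) * f (Y s w) - g (t - s) * f (X s w)) ^+ 2)%:E <=
  (2 * L ^+ 2)%:E * \int[mu]_(s in `[0%R, t]) ((h (t - s) ^+ 2)%:E * sqr_dist Y X s)
  + (4 * (c + L ^+ 2 * M))%:E * \int[mu]_(s in `[0%R, t]) ((h s - g s) ^+ 2)%:E.
Proof.
move=> mg mh L0 fL fc mX mY XM.
have mf := lipschitz_bound_measurable L0 fL.
have mD : jointly_measurable `[0%R, t]
    (fun s w => h (t - s) * f (Y s w) - g (t - s) * f (X s w))%R.
  exact: (measurable_funB (jointly_measurable_convolution mh mf mY)
    (jointly_measurable_convolution mg mf mX)).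
have mD2 : jointly_measurable `[0%R, t]
    (fun s w => (h (t - s) * f (Y s w) - g (t - s) * f (X s w)) ^+ 2)%R.
  exact: measurable_funX.
have mZ2 : jointly_measurable `[0%R, t] (fun s w => (Y s w - X s w) ^+ 2)%R.
  by apply: measurable_funX; exact: measurable_funB.
have refl (q : R -> R) : measurable_fun `[0%R, t] q ->
    measurable_fun `[0%R, t] (fun s => q (t - s)%R).
  move=> mq; apply: (measurable_comp (F := `[0%R, t])) => //.
  - move=> _ [s /= + <-]; rewrite !in_itv/= => /andP[s0 st].
    by rewrite subr_ge0 st lerBlDr lerDl.
  - by apply: measurable_funTS; exact: measurable_funB.
have mhg : measurable_fun `[0%R, t] (fun s => (h s - g s) ^+ 2)%R.
  by apply: measurable_funX; exact: measurable_funB.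
have mh2 : measurable_fun `[0%R, t] (fun s => (h s) ^+ 2)%R by exact: measurable_funX.
have msd : measurable_fun `[0%R, t] (sqr_dist Y X).
  apply: (@measurable_integral_proba _ _ _ P `[0%R, t] (fun s w => (Y s w - X s w) ^+ 2)%R) => //.
  by move=> s w _; exact: sqr_ge0.
rewrite (tonelli_swap P _ mD2)//; last by move=> s w _; exact: sqr_ge0.
have sd0 s : 0 <= sqr_dist Y X s.
  by apply: integral_ge0 => w _; rewrite lee_fin sqr_ge0.
have cLM0 : forall s, (0 <= s <= t)%R -> (0 <= c + L ^+ 2 * M)%R.
  move=> s st; have M0 : (0 <= M)%R.
    rewrite -lee_fin; apply: le_trans (XM s st).
    by apply: integral_ge0 => w _; rewrite lee_fin sqr_ge0.
  by rewrite addr_ge0 ?mulr_ge0 ?exprn_ge0// (le_trans _ fc) ?sqr_ge0.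
(* For t < 0 the interval is empty, and the sign of c + L^2 M is unknown: M >= 0 comes from a moment
   at a time of [0, t]. *)
have [t0|t0] := ltP t 0%R.
  have -> : `[0%R, t]%classic = set0 :> set R by rewrite set_itv_ge// bnd_simp -ltNge.
  by rewrite !integral_set0 !mule0 adde0.
have C0 : (0 <= 4 * (c + L ^+ 2 * M))%R.
  by rewrite mulr_ge0// (cLM0 0%R)// lexx.
rewrite -(ge0_integral_reflect (f := fun s => ((h s - g s) ^+ 2)%:E)); last 2 first.
- exact/measurable_EFinP.
- by move=> s _; rewrite lee_fin sqr_ge0.
rewrite -ge0_integralZl_EFin//; last 3 first.
- by move=> s _; rewrite mule_ge0// lee_fin sqr_ge0.
- by apply: emeasurable_funM => //; apply/measurable_EFinP; exact: (refl (fun s => h s ^+ 2)%R).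
- by rewrite mulr_ge0// exprn_ge0.
rewrite -ge0_integralZl_EFin//; last 2 first.
- by move=> s _; rewrite lee_fin sqr_ge0.
- by apply/measurable_EFinP; exact: (refl (fun s => (h s - g s) ^+ 2)%R).
rewrite -ge0_integralD//; last 4 first.
- by move=> s _; rewrite mule_ge0 ?lee_fin ?mulr_ge0 ?exprn_ge0// mule_ge0// lee_fin sqr_ge0.
- apply: measurable_funeM; apply: emeasurable_funM => //.
  by apply/measurable_EFinP; exact: (refl (fun s => h s ^+ 2)%R).
- by move=> s _; rewrite -EFinM lee_fin mulr_ge0// sqr_ge0.
- by apply: measurable_funeM; apply/measurable_EFinP; exact: (refl (fun s => (h s - g s) ^+ 2)%R).
apply: ge0_le_integral => //.
- by move=> s _; apply: integral_ge0 => w _; rewrite lee_fin sqr_ge0.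
- apply: (@measurable_integral_proba _ _ _ P) => //.
  by move=> s w _; exact: sqr_ge0.
- apply: emeasurable_funD; apply: measurable_funeM.
    apply: emeasurable_funM => //.
    by apply/measurable_EFinP; exact: (refl (fun s => h s ^+ 2)%R).
  by apply/measurable_EFinP; exact: (refl (fun s => (h s - g s) ^+ 2)%R).
move=> s /= st.
have mXs : measurable_fun setT (X s) by exact: (jointly_measurable_at _ mX).
have mYs : measurable_fun setT (Y s) by exact: (jointly_measurable_at _ mY).
set k := (h (t - s))%R; set e := (h (t - s) - g (t - s))%R.
have st' : (0 <= s <= t)%R by move: st; rewrite in_itv.
have mfX : measurable_fun setT (fun w => f (X s w)) by exact: measurableT_comp.
have mfY : measurable_fun setT (fun w => f (Y s w)) by exact: measurableT_comp.
apply: (@le_trans _ _ (\int[P]_w ((2 * L ^+ 2 * k ^+ 2)%:E * ((Y s w - X s w) ^+ 2)%:E +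
    ((4 * e ^+ 2 * c)%:E + (4 * e ^+ 2 * L ^+ 2)%:E * (X s w ^+ 2)%:E)))).
  apply: ge0_le_integral => //.
  - by move=> w _; rewrite lee_fin sqr_ge0.
  - apply/measurable_EFinP; apply: measurable_funX; apply: measurable_funB; exact: measurable_funM.
  - apply: emeasurable_funD.
      by apply: measurable_funeM; apply/measurable_EFinP; apply: measurable_funX; exact: measurable_funB.
    apply: emeasurable_funD => //.
    by apply: measurable_funeM; apply/measurable_EFinP; exact: measurable_funX.
  move=> w _; rewrite -!EFinM -!EFinD lee_fin.
  have l1 : ((f (Y s w) - f (X s w)) ^+ 2 <= L ^+ 2 * (Y s w - X s w) ^+ 2)%R.
    rewrite -exprMn -[leLHS]real_normK ?num_real// -[leRHS]real_normK ?num_real//.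
    by rewrite lerXn2r ?nnegrE// normrM (ger0_norm L0).
  have l2 : (f (X s w) ^+ 2 <= 2 * (c + L ^+ 2 * X s w ^+ 2))%R.
    have l3 : ((f (X s w) - f 0) ^+ 2 <= L ^+ 2 * X s w ^+ 2)%R.
      rewrite -exprMn -[leLHS]real_normK ?num_real// -[leRHS]real_normK ?num_real//.
      rewrite lerXn2r ?nnegrE// normrM (ger0_norm L0).
      by have := fL (X s w) 0%R; rewrite subr0.
    have := sqr_ge0 (f (X s w) - 2 * f 0)%R.
    by move: l3 fc; nra.
  have -> : (k * f (Y s w) - g (t - s) * f (X s w) =
      k * (f (Y s w) - f (X s w)) + e * f (X s w))%R by rewrite /k /e; ring.
  have := sqr_ge0 (k * (f (Y s w) - f (X s w)) - e * f (X s w))%R.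
  have k2 : (k ^+ 2 * (f (Y s w) - f (X s w)) ^+ 2 <= k ^+ 2 * (L ^+ 2 * (Y s w - X s w) ^+ 2))%R.
    by rewrite ler_wpM2l// sqr_ge0.
  have e2 : (e ^+ 2 * f (X s w) ^+ 2 <= e ^+ 2 * (2 * (c + L ^+ 2 * X s w ^+ 2)))%R.
    by rewrite ler_wpM2l// sqr_ge0.
  by nra.
have c0 : (0 <= c)%R by rewrite (le_trans _ fc)// sqr_ge0.
have a1 : (0 <= 2 * L ^+ 2 * k ^+ 2)%R by rewrite mulr_ge0 ?sqr_ge0// mulr_ge0 ?sqr_ge0.
have a2 : (0 <= 4 * e ^+ 2 * c)%R by rewrite mulr_ge0 ?sqr_ge0// mulr_ge0 ?sqr_ge0.
have a3 : (0 <= 4 * e ^+ 2 * L ^+ 2)%R by rewrite mulr_ge0 ?sqr_ge0// mulr_ge0 ?sqr_ge0.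
rewrite ge0_integralD//; last 4 first.
- by move=> w _; rewrite mule_ge0 ?lee_fin ?sqr_ge0.
- by apply: measurable_funeM; apply/measurable_EFinP; apply: measurable_funX; exact: measurable_funB.
- by move=> w _; rewrite adde_ge0 ?mule_ge0 ?lee_fin ?sqr_ge0.
- apply: emeasurable_funD => //.
  by apply: measurable_funeM; apply/measurable_EFinP; exact: measurable_funX.
rewrite ge0_integralD//; last 2 first.
- by move=> w _; rewrite mule_ge0 ?lee_fin ?sqr_ge0.
- by apply: measurable_funeM; apply/measurable_EFinP; exact: measurable_funX.
have -> : \int[P]_w (4 * e ^+ 2 * c)%:E = (4 * e ^+ 2 * c)%:E.
  by rewrite integral_cst// [X in _ * X]probability_setT mule1.
rewrite !ge0_integralZl_EFin//; last 4 first.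
- by move=> w _; rewrite lee_fin sqr_ge0.
- by apply/measurable_EFinP; exact: measurable_funX.
- by move=> w _; rewrite lee_fin sqr_ge0.
- by apply/measurable_EFinP; apply: measurable_funX; exact: measurable_funB.
rewrite leeD//.
  by rewrite -/(sqr_dist Y X s) muleA -EFinM.
apply: (@le_trans _ _ ((4 * e ^+ 2 * c)%:E + (4 * e ^+ 2 * L ^+ 2)%:E * M%:E)).
  by rewrite leeD2l// lee_wpmul2l ?XM// lee_fin.
by rewrite -!EFinM -EFinD lee_fin; lra.
Qed.

End kernel_term.

(** * Two solutions at a fixed time *)

Section volterra.
Local Open Scope ereal_scope.
Context {R : realType} {d : measure_display} {Omega : measurableType d}.
Variables (P : probability Omega R) (F : R -> set (set Omega)).
Variable W : R -> Omega -> R.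
Hypotheses (fF : filtration F) (bW : brownian_motion P F W).
Local Notation mu := (@lebesgue_measure R).
Local Notation kappa := (@kappa R).

(** The difference of two drift integrals is the integral of the difference once both integrands are
    integrable. The second moment comes from [kernel_term] with Y = X and h = 0, where only the term
    in g remains. *)
Lemma ae_integrable_convolution (t L M : R) (g f : R -> R) (X : R -> Omega -> R) :
  (0 <= t)%R -> measurable_fun `[0%R, t] g ->
  \int[mu]_(s in `[0%R, t]) (g s ^+ 2)%:E < +oo ->
  (0 <= L)%R -> lipschitz_bound L f ->
  jointly_measurable `[0%R, t] X ->
  (forall s, (0 <= s <= t)%R -> \int[P]_w (X s w ^+ 2)%:E <= M%:E) ->
  {ae P, forall w, mu.-integrable `[0%R, t] (fun s => (g (t - s) * f (X s w))%:E)}.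
Proof.
move=> t0 mg goo L0 fL mX XM.
have mf := lipschitz_bound_measurable L0 fL.
have mc := jointly_measurable_convolution mg mf mX.
have mc2 : jointly_measurable `[0%R, t] (fun s w => (g (t - s) * f (X s w)) ^+ 2)%R.
  exact: measurable_funX.
have m0 : measurable_fun `[0%R, t] (fun _ : R => 0%R : R) by [].
have := @kernel_term _ _ _ P t L (f 0 ^+ 2)%R M g (fun=> 0%R) f X X mg m0 L0 fL (lexx _) mX mX XM.
under [X in X <= _ -> _]eq_integral => w _.
  under eq_integral => s _ do rewrite mul0r sub0r sqrrN.
  over.
have -> : \int[mu]_(s in `[0%R, t]) (((fun=> 0%R) (t - s)%R ^+ 2)%:E * sqr_dist P X X s) = 0.
  by under eq_integral do rewrite expr0n mul0e; rewrite integral0.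
rewrite mule0 add0e.
under [X in _ <= _ * X -> _]eq_integral do rewrite sub0r sqrrN.
move=> le.
have loo : \int[P]_w \int[mu]_(s in `[0%R, t]) ((g (t - s) * f (X s w)) ^+ 2)%:E < +oo.
  apply: (le_lt_trans le); rewrite lte_mul_pinfty//.
    rewrite lee_fin mulr_ge0// addr_ge0 ?sqr_ge0// mulr_ge0 ?sqr_ge0//.
    rewrite -lee_fin; apply: (le_trans _ (XM 0%R _)); last by rewrite lexx.
    by apply: integral_ge0 => w _; rewrite lee_fin sqr_ge0.
have iP : P.-integrable setT (fun w => \int[mu]_(s in `[0%R, t]) ((g (t - s) * f (X s w)) ^+ 2)%:E).
  apply/integrableP; split.
    apply: (@measurable_integral_time _ _ _ `[0%R, t] (fun s w => (g (t - s) * f (X s w)) ^+ 2)%R) => //.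
    by move=> s w _; exact: sqr_ge0.
  under eq_integral => w _.
    rewrite gee0_abs; last by apply: integral_ge0 => s _; rewrite lee_fin sqr_ge0.
    over.
  exact: loo.
have := integrable_ae measurableT iP; apply: filterS => w /(_ I) fw.
apply: (@integrable_sqr _ _ (fun s => g (t - s) * f (X s w))%R) => //.
- by rewrite lebesgue_measure_itv/=; case: ifP => _; rewrite ?ltry// -EFinB ltry.
- exact: (jointly_measurable_path _ mc).
- by rewrite -ge0_fin_numE//; apply: integral_ge0 => s _; rewrite lee_fin sqr_ge0.
Qed.

(** (a + b)^2 <= 2 a^2 + 2 b^2 separates the drift, to which Cauchy-Schwarz on [0, t] adds the
    factor t, from the diffusion, where 2 times 9 [kappa] is 18 [kappa]. *)
Lemma volterra_sqr_dist (x0 : R) (b sigma G Gh : R -> R) (X Xh : R -> Omega -> R)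
    (t L : R) :
  volterra_solution P F W x0 b sigma G G X ->
  volterra_solution P F W x0 b sigma Gh Gh Xh ->
  (0 <= t)%R -> measurable_fun `[0%R, t] G -> measurable_fun `[0%R, t] Gh ->
  \int[mu]_(s in `[0%R, t]) (G s ^+ 2)%:E < +oo ->
  \int[mu]_(s in `[0%R, t]) (Gh s ^+ 2)%:E < +oo ->
  (0 <= L)%R -> lipschitz_bound L b ->
  sqr_dist P Xh X t <=
  (2 * t)%:E * \int[P]_w \int[mu]_(s in `[0%R, t])
    ((Gh (t - s) * b (Xh s w) - G (t - s) * b (X s w)) ^+ 2)%:E +
  (18 * kappa)%:E * \int[P]_w \int[mu]_(s in `[0%R, t])
    ((Gh (t - s) * sigma (Xh s w) - G (t - s) * sigma (X s w)) ^+ 2)%:E.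
Proof.
move=> [adX jX momX eqX] [adXh jXh momXh eqXh] t0 mG mGh Goo Ghoo L0 bL.
have sub : (`[0%R, t]%classic : set R) `<=` `[0%R, +oo[%classic.
  by apply: subset_itvl; rewrite bnd_simp.
have jmS (Z : R -> Omega -> R) : jointly_measurable `[0%R, +oo[ Z -> jointly_measurable `[0%R, t] Z.
  move=> jZ; apply: measurable_funS jZ; first exact: measurableX.
  by move=> [s w] [/= /sub ? _].
have mX := jmS _ jX; have mXh := jmS _ jXh.
have mom (Z : R -> Omega -> R) : (forall T : R, (0 <= T)%R -> exists M : R, forall t : R, (0 <= t <= T)%R ->
    'E_P[fun w => (`|Z t w| ^+ 2)%R] <= M%:E) ->
    exists M : R, forall s, (0 <= s <= t)%R -> \int[P]_w (Z s w ^+ 2)%:E <= M%:E.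
  move=> /(_ t t0)[N NP]; exists N => s st; have := NP s st; rewrite unlock.
  by under eq_integral do rewrite real_normK ?num_real//.
have [MX XM] := mom _ momX; have [MXh XhM] := mom _ momXh.
have aeX := ae_integrable_convolution t0 mG Goo L0 bL mX XM.
have aeXh := ae_integrable_convolution t0 mGh Ghoo L0 bL mXh XhM.
have [I [itoI XtE]] := eqX t t0; have [J [itoJ XhtE]] := eqXh t t0.
have mb := lipschitz_bound_measurable L0 bL.
have mD : jointly_measurable `[0%R, t]
    (fun s w => Gh (t - s) * b (Xh s w) - G (t - s) * b (X s w))%R.
  exact: (measurable_funB (jointly_measurable_convolution mGh mb mXh)
    (jointly_measurable_convolution mG mb mX)).
have mD2 : jointly_measurable `[0%R, t]
    (fun s w => (Gh (t - s) * b (Xh s w) - G (t - s) * b (X s w)) ^+ 2)%R.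
  exact: measurable_funX.
have mI2 : measurable_fun setT (fun w => \int[mu]_(s in `[0%R, t])
    ((Gh (t - s) * b (Xh s w) - G (t - s) * b (X s w)) ^+ 2)%:E).
  apply: (@measurable_integral_time _ _ _ `[0%R, t]
    (fun s w => (Gh (t - s) * b (Xh s w) - G (t - s) * b (X s w)) ^+ 2)%R) => //.
  by move=> s w _; exact: sqr_ge0.
have mI : measurable_fun setT I by case: itoI.
have mJ : measurable_fun setT J by case: itoJ.
have mXt := rv_measurable_fun fF t0 (adX t t0).
have mXht := rv_measurable_fun fF t0 (adXh t t0).
have mJI : measurable_fun setT (fun w => ((J w - I w) ^+ 2)%:E).
  by apply/measurable_EFinP; apply: measurable_funX; exact: measurable_funB.
have I20 w : 0 <= \int[mu]_(s in `[0%R, t])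
    ((Gh (t - s) * b (Xh s w) - G (t - s) * b (X s w)) ^+ 2)%:E.
  by apply: integral_ge0 => s _; rewrite lee_fin sqr_ge0.
apply: (@le_trans _ _ (\int[P]_w ((2 * t)%:E * \int[mu]_(s in `[0%R, t])
    ((Gh (t - s) * b (Xh s w) - G (t - s) * b (X s w)) ^+ 2)%:E +
    2%:E * ((J w - I w) ^+ 2)%:E))).
  apply: ae_ge0_le_integral => //.
  - by move=> w _; rewrite lee_fin sqr_ge0.
  - by apply/measurable_EFinP; apply: measurable_funX; exact: measurable_funB.
  - by move=> w _; rewrite adde_ge0 ?mule_ge0 ?lee_fin ?sqr_ge0 ?mulr_ge0.
  - by apply: emeasurable_funD; exact: measurable_funeM.
  apply: filter_app XtE; apply: filter_app XhtE.
  move: aeX aeXh; apply: filterS2 => w iX iXh -> -> _.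
  set DXh := Rintegral _ _ _; set DX := Rintegral _ _ _.
  have DE : (DXh - DX = \int[mu]_(s in `[0%R, t])
      (Gh (t - s) * b (Xh s w) - G (t - s) * b (X s w)))%R.
    by rewrite (RintegralB _ iXh iX).
  have le1 : ((DXh - DX) ^+ 2)%:E <= t%:E * \int[mu]_(s in `[0%R, t])
      ((Gh (t - s) * b (Xh s w) - G (t - s) * b (X s w)) ^+ 2)%:E.
    rewrite DE; apply: sqr_Rintegral_le => //.
    exact: (integrableB _ iXh iX).
  apply: (@le_trans _ _ (2%:E * ((DXh - DX) ^+ 2)%:E + 2%:E * ((J w - I w) ^+ 2)%:E)).
    rewrite -!EFinM -EFinD lee_fin.
    have := sqr_ge0 ((DXh - DX) - (J w - I w))%R.
    by clear; move: DXh DX (J w) (I w) => x1 x2 x3 x4; nra.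
  by rewrite leeD2r// (EFinM 2 t) -muleA; apply: lee_wpmul2l.
have k0 := @kappa_ge0 R.
rewrite ge0_integralD//; last 4 first.
- by move=> w _; rewrite mule_ge0// lee_fin mulr_ge0.
- exact: measurable_funeM.
- by move=> w _; rewrite mule_ge0// lee_fin sqr_ge0.
- exact: measurable_funeM.
rewrite !ge0_integralZl_EFin//; last 2 first.
- by move=> w _; rewrite lee_fin sqr_ge0.
- by rewrite mulr_ge0.
apply: leeD2l.
have ito2 : 2%:E * \int[P]_w ((J w - I w) ^+ 2)%:E <= 2%:E * ((9 * kappa)%:E *
    \int[P]_w \int[mu]_(s in `[0%R, t])
      ((Gh (t - s) * sigma (Xh s w) - G (t - s) * sigma (X s w)) ^+ 2)%:E).
  by apply: lee_wpmul2l => //; exact: (ito_integral_difference fF bW itoJ itoI).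
apply: (le_trans ito2); rewrite muleA -EFinM.
by have -> : (2 * (9 * kappa) = 18 * kappa)%R by ring.
Qed.

End volterra.

Lemma powRN_small (R : realType) (r e : R) : 0 < r -> 0 < e ->
  exists N, forall n, (0 < n)%N -> (N <= n)%N -> n%:R `^ (- r) <= e.
Proof.
move=> r0 e0; exists (Num.truncn (e^-1 `^ r^-1)).+1 => n n0 Nn.
rewrite powRN -[leRHS]invrK lef_pV2 ?posrE ?powR_gt0 ?ltr0n ?invr_gt0//.
have -> : e^-1 = (e^-1 `^ r^-1) `^ r.
  by rewrite -powRrM mulVf ?gt_eqF// powRr1// invr_ge0 ltW.
rewrite ge0_ler_powR ?nnegrE ?powR_ge0 ?ler0n ?(ltW r0)//.
by apply: (le_trans (ltW (truncnS_gt _))); rewrite ler_nat.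
Qed.

(** * From the distance of kernels to the distance of solutions *)

Section stability.
Local Open Scope ereal_scope.
Context {R : realType} {d : measure_display} {Omega : measurableType d}.
Variables (P : probability Omega R) (F : R -> set (set Omega)).
Variable W : R -> Omega -> R.
Hypotheses (fF : filtration F) (bW : brownian_motion P F W).
Local Notation mu := (@lebesgue_measure R).
Local Notation kappa := (@kappa R).

Variables (x0 T : R) (b sigma G : R -> R) (X : R -> Omega -> R).
Hypotheses (T0 : (0 <= T)%R) (mG : measurable_fun `[0%R, T] G).
Hypothesis Goo : \int[mu]_(s in `[0%R, T]) (G s ^+ 2)%:E < +oo.
Hypothesis solX : volterra_solution P F W x0 b sigma G G X.

Lemma moment_bound (Z : R -> Omega -> R) (H : R -> R) :
  volterra_solution P F W x0 b sigma H H Z ->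
  exists2 M : R, (0 <= M)%R &
    forall s, (0 <= s <= T)%R -> \int[P]_w (Z s w ^+ 2)%:E <= M%:E.
Proof.
move=> [_ _ /(_ T T0)[N NP] _].
have NP' s : (0 <= s <= T)%R -> \int[P]_w (Z s w ^+ 2)%:E <= N%:E.
  move=> sT; have := NP s sT; rewrite unlock.
  by under eq_integral do rewrite real_normK ?num_real//.
exists N => //; rewrite -lee_fin (le_trans _ (NP' 0%R _)) ?lexx//.
by apply: integral_ge0 => w _; rewrite lee_fin sqr_ge0.
Qed.

Lemma measurable_solution (Z : R -> Omega -> R) (H : R -> R) (s : R) :
  volterra_solution P F W x0 b sigma H H Z -> (0 <= s)%R ->
  measurable_fun setT (Z s).
Proof. by move=> [adZ _ _ _] s0; exact: (rv_measurable_fun fF s0 (adZ s s0)). Qed.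

(** A and B are chosen before Gh, Xh, [theta] and [eps], so that they serve all n at once. In the
    proof b and sigma share one Lipschitz constant and one bound at 0, so that [kernel_term] gives
    both the same estimate. *)
Lemma volterra_stability : lipschitz b -> lipschitz sigma ->
  exists A B : R, [/\ (0 <= A)%R, (0 <= B)%R &
  forall (Gh : R -> R) (Xh : R -> Omega -> R) (theta eps : R),
    measurable_fun `[0%R, T] Gh ->
    \int[mu]_(s in `[0%R, T]) (Gh s ^+ 2)%:E < +oo ->
    volterra_solution P F W x0 b sigma Gh Gh Xh ->
    (0 <= theta)%R ->
    A%:E * \int[mu]_(s in `[0%R, T]) (expR (- (theta * s)) * Gh s ^+ 2)%:E <= (2^-1)%:E ->
    \int[mu]_(s in `[0%R, T]) ((Gh s - G s) ^+ 2)%:E <= eps%:E ->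
    forall t, (0 <= t <= T)%R ->
    'E_P[fun w => (`|Xh t w - X t w| ^+ 2)%R] <= (B * expR (theta * T) * eps)%:E].
Proof.
move=> /lipschitz_exists_bound[Lb Lb0 bL] /lipschitz_exists_bound[Ls Ls0 sL].
have [M M0 XM] := moment_bound solX.
have k0 := @kappa_ge0 R.
pose K := (2 * T + 18 * kappa)%R.
have K0 : (0 <= K)%R by rewrite addr_ge0 ?mulr_ge0.
pose L := (Lb + Ls)%R.
have L0 : (0 <= L)%R by rewrite addr_ge0.
have LbL : lipschitz_bound L b.
  by move=> x y; rewrite (le_trans (bL x y))// ler_wpM2r// lerDl.
have LsL : lipschitz_bound L sigma.
  by move=> x y; rewrite (le_trans (sL x y))// ler_wpM2r// lerDr.
pose c := (b 0 ^+ 2 + sigma 0 ^+ 2)%R.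
have c0 : (0 <= c)%R by rewrite addr_ge0 ?sqr_ge0.
have bc : (b 0 ^+ 2 <= c)%R by rewrite lerDl sqr_ge0.
have sc : (sigma 0 ^+ 2 <= c)%R by rewrite lerDr sqr_ge0.
have D0 : (0 <= 4 * (c + L ^+ 2 * M))%R.
  by rewrite mulr_ge0// addr_ge0// mulr_ge0// sqr_ge0.
exists (K * (2 * L ^+ 2))%R, (2 * (K * (4 * (c + L ^+ 2 * M))))%R; split.
- by rewrite mulr_ge0// mulr_ge0// sqr_ge0.
- by rewrite mulr_ge0// mulr_ge0.
move=> Gh Xh theta eps mGh Ghoo solXh th0 half Geps t tT.
have eps0 : (0 <= eps)%R.
  by rewrite -lee_fin; apply: le_trans Geps; apply: integral_ge0 => s _; rewrite lee_fin sqr_ge0.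
have [Mh Mh0 XhM] := moment_bound solXh.
have u0 s : 0 <= sqr_dist P Xh X s by apply: integral_ge0 => w _; rewrite lee_fin sqr_ge0.
have jm (Z : R -> Omega -> R) (r : R) (H : R -> R) : volterra_solution P F W x0 b sigma H H Z ->
    jointly_measurable `[0%R, r] Z.
  move=> [_ jZ _ _]; apply: measurable_funS jZ; first exact: measurableX.
  by move=> [s w] [/= + _]; rewrite !in_itv/= => /andP[-> _].
have mu2 : measurable_fun `[0%R, T] (sqr_dist P Xh X).
  apply: (@measurable_integral_proba _ _ _ P `[0%R, T] (fun s w => (Xh s w - X s w) ^+ 2)%R) => //.
    by apply: measurable_funX; apply: measurable_funB; [exact: jm solXh|exact: jm solX].
  by move=> s w _; exact: sqr_ge0.
(* This a priori bound involves the moments of Xh; it starts the iteration in [volterra_gronwall]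
   and is absent from its conclusion. *)
have uV s : (0 <= s <= T)%R -> sqr_dist P Xh X s <= (2 * (Mh + M))%:E.
  move=> sT; have [s0 _] := andP sT.
  have mX := measurable_solution solX s0; have mXh := measurable_solution solXh s0.
  apply: (@le_trans _ _ (\int[P]_w (2%:E * ((Xh s w ^+ 2)%:E + (X s w ^+ 2)%:E)))).
    apply: ge0_le_integral => //.
    - by move=> w _; rewrite lee_fin sqr_ge0.
    - by apply/measurable_EFinP; apply: measurable_funX; exact: measurable_funB.
    - by apply: measurable_funeM; apply: emeasurable_funD; apply/measurable_EFinP; exact: measurable_funX.
    move=> w _; rewrite -EFinD -EFinM lee_fin.
    by have := sqr_ge0 (Xh s w + X s w)%R; nra.
  rewrite ge0_integralZl_EFin//; last 2 first.
  - by move=> w _; rewrite adde_ge0 ?lee_fin ?sqr_ge0.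
  - by apply: emeasurable_funD; apply/measurable_EFinP; exact: measurable_funX.
  rewrite ge0_integralD//; last 4 first.
  - by move=> w _; rewrite lee_fin sqr_ge0.
  - by apply/measurable_EFinP; exact: measurable_funX.
  - by move=> w _; rewrite lee_fin sqr_ge0.
  - by apply/measurable_EFinP; exact: measurable_funX.
  by rewrite (EFinM 2) (EFinD Mh); apply: lee_wpmul2l => //; apply: leeD; [exact: XhM|exact: XM].
have ineq r : (0 <= r <= T)%R ->
    sqr_dist P Xh X r <= (K * (2 * L ^+ 2))%:E *
      \int[mu]_(s in `[0%R, r]) ((Gh (r - s) ^+ 2)%:E * sqr_dist P Xh X s)
    + (K * (4 * (c + L ^+ 2 * M)) * eps)%:E.
  move=> /andP[r0 rT].
  have sub : (`[0%R, r]%classic : set R) `<=` `[0%R, T]%classic.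
    by apply: subset_itvl; rewrite bnd_simp.
  have mGr : measurable_fun `[0%R, r] G by apply: measurable_funS mG.
  have mGhr : measurable_fun `[0%R, r] Gh by apply: measurable_funS mGh.
  have fin (g : R -> R) : measurable_fun `[0%R, T] g ->
      \int[mu]_(s in `[0%R, r]) (g s ^+ 2)%:E <= \int[mu]_(s in `[0%R, T]) (g s ^+ 2)%:E.
    move=> mg; apply: ge0_subset_integral => //.
      by apply/measurable_EFinP; exact: measurable_funX.
    by move=> s _; rewrite lee_fin sqr_ge0.
  have XMr s : (0 <= s <= r)%R -> \int[P]_w (X s w ^+ 2)%:E <= M%:E.
    by move=> /andP[s0 sr]; apply: XM; rewrite s0 (le_trans sr).
  have epsr : \int[mu]_(s in `[0%R, r]) ((Gh s - G s) ^+ 2)%:E <= eps%:E.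
    apply: le_trans Geps; apply: (fin (fun s => Gh s - G s)%R).
    exact: measurable_funB.
  have vs := volterra_sqr_dist fF bW solX solXh r0 mGr mGhr
    (le_lt_trans (fin _ mG) Goo) (le_lt_trans (fin _ mGh) Ghoo) Lb0 bL.
  apply: (le_trans vs).
  set Z := \int[mu]_(s in _) (_ * _).
  have Z0 : 0 <= Z.
    by apply: integral_ge0 => s _; rewrite mule_ge0// lee_fin sqr_ge0.
  have bound f : lipschitz_bound L f -> (f 0 ^+ 2 <= c)%R ->
    \int[P]_w \int[mu]_(s in `[0%R, r])
      ((Gh (r - s) * f (Xh s w) - G (r - s) * f (X s w)) ^+ 2)%:E <=
      (2 * L ^+ 2)%:E * Z + (4 * (c + L ^+ 2 * M))%:E * eps%:E.
    move=> Lf fc; apply: (le_trans (kernel_term mGr mGhr L0 Lf fc (jm _ _ _ solX) (jm _ _ _ solXh) XMr)).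
    by apply: leeD2l; apply: lee_wpmul2l.
  have S0 : 0 <= (2 * L ^+ 2)%:E * Z + (4 * (c + L ^+ 2 * M))%:E * eps%:E.
    by rewrite adde_ge0 ?mule_ge0// lee_fin// mulr_ge0// sqr_ge0.
  apply: (@le_trans _ _ (K%:E * ((2 * L ^+ 2)%:E * Z + (4 * (c + L ^+ 2 * M))%:E * eps%:E))).
    rewrite /K EFinD ge0_muleDl ?lee_fin ?mulr_ge0//.
    apply: leeD.
      apply: (@le_trans _ _ ((2 * r)%:E * ((2 * L ^+ 2)%:E * Z + (4 * (c + L ^+ 2 * M))%:E * eps%:E))).
        by apply: lee_wpmul2l; [rewrite lee_fin mulr_ge0|exact: bound].
      by apply: lee_wpmul2r => //; rewrite lee_fin ler_wpM2l.
    by apply: lee_wpmul2l; [rewrite lee_fin mulr_ge0|exact: bound].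
  rewrite ge0_muleDr; last 2 first.
  - by rewrite mule_ge0// lee_fin mulr_ge0// sqr_ge0.
  - by rewrite mule_ge0// lee_fin.
  rewrite muleA -!EFinM; apply: leeD => //.
  by rewrite le_eqVlt; apply/orP; left; apply/eqP; congr EFin; ring.
have kk s : (0 <= Gh s ^+ 2)%R by exact: sqr_ge0.
have mk : measurable_fun `[0%R, T] (fun s => Gh s ^+ 2)%R by exact: measurable_funX.
have A0 : (0 <= K * (2 * L ^+ 2))%R by rewrite mulr_ge0// mulr_ge0// sqr_ge0.
have E0 : (0 <= K * (4 * (c + L ^+ 2 * M)) * eps)%R by rewrite mulr_ge0// mulr_ge0.
have := volterra_gronwall A0 E0 th0 mk kk mu2 (fun s _ => u0 s) uV half ineq tT.
rewrite unlock /sqr_dist.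
under [X in _ -> X <= _]eq_integral do rewrite real_normK ?num_real//.
move=> /le_trans; apply; rewrite lee_fin.
by rewrite le_eqVlt; apply/orP; left; apply/eqP; ring.
Qed.

(* The damping [theta] has to be chosen uniformly in [n]. For large [n], [Gs n]
   is close to [G] and the damping of [2 * G ^ 2] serves; the finitely many
   remaining [n] are treated one by one. *)
Lemma volterra_rate (Gs : nat -> R -> R) (r C0 : R) (n0 : nat) :
  lipschitz b -> lipschitz sigma -> (0 < r)%R ->
  (forall n, (0 < n)%N -> measurable_fun `[0%R, T] (Gs n)) ->
  (forall n, (0 < n)%N -> \int[mu]_(s in `[0%R, T]) (Gs n s ^+ 2)%:E < +oo) ->
  (forall n, (0 < n)%N -> (n0 <= n)%N ->
    \int[mu]_(s in `[0%R, T]) ((Gs n s - G s) ^+ 2)%:E <= (C0 * n%:R `^ (- r))%:E) ->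
  exists2 C : R, (0 < C)%R &
    forall (n : nat) (Xh : R -> Omega -> R), (0 < n)%N ->
    volterra_solution P F W x0 b sigma (Gs n) (Gs n) Xh ->
    forall t : R, (0 <= t <= T)%R ->
    'E_P[fun w => (`|Xh t w - X t w| ^+ 2)%R] <= (C * n%:R `^ (- r))%:E.
Proof.
move=> Lb Ls r0 mGs Gsoo rate.
have [A [B [A0 B0 stab]]] := volterra_stability Lb Ls.
have pos n : (0 < n)%N -> (0 < n%:R `^ (- r) :> R)%R.
  by move=> n0'; rewrite powR_gt0// ltr0n.
(* A + 1 in place of A, as A may be 0. *)
have eta0 (q : R) : (0 < q)%R -> (0 < q / (A + 1))%R.
  by move=> q0; rewrite divr_gt0// ltr_wpDl.
have etaA (q : R) (y : \bar R) : (0 < q)%R -> y <= (q / (A + 1))%:E -> A%:E * y <= q%:E.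
  move=> q0 /(lee_wpmul2l (A0 : 0 <= A%:E)) /le_trans; apply.
  rewrite -EFinM lee_fin mulrA ler_pdivrMr ?ltr_wpDl// mulrC ler_wpM2l//.
    exact: ltW.
  by rewrite lerDl.
have mS (g : R -> R) : measurable_fun `[0%R, T] g ->
    measurable_fun `[0%R, T] (fun s => (g s ^+ 2)%:E).
  by move=> mg; apply/measurable_EFinP; exact: measurable_funX.
have S0 (g : R -> R) s : 0 <= (g s ^+ 2)%:E by rewrite lee_fin sqr_ge0.
have [N NP] : exists N, exists2 C : R, (0 < C)%R &
    forall (n : nat) (Xh : R -> Omega -> R), (0 < n)%N -> (N <= n)%N ->
    volterra_solution P F W x0 b sigma (Gs n) (Gs n) Xh ->
    forall t : R, (0 <= t <= T)%R ->
    'E_P[fun w => (`|Xh t w - X t w| ^+ 2)%R] <= (C * n%:R `^ (- r))%:E.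
  (* Since Gs_n^2 <= 2 G^2 + 2 (Gs_n - G)^2, the allowed 1 / 2 is shared: 1 / 4 for the damped 2 G^2
     and, through the 1 / 8 below, 1 / 4 for twice the squared distance of the kernels. *)
  have [||||theta th0 hth] := @exists_damping R T (fun s => 2 * G s ^+ 2)%R (4^-1 / (A + 1)).
  - by apply: measurable_funM => //; exact: measurable_funX.
  - by move=> s; rewrite mulr_ge0// sqr_ge0.
  - under eq_integral do rewrite EFinM.
    rewrite ge0_integralZl_EFin//; [|exact: mS].
    by rewrite lte_mul_pinfty// lee_fin.
  - exact: eta0.
  have C00 : (0 <= `|C0| + 1)%R by rewrite addr_ge0.
  have q0 : (0 < 8^-1 / (`|C0| + 1))%R by rewrite divr_gt0// ltr_wpDl.
  have [N1 N1P] := powRN_small r0 (eta0 _ q0).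
  exists (maxn n0 N1), (B * expR (theta * T) * (`|C0| + 1) + 1)%R.
    by rewrite ltr_wpDl// mulr_ge0// mulr_ge0// expR_ge0.
  move=> n Xh n_gt0; rewrite geq_max => /andP[n0n N1n] solXh t tT.
  have p0 := pos n n_gt0.
  have rate1 : \int[mu]_(s in `[0%R, T]) ((Gs n s - G s) ^+ 2)%:E <=
      ((`|C0| + 1) * n%:R `^ (- r))%:E.
    apply: (le_trans (rate n n_gt0 n0n)); rewrite lee_fin ler_wpM2r ?(ltW p0)//.
    by rewrite (le_trans (ler_norm C0))// lerDl.
  apply: (le_trans (stab (Gs n) Xh theta ((`|C0| + 1) * n%:R `^ (- r))%R (mGs n n_gt0) (Gsoo n n_gt0) solXh th0 _ rate1 t tT)).
    have mg := mGs n n_gt0.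
    have le1 : \int[mu]_(s in `[0%R, T]) (expR (- (theta * s)) * Gs n s ^+ 2)%:E <=
        \int[mu]_(s in `[0%R, T]) (expR (- (theta * s)) * (2 * G s ^+ 2))%:E +
        2%:E * \int[mu]_(s in `[0%R, T]) ((Gs n s - G s) ^+ 2)%:E.
      rewrite -ge0_integralZl_EFin//; [|exact: (mS (fun s => Gs n s - G s)%R (measurable_funB mg mG))].
      rewrite -ge0_integralD//; last 4 first.
      - by move=> s _; rewrite lee_fin mulr_ge0 ?expR_ge0// mulr_ge0// sqr_ge0.
      - apply/measurable_EFinP; apply: measurable_funM; first exact: measurable_expRN.
        by apply: measurable_funM => //; exact: measurable_funX.
      - by move=> s _; rewrite mule_ge0.
      - by apply: measurable_funeM; exact: (mS (fun s => Gs n s - G s)%R (measurable_funB mg mG)).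
      apply: ge0_le_integral => //.
      - by move=> s _; rewrite lee_fin mulr_ge0 ?expR_ge0// sqr_ge0.
      - apply/measurable_EFinP; apply: measurable_funM; first exact: measurable_expRN.
        exact: measurable_funX.
      - apply: emeasurable_funD; last first.
          by apply: measurable_funeM; exact: (mS (fun s => Gs n s - G s)%R (measurable_funB mg mG)).
        apply/measurable_EFinP; apply: measurable_funM; first exact: measurable_expRN.
        by apply: measurable_funM => //; exact: measurable_funX.
      move=> s /=; rewrite in_itv/= => /andP[s0 _].
      rewrite -EFinM -EFinD lee_fin.
      have e0 := expR_ge0 (- (theta * s))%R.
      have e1 : (expR (- (theta * s)) <= 1)%R by rewrite expR_le1 oppr_le0 mulr_ge0.
      have sq : (Gs n s ^+ 2 <= 2 * G s ^+ 2 + 2 * (Gs n s - G s) ^+ 2)%R.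
        by have := sqr_ge0 (Gs n s - 2 * G s)%R; nra.
      have := ler_wpM2l e0 sq; have := sqr_ge0 (Gs n s - G s)%R.
      by move: ((Gs n s - G s) ^+ 2)%R => q; nra.
    apply: (@le_trans _ _ (A%:E * (4^-1 / (A + 1) + 4^-1 / (A + 1))%:E)).
      apply: lee_wpmul2l; first by rewrite lee_fin.
      apply: (le_trans le1); rewrite [leRHS]EFinD; apply: leeD => //.
      apply: (@le_trans _ _ (2%:E * ((`|C0| + 1) * n%:R `^ (- r))%:E)).
        exact: lee_wpmul2l.
      have := N1P n n_gt0 N1n.
      rewrite -EFinM lee_fin => /(ler_wpM2l C00).
      have -> : ((`|C0| + 1) * (8^-1 / (`|C0| + 1) / (A + 1)) = 8^-1 / (A + 1))%R.
        by field; rewrite !gt_eqF ?ltr_wpDl.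
      by lra.
    rewrite -mulrDl; apply: etaA => //.
    by rewrite lee_fin le_eqVlt; apply/orP; left; apply/eqP; congr (_ / _)%R; lra.
  rewrite lee_fin mulrA ler_wpM2r ?(ltW p0)//.
  by rewrite lerDl.
(* A single kernel has its own damping, and its finite distance to G, divided by n^(- r), gives the
   constant; the added 1 makes it positive. *)
have fixed n : (0 < n)%N -> exists2 C : R, (0 < C)%R &
    forall (Xh : R -> Omega -> R),
    volterra_solution P F W x0 b sigma (Gs n) (Gs n) Xh ->
    forall t : R, (0 <= t <= T)%R ->
    'E_P[fun w => (`|Xh t w - X t w| ^+ 2)%R] <= (C * n%:R `^ (- r))%:E.
  move=> n_gt0; have p0 := pos n n_gt0.
  have mg := mGs n n_gt0; have goo := Gsoo n n_gt0.
  have [||||theta th0 hth] := @exists_damping R T (fun s => Gs n s ^+ 2)%R (2^-1 / (A + 1)).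
  - exact: measurable_funX.
  - by move=> s; rewrite sqr_ge0.
  - exact: goo.
  - exact: eta0.
  pose I := \int[mu]_(s in `[0%R, T]) ((Gs n s - G s) ^+ 2)%:E.
  have I0 : 0 <= I by apply: integral_ge0 => s _.
  have Ioo : I < +oo.
    apply: (@le_lt_trans _ _ (\int[mu]_(s in `[0%R, T])
        (2%:E * ((Gs n s ^+ 2)%:E + (G s ^+ 2)%:E)))).
      apply: ge0_le_integral => //.
      - exact: (mS (fun s => Gs n s - G s)%R (measurable_funB mg mG)).
      - by apply: measurable_funeM; apply: emeasurable_funD; exact: mS.
      move=> s _; rewrite -EFinD -EFinM lee_fin.
      by have := sqr_ge0 (Gs n s + G s)%R; nra.
    rewrite ge0_integralZl_EFin//; last 2 first.
    - by move=> s _; rewrite adde_ge0.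
    - by apply: emeasurable_funD; exact: mS.
    rewrite ge0_integralD//; [|exact: mS..].
    by rewrite lte_mul_pinfty ?lee_fin// lte_add_pinfty.
  have IE : I = (fine I)%:E by rewrite fineK// ge0_fin_numE.
  exists (B * expR (theta * T) * fine I / n%:R `^ (- r) + 1)%R.
    rewrite ltr_wpDl// mulr_ge0 ?invr_ge0 ?(ltW p0)// mulr_ge0 ?fine_ge0//.
    by rewrite mulr_ge0// expR_ge0.
  move=> Xh solXh t tT.
  apply: (le_trans (stab (Gs n) Xh theta (fine I) mg goo solXh th0 _ _ t tT)).
  - exact: etaA.
  - by rewrite -/I IE.
  rewrite lee_fin mulrDl divfK ?gt_eqF// lerDl mul1r.
  exact: ltW.
(* Lowering the threshold by one adds the constant of a single n. *)
elim: N NP => [|N IH] [C C0' CP].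
  by exists C => // n Xh n_gt0; exact: CP.
have [N_eq0|N_gt0] := posnP N.
  by exists C => // n Xh n_gt0; apply: CP => //; rewrite N_eq0.
have [C' C'0 C'P] := fixed N N_gt0.
apply: IH; exists (C + C')%R; first exact: addr_gt0.
move=> n Xh n_gt0; rewrite leq_eqVlt => /predU1P[<-|Nn] solXh t tT.
  apply: (le_trans (C'P Xh solXh t tT)).
  by rewrite lee_fin ler_wpM2r ?(ltW (pos _ N_gt0))// lerDr ltW.
apply: (le_trans (CP n Xh n_gt0 Nn solXh t tT)).
by rewrite lee_fin ler_wpM2r ?(ltW (pos _ n_gt0))// lerDl ltW.
Qed.

End stability.

(** * The fractional kernel and its barycentric discretization *)

Section powR_integral.
Context {R : realType}.
Local Notation mu := (@lebesgue_measure R).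

Lemma is_derive_powR_prim (q x : R) : 0 < x -> q + 1 != 0 ->
  is_derive x 1 (fun y : R => (q + 1)^-1 * y `^ (q + 1)) (x `^ q).
Proof.
move=> x0 q1; have h := is_derive1_powR (q + 1) x0.
have := @is_deriveZ _ _ _ _ (q + 1)^-1 _ _ _ h.
move=> h2; apply: (is_derive_eq h2).
by rewrite addrK -mulr_algl scaler1 mulrA mulVf// mul1r.
Qed.

Lemma integral_powR_itv (q a b : R) : 0 < a -> a < b -> q + 1 != 0 ->
  (\int[mu]_(x in `[a, b]) (x `^ q)%:E =
  ((b `^ (q + 1) - a `^ (q + 1)) / (q + 1))%:E)%E.
Proof.
move=> a0 ab q1; have b0 := lt_trans a0 ab.
pose F (y : R) := (q + 1)^-1 * y `^ (q + 1).
have F'E (x : R) : 0 < x -> is_derive x 1 F (x `^ q).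
  by move=> x0; exact: is_derive_powR_prim.
have cF (x : R) : 0 < x -> {for x, continuous F}.
  move=> x0; apply: differentiable_continuous; apply/derivable1_diffP.
  by have [] := F'E x x0.
rewrite (@continuous_FTC2 _ (fun x => x `^ q) F)//.
- by rewrite -EFinB /F -mulrBr mulrC.
- apply: derivable_within_continuous => x; rewrite in_itv/= => /andP[ax _].
  by apply: derivable_powR; rewrite in_itv/= (lt_le_trans a0).
- split.
  + move=> x; rewrite in_itv/= => /andP[ax _].
    by have [] := F'E x (lt_trans a0 ax).
  + exact/cvg_at_right_filter/cF.
  + exact/cvg_at_left_filter/cF.
- move=> x; rewrite in_itv/= => /andP[ax _]; rewrite derive1E.
  by have := F'E x (lt_trans a0 ax) => h; rewrite derive_val.
Qed.

Lemma measurable_powR_EFin (q : R) (E : set R) :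
  measurable_fun E (fun x : R => (x `^ q)%:E).
Proof.
by apply: measurable_funTS; apply/measurable_EFinP; exact: measurable_powR.
Qed.

(** Monotone convergence along [1 / (n + 2), 1], on which the primitive is regular; n + 2 keeps the
    left end strictly below 1. *)
Lemma integral_powR01 (p : R) : p < 1 ->
  (\int[mu]_(x in `]0%R, 1%R]) (x `^ (- p))%:E <= ((1 - p)^-1)%:E)%E.
Proof.
move=> p1; have p0 : 0 < 1 - p by rewrite subr_gt0.
pose D (n : nat) : set R := [set` `[n.+2%:R^-1, (1 : R)]].
have UD : \bigcup_n D n = `]0%R, 1%R]%classic.
  apply/seteqP; split => x.
    move=> [n _]; rewrite /D/= !in_itv/= => /andP[nx ->]; rewrite andbT.
    by rewrite (lt_le_trans _ nx)// invr_gt0 ltr0n.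
  rewrite /= in_itv/= => /andP[x0 x1].
  exists (Num.truncn x^-1) => //; rewrite /D/= in_itv/= x1 andbT.
  rewrite -[leRHS]invrK lef_pV2 ?posrE ?ltr0n ?invr_gt0//.
  by apply: (le_trans (ltW (truncnS_gt _))); rewrite ler_nat.
rewrite -UD.
have ndD : nondecreasing_seq D.
  move=> m n mn; rewrite subsetEset => x; rewrite /D/= !in_itv/= => /andP[mx ->].
  rewrite andbT (le_trans _ mx)//.
  by rewrite lef_pV2 ?posrE ?ltr0n// ler_nat !ltnS.
have mD n : measurable (D n) by exact: measurable_itv.
have pos n x : D n x -> (0 <= (x `^ (- p))%:E)%E by rewrite lee_fin powR_ge0.
have cv : (\int[mu]_(x in D n) (x `^ (- p))%:E @[n --> \oo] -->
    \int[mu]_(x in \bigcup_n D n) (x `^ (- p))%:E)%E.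
  apply: ge0_nondecreasing_set_cvg_integral => // n.
  exact: measurable_powR_EFin.
rewrite -(cvg_lim _ cv)//; apply: lime_le; first by apply/cvg_ex; eexists; exact: cv.
apply: nearW => n.
rewrite integral_powR_itv ?invr_gt0 ?ltr0n//; last 2 first.
- by rewrite invf_lt1 ?ltr0n// ltr1n.
- by rewrite addrC gt_eqF.
rewrite lee_fin powR1 (addrC _ 1) ler_pdivrMr// mulVf ?gt_eqF//.
Qed.

(** The substitution x = K y scales the case K = 1. *)
Lemma integral_powR_0_le (p K : R) : p < 1 -> 0 < K ->
  (\int[mu]_(x in `]0%R, K]) (x `^ (- p))%:E <= ((1 - p)^-1 * K `^ (1 - p))%:E)%E.
Proof.
move=> p1 K0.
have KV0 : 0 < K^-1 by rewrite invr_gt0.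
pose f (x : R) := (((fun x : R => (x `^ (- p))%:E) \_ `]0%R, 1%R]) x : \bar R)%E.
have mf : measurable_fun setT f.
  by apply/(measurable_restrictT _ _).1 => //; exact: measurable_powR_EFin.
have f0 x : (0 <= f x)%E by apply: erestrict_ge0 => y _; rewrite lee_fin powR_ge0.
have E : (\int[mu]_(x in `]0%R, K]) (x `^ (- p))%:E =
    \int[mu]_x ((K `^ (- p))%:E * f (0 + K^-1 * x)%R))%E.
  rewrite integral_mkcond; apply: eq_integral => x _.
  rewrite /f add0r !patchE !mem_setE !in_itv/=.
  rewrite pmulr_rgt0// ler_pdivrMl// mulr1.
  case: ifPn => [/andP[x0 xK]|]; last by rewrite mule0.
  rewrite -EFinM; congr EFin; rewrite -powRM ?(ltW K0)//; last first.
    by rewrite mulr_ge0 ?ltW.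
  by rewrite mulrA divff ?gt_eqF// mul1r.
rewrite E ge0_integralZl_EFin ?powR_ge0//; last exact: (measurableT_comp mf (measurable_affine 0 K^-1)).
rewrite ge0_integral_affine// invrK muleA -EFinM.
rewrite mulrC (_ : K * K `^ (- p) = K `^ (1 - p)); last first.
  by rewrite powRD ?powRr1 ?(ltW K0)// (gt_eqF K0) implybT.
rewrite EFinM muleC; apply: lee_wpmul2r; first by rewrite lee_fin powR_ge0.
by rewrite -integral_mkcond; exact: integral_powR01.
Qed.

Lemma integral_powRN2_le (a b : R) : 0 < a -> a <= b ->
  (\int[mu]_(x in `[a, b]) (x `^ (- 2))%:E <= (a^-1)%:E)%E.
Proof.
move=> a0; rewrite le_eqVlt => /predU1P[<-|ab].
  by rewrite set_itv1 integral_set1 lee_fin invr_ge0 ltW.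
have E : -2 + 1 = -1 :> R by lra.
rewrite integral_powR_itv// E ?oppr_eq0 ?oner_eq0//.
rewrite !powR_inv1 ?(ltW a0) ?(ltW (lt_trans a0 ab))//.
rewrite lee_fin invrN1 mulrN1 opprB gerBl// invr_ge0 ltW//.
exact: lt_trans ab.
Qed.

(** The integrand is 1 / t times the exponential density of rate t, whose total mass is 1. *)
Lemma integral_expRN_le (K t : R) : 0 <= K -> 0 < t ->
  (\int[mu]_(x in `[K, +oo[) (expR (- x * t))%:E <= (t^-1)%:E)%E.
Proof.
move=> K0 t0.
apply: (@le_trans _ _ (\int[mu]_x ((t^-1)%:E * (exponential_pdf t x)%:E)))%E.
  rewrite integral_mkcond; apply: ge0_le_integral => //.
  - by move=> x _; apply: erestrict_ge0 => y _; rewrite lee_fin expR_ge0.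
  - apply/(measurable_restrictT _ _).1 => //; apply: measurable_funTS.
    apply/measurable_EFinP; apply: measurableT_comp => //.
    by apply: measurable_funM.
  - by apply: measurable_funeM; apply/measurable_EFinP; exact: measurable_exponential_pdf.
  move=> x _; rewrite patchE; case: ifPn => [|_]; last first.
    by rewrite -EFinM lee_fin mulr_ge0 ?invr_ge0 ?exponential_pdf_ge0// ltW.
  rewrite inE/= in_itv/= andbT => Kx; rewrite exponential_pdfE ?(le_trans K0)//.
  by rewrite -EFinM lee_fin mulrA mulVf ?gt_eqF// mul1r mulNr mulNr mulrC.
rewrite ge0_integralZl_EFin ?invr_ge0 ?(ltW t0)//; last 2 first.
- by move=> x _; rewrite lee_fin exponential_pdf_ge0// ltW.
- by apply/measurable_EFinP; exact: measurable_exponential_pdf.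
by rewrite integral_exponential_pdf// mule1.
Qed.

End powR_integral.

(** * The measure [lambda] and its Laplace transform *)

Section lambda.
Context {R : realType}.
Local Notation mu := (@lebesgue_measure R).
Variable H : R.
Hypothesis H01 : 0 < H < 2^-1.
Local Notation p := (H + 2^-1).
Local Notation c := (c_ H).

Lemma c_ge0 : 0 <= c.
Proof. by rewrite invr_ge0 mulr_ge0 ?Gamma_ge0. Qed.

Lemma p_lt1 : p < 1. Proof. by case/andP: H01; lra. Qed.

Lemma p_gt0 : 0 < p. Proof. by case/andP: H01; lra. Qed.

Lemma powRNp (x : R) : x `^ (- H - 2^-1) = x `^ (- p).
Proof. by rewrite opprD. Qed.

Lemma ge0_integral_lambda (D : set R) (f : R -> \bar R) : measurable D ->
  D `<=` `[0, +oo[ -> measurable_fun D f -> (forall x, D x -> (0 <= f x)%E) ->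
  (\int[lambda H]_(x in D) f x = \int[mu]_(x in D) (f x * (c * x `^ (- p))%:E))%E.
Proof.
move=> mD D0 mf f0.
rewrite (ge0_integral_density (mu := mu) (g := lambda_density H))//; last 2 first.
- exact: lambda_density_ge0.
- exact: measurable_lambda_density.
apply: eq_integral => x /[!inE] /D0 x0.
by rewrite /lambda_density indicE mem_set// mulr1 powRNp.
Qed.

Lemma lambda_bounded_le (K : R) : 0 < K ->
  (lambda H `[0%R, K[ <= (c * ((1 - p)^-1 * K `^ (1 - p)))%:E)%E.
Proof.
move=> K0.
have m1 : measurable_fun setT (fun x : R => (c * x `^ (- p))%:E).
  by apply/measurable_EFinP; apply: measurable_funM => //; exact: measurable_powR.
have -> : lambda H `[0%R, K[ = (\int[mu]_(x in `[0%R, K[) (c * x `^ (- p))%:E)%E.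
  apply: eq_integral => x; rewrite inE/= in_itv/= => /andP[x0 _].
  by rewrite /lambda_density indicE mem_set ?mulr1 ?powRNp//= in_itv/= x0.
rewrite integral_itv_bndo_bndc; last exact: measurable_funTS.
rewrite -integral_itv_obnd_cbnd; last exact: measurable_funTS.
under eq_integral do rewrite EFinM.
rewrite ge0_integralZl_EFin ?c_ge0//; last 2 first.
- by move=> x _; rewrite lee_fin powR_ge0.
- exact: measurable_powR_EFin.
rewrite EFinM; apply: lee_wpmul2l; first by rewrite lee_fin c_ge0.
by apply: integral_powR_0_le => //; exact: p_lt1.
Qed.

(** Beyond K the density is at most c K^(- p), since p > 0. *)
Lemma lambda_tail_le (K t : R) : 0 < K -> 0 < t ->
  (\int[lambda H]_(x in `[K, +oo[) (expR (- x * t))%:E <=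
   (c * (K `^ (- p) * t^-1))%:E)%E.
Proof.
move=> K0 t0.
have me : measurable_fun setT (fun x : R => (expR (- x * t))%:E).
  by apply/measurable_EFinP; apply: measurableT_comp => //; apply: measurable_funM.
rewrite ge0_integral_lambda//; last 2 first.
- by move=> x /=; rewrite !in_itv/= !andbT; apply: le_trans; exact: ltW.
- exact: measurable_funTS.
apply: (@le_trans _ _ (\int[mu]_(x in `[K, +oo[)
    ((c * K `^ (- p))%:E * (expR (- x * t))%:E)))%E.
  apply: ge0_le_integral => //.
  - by move=> x _; rewrite mule_ge0 ?lee_fin ?expR_ge0// mulr_ge0 ?powR_ge0 ?c_ge0.
  - apply: emeasurable_funM; first exact: measurable_funTS.
    apply: measurable_funTS; apply/measurable_EFinP; apply: measurable_funM => //.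
  - by apply: measurable_funeM; exact: measurable_funTS.
  move=> x /=; rewrite in_itv/= andbT => Kx.
  rewrite muleC; apply: lee_wpmul2r; first by rewrite lee_fin expR_ge0.
  rewrite lee_fin ler_wpM2l ?c_ge0// !powRN lef_pV2 ?posrE ?powR_gt0// ?(lt_le_trans K0)//.
  by rewrite ge0_ler_powR ?(ltW p_gt0)// ?nnegrE ?(ltW K0)// (le_trans (ltW K0)).
rewrite ge0_integralZl_EFin ?mulr_ge0 ?powR_ge0 ?c_ge0//; last first.
  exact: measurable_funTS.
rewrite (mulrA c) [leRHS]EFinM; apply: lee_wpmul2l.
  by rewrite lee_fin mulr_ge0 ?powR_ge0 ?c_ge0.
by apply: integral_expRN_le => //; exact: ltW.
Qed.

(** The integrand of Gamma(1 - p) = Gamma(1/2 - H) extended by 0 to the line, ready for the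
    substitution x -> t x. *)
Let gammaf (x : R) : \bar R :=
  ((fun x : R => (x `^ (- p) * expR (- x))%:E) \_ `]0%R, +oo[) x.

Let measurable_gamma_integrand (E : set R) :
  measurable_fun E (fun x : R => (x `^ (- p) * expR (- x))%:E).
Proof.
apply: measurable_funTS; apply/measurable_EFinP; apply: measurable_funM.
  exact: measurable_powR.
by apply: measurableT_comp => //; exact: measurable_oppr.
Qed.

Let mgammaf : measurable_fun setT gammaf.
Proof. by apply/(measurable_restrictT _ _).1. Qed.

Let gammaf0 x : (0 <= gammaf x)%E.
Proof. by apply: erestrict_ge0 => y _; rewrite lee_fin mulr_ge0 ?powR_ge0 ?expR_ge0. Qed.

Let gamma_integrand_ge0 x : (0 <= (x `^ (- p) * expR (- x))%:E)%E.
Proof. by rewrite lee_fin mulr_ge0 ?powR_ge0 ?expR_ge0. Qed.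

Lemma Gamma_half_integral_lty :
  (\int[mu]_(x in `]0%R, +oo[) (x `^ (- p) * expR (- x))%:E < +oo)%E.
Proof.
have -> : `]0%R, +oo[%classic = `]0%R, 1%R] `|` `]1%R, +oo[ :> set R.
  by rewrite -itv_bndbnd_setU// bnd_simp.
rewrite ge0_integral_setU//; try exact: measurable_gamma_integrand; last first.
  apply/disj_setPS => x [] /=; rewrite !in_itv/= andbT => /andP[_ x1] x1'.
  by move: (lt_le_trans x1' x1); rewrite ltxx.
apply: lte_add_pinfty.
  apply: (@le_lt_trans _ _ (\int[mu]_(x in `]0%R, 1%R]) (x `^ (- p))%:E)%E); last first.
    by apply: (le_lt_trans (integral_powR01 p_lt1)); rewrite ltry.
  apply: ge0_le_integral => //.
  - exact: measurable_gamma_integrand.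
  - exact: measurable_powR_EFin.
  move=> x /=; rewrite in_itv/= => /andP[x0 _].
  by rewrite lee_fin ler_piMr ?powR_ge0// expR_le1 oppr_le0 ltW.
apply: (@le_lt_trans _ _ (\int[mu]_(x in `[1%R, +oo[) (expR (- x * 1))%:E)%E); last first.
  by apply: (le_lt_trans (integral_expRN_le _ _)) => //; rewrite ltry.
have me : measurable_fun setT (fun x : R => (expR (- x * 1))%:E).
  by apply/measurable_EFinP; apply: measurableT_comp => //; apply: measurable_funM.
rewrite -integral_itv_obnd_cbnd; last exact: measurable_funTS.
apply: ge0_le_integral => //.
- exact: measurable_gamma_integrand.
- exact: measurable_funTS.
move=> x /=; rewrite in_itv/= andbT => x1.
rewrite lee_fin mulr1 ler_piMl ?expR_ge0// powRN invf_le1 ?powR_gt0 ?(lt_trans ltr01)//.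
by rewrite -[leLHS](powRr0 x) ler_powR ?(ltW x1)// ltW// p_gt0.
Qed.

Lemma Gamma_half_EFin : (Gamma (2^-1 - H))%:E =
  (\int[mu]_(x in `]0%R, +oo[) (x `^ (- p) * expR (- x))%:E)%E.
Proof.
rewrite /Gamma (_ : 2^-1 - H - 1 = - p); last lra.
rewrite /Rintegral fineK// ge0_fin_numE; first exact: Gamma_half_integral_lty.
by apply: integral_ge0 => x _.
Qed.

(** On [1, 2] the integrand is at least 2^(- p) exp (- 2). Positivity lets Gamma(1/2 - H) cancel
    against its inverse in [c_ H], which the convention 0^-1 = 0 does not give for free. *)
Lemma Gamma_half_gt0 : 0 < Gamma (2^-1 - H).
Proof.
rewrite -lte_fin Gamma_half_EFin.
apply: (@lt_le_trans _ _ (\int[mu]_(x in `[1%R, 2%R]) (2 `^ (- p) * expR (- 2))%:E)%E).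
  rewrite integral_cst//= lebesgue_measure_itv/= lte_fin ltr1n/= -EFinB -EFinM lte_fin.
  by rewrite !mulr_gt0 ?powR_gt0 ?expR_gt0//; lra.
apply: (@le_trans _ _ (\int[mu]_(x in `[1%R, 2%R]) (x `^ (- p) * expR (- x))%:E)%E).
  apply: ge0_le_integral => //.
  - exact: measurable_gamma_integrand.
  move=> x /=; rewrite in_itv/= => /andP[x1 x2]; have x0 := lt_le_trans ltr01 x1.
  rewrite lee_fin ler_pM ?powR_ge0 ?expR_ge0//; last by rewrite ler_expR lerN2.
  rewrite !powRN lef_pV2 ?posrE ?powR_gt0//.
  by rewrite ge0_ler_powR ?(ltW p_gt0)// ?nnegrE ltW.
apply: ge0_subset_integral => //; first exact: measurable_gamma_integrand.
by move=> x /=; rewrite !in_itv/= andbT => /andP[x1 _]; exact: lt_le_trans x1.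
Qed.

(** The substitution x -> t x turns the integral into c t^(p - 1) Gamma(1/2 - H). *)
Lemma lambda_laplace (t : R) : 0 < t ->
  (\int[lambda H]_(x in `[0%R, +oo[) (expR (- x * t))%:E =
   (t `^ (H - 2^-1) / Gamma (H + 2^-1))%:E)%E.
Proof.
move=> t0.
have me : measurable_fun setT (fun x : R => (expR (- x * t))%:E).
  by apply/measurable_EFinP; apply: measurableT_comp => //; apply: measurable_funM.
rewrite ge0_integral_lambda//; last exact: measurable_funTS.
have m1 : measurable_fun setT (fun x : R => (c * x `^ (- p))%:E).
  by apply/measurable_EFinP; apply: measurable_funM => //; exact: measurable_powR.
rewrite -integral_itv_obnd_cbnd; last by apply: measurable_funTS; exact: emeasurable_funM.
rewrite integral_mkcond.
transitivity (\int[mu]_x ((c * t `^ p)%:E * gammaf (0 + t * x)%R))%E.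
  apply: eq_integral => x _; rewrite /gammaf add0r !patchE !mem_setE !in_itv/= !andbT.
  rewrite pmulr_rgt0//; case: ifPn => [x0|]; last by rewrite mule0.
  rewrite -!EFinM; congr EFin; rewrite powRM ?(ltW t0) ?(ltW x0)// (powRN t).
  rewrite mulNr (mulrC t x); field.
  by rewrite gt_eqF// powR_gt0.
rewrite ge0_integralZl_EFin ?mulr_ge0 ?powR_ge0 ?c_ge0//; last first.
  exact: (measurableT_comp mgammaf (measurable_affine 0 t)).
rewrite ge0_integral_affine// /gammaf -integral_mkcond -Gamma_half_EFin -!EFinM.
congr EFin; rewrite /c_ (_ : H - 2^-1 = p - 1); last lra.
rewrite [in RHS]powRD; last by rewrite (gt_eqF t0) implybT.
rewrite powR_inv1 ?(ltW t0)// invfM.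
have g0 := Gamma_half_gt0.
by move: (Gamma p)^-1 => u; field; rewrite !gt_eqF.
Qed.

Lemma G_fracE (t : R) : 0 < t -> G_frac H t = t `^ (H - 2^-1) / Gamma (H + 2^-1).
Proof. by move=> t0; rewrite /G_frac /Rintegral lambda_laplace. Qed.

End lambda.

Section exp_taylor.
Context {R : realType}.

(** Nonnegativity is convexity: exp lies above its tangents. The upper bound, without the factor 1 /
    2, also rests on exp u >= 1 + u, used differently on the two sides of x. *)
Lemma expRN_taylor1 (x y : R) : 0 <= x -> 0 <= y ->
  0 <= expR (- y) - expR (- x) + (y - x) * expR (- x) <= (y - x) ^+ 2.
Proof.
move=> x0 y0; have ey := expR_gt0 (- y); have ex := expR_gt0 (- x).
have ex1 : expR (- x) <= 1 by rewrite expR_le1 oppr_le0.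
have ey1 : expR (- y) <= 1 by rewrite expR_le1 oppr_le0.
apply/andP; split.
  have -> : expR (- y) = expR (- x) * expR (x - y) by rewrite -expRD; congr expR; ring.
  have := expR_ge1Dx (x - y); nra.
have [xy|/ltW yx] := leP x y.
  have e1 : 1 + (y - x) <= expR (y - x) by exact: expR_ge1Dx.
  have -> : expR (- y) = expR (- x) * (expR (y - x))^-1.
    by rewrite -expRN -expRD; congr expR; ring.
  have h0 : 0 <= y - x by rewrite subr_ge0.
  have h1 : (expR (y - x))^-1 <= (1 + (y - x))^-1.
    by rewrite lef_pV2 ?posrE ?expR_gt0// ltr_wpDr.
  have h2 : (1 + (y - x))^-1 <= 1 - (y - x) + (y - x) ^+ 2.
    rewrite -[leLHS]mul1r ler_pdivrMr ?ltr_wpDr//.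
    by move: (y - x) h0 => h h0; have := mulr_ge0 h0 (sqr_ge0 h); nra.
  have h3 := le_trans h1 h2.
  have := ler_wpM2l (ltW ex) h3; have := sqr_ge0 (y - x).
  by move: (y - x) => h; nra.
have -> : expR (- x) = expR (- y) * expR (y - x).
  by rewrite -expRD; congr expR; ring.
have h1 := expR_ge1Dx (y - x).
have h0 : y - x <= 0 by rewrite subr_le0.
(* With E = exp h >= 1 + h and h <= 0, one has 1 - E + h E = 1 - E (1 - h) <= 1 - (1 + h) (1 - h) =
   h^2. *)
move: (y - x) h0 h1 => h h0; move: (expR h) => E h1.
have h2 : 1 - E + h * E <= h ^+ 2.
  by have : 0 <= (E - (1 + h)) * (1 - h); [apply: mulr_ge0; lra|nra].
have -> : expR (- y) - expR (- y) * E + h * (expR (- y) * E) =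
    expR (- y) * (1 - E + h * E) by ring.
apply: (le_trans (ler_wpM2l (ltW ey) h2)).
by rewrite ler_piMl ?sqr_ge0.
Qed.

End exp_taylor.

(** * The barycentric atoms, cell by cell *)

Section cells.
Context {R : realType}.
Variable H : R.
Hypothesis H01 : 0 < H < 2^-1.
Local Notation lam := (lambda H).

Definition laplace (D : set R) (t : R) : R :=
  \int[lam]_(x in D) expR (- x * t).

Lemma measurable_expRNM (t : R) (D : set R) :
  measurable_fun D (fun x : R => expR (- x * t)).
Proof.
by apply: measurable_funTS; apply: measurableT_comp => //; apply: measurable_funM.
Qed.

Lemma integrable_laplace (D : set R) (t : R) : 0 < t -> measurable D ->
  D `<=` `[0, +oo[ -> lam.-integrable D (EFin \o (fun x => expR (- x * t))).
Proof.
move=> t0 mD D0.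
suff iT : lam.-integrable `[0%R, +oo[%classic (EFin \o (fun x => expR (- x * t))).
  have := @integrableS _ _ _ lam `[0%R, +oo[%classic D (EFin \o (fun x => expR (- x * t))).
  exact.
apply/integrableP; split; first by apply/measurable_EFinP; exact: measurable_expRNM.
under eq_integral do rewrite /= ger0_norm ?expR_ge0//.
by rewrite lambda_laplace// ltry.
Qed.

Lemma laplace_ge0 D t : 0 <= laplace D t.
Proof. by apply: Rintegral_ge0 => x _; exact: expR_ge0. Qed.

Lemma laplaceE (t : R) : laplace `[0, +oo[ t = G_frac H t.
Proof. by []. Qed.

Lemma lambda_itv_lty (x y : R) : 0 <= x -> (lam `[x, y[ < +oo)%E.
Proof.
move=> x0; have K0 : 0 < `|y| + 1 by rewrite ltr_wpDl.
apply: (@le_lt_trans _ _ (lam `[0, `|y| + 1[)).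
  apply: le_measure; rewrite ?inE//.
  move=> z /=; rewrite !in_itv/= => /andP[xz zy].
  by rewrite (le_trans x0 xz)/= (lt_trans zy)// (le_lt_trans (ler_norm y))// ltrDl.
by apply: (le_lt_trans (lambda_bounded_le H01 K0)); rewrite ltry.
Qed.

(** In the proof, [phi] is exp (- r t) minus its tangent at the mean. The tangent integrates to the
    mass times its value at the mean, so the integral of [phi] is exactly the error, and
    [expRN_taylor1] bounds [phi] pointwise. *)
Lemma cell_estimate (x y t : R) : 0 <= x -> x < y -> 0 < t ->
  `|laplace `[x, y[ t - fine (lam `[x, y[) *
      expR (- ((\int[lam]_(r in `[x, y[) r) / fine (lam `[x, y[)) * t)| <=
    t ^+ 2 * (y - x) ^+ 2 * fine (lam `[x, y[).
Proof.
move=> x0 xy t0; set mass := fine _; set mean := _ / mass.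
have mass0 : 0 <= mass by rewrite fine_ge0.
have lamE : lam `[x, y[ = mass%:E.
  by rewrite fineK// ge0_fin_numE// lambda_itv_lty.
have sub : (`[x, y[%classic : set R) `<=` `[0, +oo[%classic.
  by move=> z /=; rewrite !in_itv/= andbT => /andP[+ _]; exact: le_trans.
have ibd (f : R -> R) : measurable_fun `[x, y[ f -> [bounded f z | z in `[x, y[] ->
    lam.-integrable `[x, y[ (EFin \o f).
  by move=> mf bf; apply: measurable_bounded_integrable => //; exact: lambda_itv_lty.
have i1 := integrable_laplace t0 (measurable_itv `[x, y[) sub.
have iid : lam.-integrable `[x, y[ (EFin \o (fun r : R => r)).
  apply: ibd; first exact: measurable_id.
  exists `|y|; split => // N yN z /=; rewrite in_itv/= => /andP[xz zy].
  rewrite ger0_norm ?(le_trans x0)// (le_trans (ltW zy))//.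
  by rewrite (le_trans (ler_norm y))// ltW.
have icst (k : R) : lam.-integrable `[x, y[ (EFin \o cst k).
  by apply: ibd => //; exact: bounded_cst.
have RC (k : R) : \int[lam]_(r in `[x, y[) k = k * mass by rewrite Rintegral_cst.
(* For a cell of mass 0 the mean is a division by 0; both terms then vanish, the Laplace integral
   being at most the mass. *)
have [mass_eq0|mass_neq0] := eqVneq mass 0.
  have -> : laplace `[x, y[ t = 0.
    apply/eqP; rewrite eq_le laplace_ge0 andbT.
    apply: (@le_trans _ _ (\int[lam]_(r in `[x, y[) (1 : R))); last first.
      by rewrite RC mass_eq0 mulr0.
    apply: le_Rintegral => //; first exact: icst.
    move=> r /sub /=; rewrite in_itv/= andbT => r0.
    by rewrite expR_le1 mulNr oppr_le0 mulr_ge0// ltW.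
  by rewrite mass_eq0 mul0r subr0 normr0 mulr0.
have massp : 0 < mass by rewrite lt0r mass_neq0.
have mean_x : x <= mean.
  rewrite ler_pdivlMr// -RC; apply: le_Rintegral => //; first exact: icst.
  by move=> r /=; rewrite in_itv/= => /andP[].
have mean_y : mean <= y.
  rewrite ler_pdivrMr// -RC; apply: le_Rintegral => //; first exact: icst.
  by move=> r /=; rewrite in_itv/= => /andP[_ /ltW].
have meanE : \int[lam]_(r in `[x, y[) r = mean * mass.
  by rewrite /mean divfK.
pose e := expR (- mean * t).
pose phi (r : R) := expR (- r * t) + (t * e * r - (e + t * e * mean)).
have i2 : lam.-integrable `[x, y[ (EFin \o (fun r => t * e * r)).
  exact: (integrableZl _ (t * e) iid).
have i3 : lam.-integrable `[x, y[ (EFin \o (fun r => t * e * r - (e + t * e * mean))).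
  exact: (integrableB _ i2 (icst _)).
have i4 : lam.-integrable `[x, y[ (EFin \o phi).
  exact: (integrableD _ i1 i3).
have phiE : \int[lam]_(r in `[x, y[) phi r = laplace `[x, y[ t - mass * e.
  rewrite (RintegralD _ i1 i3)// (RintegralB _ i2 (icst (e + t * e * mean)))// RintegralZl// RC meanE.
  by rewrite /laplace; ring.
have phi_bound r : `[x, y[%classic r -> 0 <= phi r <= t ^+ 2 * (y - x) ^+ 2.
  move=> /[dup] xyr /sub /=; rewrite in_itv/= andbT => r0.
  have m0 : 0 <= mean by exact: le_trans mean_x.
  have := @expRN_taylor1 R (mean * t) (r * t) (mulr_ge0 m0 (ltW t0)) (mulr_ge0 r0 (ltW t0)).
  have -> : expR (- (r * t)) - expR (- (mean * t)) +
      (r * t - mean * t) * expR (- (mean * t)) = phi r.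
    by rewrite /phi /e !mulNr; ring.
  move=> /andP[-> /le_trans]; apply; rewrite -mulrBl exprMn mulrC.
  rewrite ler_wpM2l ?sqr_ge0// -[leLHS]real_normK ?num_real//.
  rewrite lerXn2r ?nnegrE ?subr_ge0 ?(ltW xy)// ler_norml.
  by move: xyr => /=; rewrite in_itv/= => /andP[xr ry]; apply/andP; split; lra.
rewrite -/e -phiE ger0_norm; last by apply: Rintegral_ge0 => r /phi_bound /andP[].
rewrite -RC; apply: le_Rintegral => //; first exact: icst.
by move=> r /phi_bound /andP[].
Qed.

(** Induction on the number m of cells already counted, with the width K / n of the full subdivision
    kept fixed; the errors add up because the masses do. *)
Lemma hatG_estimate (K t : R) (n : nat) : 0 < K -> 0 < t -> (0 < n)%N ->
  `|laplace `[0, K[ t - hatG H K n t| <=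
    t ^+ 2 * (K / n%:R) ^+ 2 * fine (lam `[0, K[).
Proof.
move=> K0 t0 n0; have n0' : 0 < n%:R :> R by rewrite ltr0n.
suff h m : (m <= n)%N ->
    `|laplace `[0, m%:R / n%:R * K[ t -
      atomic_laplace [seq (cell_mass H K n i, cell_mean H K n i) | i <- iota 1 m] t| <=
    t ^+ 2 * (K / n%:R) ^+ 2 * fine (lam `[0, m%:R / n%:R * K[).
  by have := h n (leqnn n); rewrite divff ?gt_eqF// mul1r.
elim: m => [_|m IH mn].
  rewrite !mul0r set_itvco0 /laplace Rintegral_set0 /atomic_laplace big_nil subr0 normr0.
  by rewrite measure0 mulr0.
have x0 : 0 <= m%:R / n%:R * K :> R by rewrite mulr_ge0 ?divr_ge0// ltW.
have xy : m%:R / n%:R * K < m.+1%:R / n%:R * K :> R.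
  by rewrite ltr_pM2r// ltr_pM2r ?invr_gt0// ltr_nat.
have cellE : cell K n m.+1 = `[m%:R / n%:R * K, m.+1%:R / n%:R * K[%classic.
  by rewrite /cell -natr1 addrK.
set x := m%:R / n%:R * K in x0 xy cellE IH *.
set y := m.+1%:R / n%:R * K in xy cellE *.
have U : `[0, y[%classic = `[0, x[%classic `|` `[x, y[%classic :> set R.
  by rewrite -itv_bndbnd_setU// bnd_simp// ltW.
have dis : [disjoint `[0%R, x[%classic & `[x, y[%classic : set R].
  apply/disj_setPS => z [] /=; rewrite !in_itv/= => /andP[_ zx] /andP[xz _].
  by move: (le_lt_trans xz zx); rewrite ltxx.
have sub : (`[0, y[%classic : set R) `<=` `[0, +oo[%classic.
  by move=> z /=; rewrite !in_itv/= andbT => /andP[].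
have -> : laplace `[0, y[ t = laplace `[0, x[ t + laplace `[x, y[ t.
  rewrite /laplace U Rintegral_setU//; rewrite -U.
  by apply: integrable_laplace.
have -> : fine (lam `[0, y[) = fine (lam `[0, x[) + fine (lam `[x, y[).
  rewrite U measureU//; last by apply/disj_set2P.
  by rewrite fineD// ge0_fin_numE// lambda_itv_lty.
have -> : iota 1 m.+1 = iota 1 m ++ [:: m.+1].
  by rewrite -[in LHS](addn1 m) iotaD add1n.
rewrite map_cat /atomic_laplace big_cat/= big_seq1.
rewrite /cell_mean /cell_mass cellE/=.
rewrite mulrDr opprD addrACA (le_trans (ler_normD _ _))// lerD//.
  exact: IH (ltnW mn).
have yx : y - x = K / n%:R.
  by rewrite /y /x -natr1; field; rewrite gt_eqF.
by rewrite -yx; exact: cell_estimate.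
Qed.

End cells.

Section atomic.
Context {R : realType}.
Local Notation mu := (@lebesgue_measure R).
Variable m : seq (R * R).

Lemma continuous_atomic_laplace : continuous (atomic_laplace m).
Proof.
rewrite /atomic_laplace; elim: m => [|[a x] s IH].
  under eq_fun do rewrite big_nil; exact: cst_continuous.
under eq_fun do rewrite big_cons/=.
move=> t; apply: cvgD; last exact: IH.
apply: cvgM; first exact: cvg_cst.
apply: continuous_comp; last exact: continuous_expR.
by apply: cvgM; [exact: cvg_cst|exact: cvg_id].
Qed.

Lemma measurable_atomic_laplace (D : set R) : measurable_fun D (atomic_laplace m).
Proof.
apply: measurable_funTS; apply: continuous_measurable_fun.
exact: continuous_atomic_laplace.
Qed.

Lemma atomic_laplace_sqr_lty (T : R) :
  (\int[mu]_(s in `[0%R, T]) (atomic_laplace m s ^+ 2)%:E < +oo)%E.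
Proof.
apply: integrable_lty => //.
apply: (@continuous_compact_integrable _ (fun s => atomic_laplace m s ^+ 2)).
  exact: segment_compact.
apply: continuous_subspaceT => t; under eq_fun do rewrite expr2.
by apply: cvgM; exact: continuous_atomic_laplace.
Qed.

End atomic.

(** * From pointwise to square integrated errors of kernels *)

Section kernel_error.
Context {R : realType}.
Local Notation mu := (@lebesgue_measure R).
Variable H : R.
Hypothesis H01 : 0 < H < 2^-1.
Local Notation p := (H + 2^-1).
Local Notation c := (c_ H).
Local Notation g := (Gamma (H + 2^-1))^-1.

(** The closed formula is available for t > 0, so [f] sets the value at 0 apart. *)
Lemma measurable_G_frac (T : R) : measurable_fun `[0, T] (G_frac H).
Proof.
pose f (t : R) := if t == 0 then G_frac H 0 else t `^ (H - 2^-1) / Gamma (H + 2^-1).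
apply: (eq_measurable_fun f).
  move=> t; rewrite inE/= in_itv/= /f => /andP[t0 _].
  by case: eqVneq => [->//|tn0]; rewrite G_fracE// lt0r tn0.
apply: measurable_funTS; apply: measurable_fun_ifT => //.
  apply: (measurable_fun_bool true); rewrite setTI (_ : _ @^-1` _ = [set 0]).
    exact: measurable_set1.
  by apply/seteqP; split => x /= /eqP.
by apply: measurable_funM => //; exact: measurable_powR.
Qed.

Lemma G_frac_sqr (t : R) : 0 < t -> G_frac H t ^+ 2 = g ^+ 2 * t `^ (- (1 - 2 * H)).
Proof.
move=> t0; rewrite G_fracE// exprMn mulrC; congr (_ * _).
by rewrite -powR_mulrn ?powR_ge0// -powRrM; congr (_ `^ _); lra.
Qed.

Let r1 : 1 - 2 * H < 1. Proof. by case/andP: H01; lra. Qed.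

Lemma integral_G_frac_sqr_lty (T : R) :
  (\int[mu]_(s in `[0%R, T]) (G_frac H s ^+ 2)%:E < +oo)%E.
Proof.
have mG2 : measurable_fun `]0%R, T] (fun s => (G_frac H s ^+ 2)%:E).
  apply/measurable_EFinP; apply: measurable_funX.
  by apply: measurable_funS (@measurable_G_frac T) => //; apply: subset_itvr; rewrite bnd_simp.
rewrite -integral_itv_obnd_cbnd//.
have [T0|T0] := leP T 0.
  by rewrite set_itv_ge ?integral_set0 ?ltry// bnd_simp -leNgt.
under eq_integral => s.
  rewrite inE/= in_itv/= => /andP[s0 _]; rewrite G_frac_sqr// EFinM; over.
rewrite ge0_integralZl_EFin ?sqr_ge0//; last 2 first.
- by move=> s _; rewrite lee_fin powR_ge0.
- exact: measurable_powR_EFin.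
rewrite lte_mul_pinfty ?lee_fin ?sqr_ge0//.
by apply: (le_lt_trans (integral_powR_0_le r1 T0)); rewrite ltry.
Qed.

(* For [t <= 1 / K] the tail is bounded by the whole kernel, for [t > 1 / K] by
   [c * K ^ (- p) / t]; both parts then integrate to a multiple of
   [K ^ (- 2 * H)]. *)
Definition tail_sqr_bound (K t : R) : R :=
  if t <= K^-1 then g ^+ 2 * t `^ (- (1 - 2 * H))
  else (c * K `^ (- p)) ^+ 2 * t `^ (- 2).

Lemma measurable_tail_sqr_bound K (D : set R) :
  measurable_fun D (fun t => (tail_sqr_bound K t)%:E).
Proof.
apply: measurable_funTS; apply/measurable_EFinP; apply: measurable_fun_ifT => //.
- by apply: measurable_fun_ler.
- by apply: measurable_funM => //; exact: measurable_powR.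
- by apply: measurable_funM => //; exact: measurable_powR.
Qed.

Lemma tail_sqr_bound_ge0 K t : 0 <= tail_sqr_bound K t.
Proof. by rewrite /tail_sqr_bound; case: ifP => _; rewrite mulr_ge0 ?sqr_ge0 ?powR_ge0. Qed.

Lemma laplace_tail_sqr (K t : R) : 0 < K -> 0 < t ->
  laplace H `[K, +oo[ t ^+ 2 <= tail_sqr_bound K t.
Proof.
move=> K0 t0; have sub : (`[K, +oo[%classic : set R) `<=` `[0, +oo[%classic.
  by apply: subset_itvr; rewrite bnd_simp ltW.
have l0 : 0 <= laplace H `[K, +oo[ t by exact: laplace_ge0.
have LE : (laplace H `[K, +oo[ t)%:E = (\int[lambda H]_(x in `[K, +oo[) (expR (- x * t))%:E)%E.
  by rewrite /laplace /Rintegral fineK//; apply: integrable_fin_num => //; exact: integrable_laplace.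
rewrite /tail_sqr_bound; case: ifPn => _.
  rewrite -G_frac_sqr// lerXn2r ?nnegrE//; first exact: laplace_ge0.
  rewrite -lee_fin LE -laplaceE /laplace /Rintegral fineK; last first.
    by apply: integrable_fin_num => //; exact: integrable_laplace.
  apply: ge0_subset_integral => //.
  by apply/measurable_EFinP; exact: measurable_expRNM.
have -> : t `^ (- 2) = t^-1 ^+ 2.
  by rewrite powRN powR_mulrn ?(ltW t0)// exprVn.
rewrite -exprMn lerXn2r ?nnegrE//.
  by rewrite !mulr_ge0 ?powR_ge0 ?c_ge0// invr_ge0 ltW.
by rewrite -lee_fin LE -mulrA; exact: lambda_tail_le.
Qed.

Lemma integral_tail_sqr_bound (K T : R) : 0 < K -> 0 <= T ->
  (\int[mu]_(t in `]0%R, T]) (tail_sqr_bound K t)%:E <=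
   ((g ^+ 2 / (2 * H) + c ^+ 2) * K `^ (- (2 * H)))%:E)%E.
Proof.
move=> K0 T0; have KV0 : 0 < K^-1 by rewrite invr_gt0.
have H0 : 0 < H by case/andP: H01.
have tp0 K' t : (0 <= (tail_sqr_bound K' t)%:E)%E by rewrite lee_fin tail_sqr_bound_ge0.
(* Enlarging the domain to ]0, T + 1 / K] gives both pieces a fixed shape, whether T is below or
   above 1 / K. *)
apply: (@le_trans _ _ (\int[mu]_(t in `]0%R, (K^-1)%R] `|` `](K^-1)%R, (T + K^-1)%R])
    (tail_sqr_bound K t)%:E)%E).
  apply: ge0_subset_integral => //.
  - exact: measurableU.
  - exact: measurable_tail_sqr_bound.
  move=> t /=; rewrite !in_itv/= => /andP[t0 tT].
  have [tK|tK] := leP t K^-1; [left|right]; rewrite ?t0//.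
  by rewrite (le_trans tT)// lerDl ltW.
rewrite ge0_integral_setU//; last 2 first.
- exact: measurable_tail_sqr_bound.
- apply/disj_setPS => z [] /=; rewrite !in_itv/= => /andP[_ zx] /andP[xz _].
  by move: (lt_le_trans xz zx); rewrite ltxx.
rewrite mulrDl EFinD; apply: leeD.
  under eq_integral => t.
    rewrite inE/= in_itv/= /tail_sqr_bound => /andP[t0 ->]; rewrite EFinM; over.
  rewrite ge0_integralZl_EFin ?sqr_ge0//; last 2 first.
  - by move=> s _; rewrite lee_fin powR_ge0.
  - exact: measurable_powR_EFin.
  rewrite -mulrA [leRHS]EFinM; apply: lee_wpmul2l; first by rewrite lee_fin sqr_ge0.
  apply: (le_trans (integral_powR_0_le r1 KV0)).
  have -> : 1 - (1 - 2 * H) = 2 * H by ring.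
  rewrite lee_fin ler_wpM2l ?invr_ge0 ?mulr_ge0 ?(ltW H0)//.
  by rewrite -powR_inv1 ?(ltW K0)// -powRrM mulN1r.
apply: (@le_trans _ _ (\int[mu]_(t in `[(K^-1)%R, (T + K^-1)%R])
    (((c * K `^ (- p)) ^+ 2)%:E * (t `^ (- 2))%:E))%E).
  rewrite -[leRHS]integral_itv_obnd_cbnd; last first.
    by apply: measurable_funeM; exact: measurable_powR_EFin.
  apply: ge0_le_integral => //.
  - exact: measurable_tail_sqr_bound.
  - by apply: measurable_funeM; exact: measurable_powR_EFin.
  move=> t /=; rewrite in_itv/= => /andP[tK _].
  by rewrite /tail_sqr_bound (leNgt t) tK/= EFinM.
rewrite ge0_integralZl_EFin ?sqr_ge0//; last 2 first.
- by move=> s _; rewrite lee_fin powR_ge0.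
- exact: measurable_powR_EFin.
apply: (@le_trans _ _ (((c * K `^ (- p)) ^+ 2)%:E * (K^-1^-1)%R%:E)%E).
  apply: lee_wpmul2l; first by rewrite lee_fin sqr_ge0.
  by apply: integral_powRN2_le => //; rewrite lerDr.
rewrite invrK -EFinM lee_fin exprMn -mulrA ler_wpM2l ?sqr_ge0//.
rewrite -powR_mulrn ?powR_ge0// -powRrM -[X in _ * X <= _]powRr1 ?(ltW K0)// -powRD.
  by rewrite le_eqVlt; apply/orP; left; apply/eqP; congr (_ `^ _); lra.
by rewrite (gt_eqF K0) implybT.
Qed.

(** Frequencies below K give an error E uniform in time, those above K a tail l whose bound is
    singular at 0; (E + l)^2 <= 2 E^2 + 2 l^2 separates them. *)
Lemma kernel_error (Gh : R -> R) (K T E : R) : 0 < K -> 0 <= T -> 0 <= E ->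
  measurable_fun `[0%R, T] Gh ->
  (forall t, 0 < t <= T -> `|Gh t - G_frac H t| <= E + laplace H `[K, +oo[ t) ->
  (\int[mu]_(t in `[0%R, T]) ((Gh t - G_frac H t) ^+ 2)%:E <=
   (2 * T * E ^+ 2 + 2 * (g ^+ 2 / (2 * H) + c ^+ 2) * K `^ (- (2 * H)))%:E)%E.
Proof.
move=> K0 T0 E0 mGh err.
have sub : (`]0, T]%classic : set R) `<=` `[0, T]%classic.
  by apply: subset_itvr; rewrite bnd_simp.
have md : measurable_fun `]0%R, T] (fun t => ((Gh t - G_frac H t) ^+ 2)%:E).
  apply/measurable_EFinP; apply: measurable_funX; apply: measurable_funB.
    exact: measurable_funS mGh.
  exact: measurable_funS (@measurable_G_frac T).
rewrite -integral_itv_obnd_cbnd//.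
have tp0 K' t : (0 <= (tail_sqr_bound K' t)%:E)%E by rewrite lee_fin tail_sqr_bound_ge0.
apply: (@le_trans _ _ (\int[mu]_(t in `]0%R, T])
    ((2 * E ^+ 2)%:E + 2%:E * (tail_sqr_bound K t)%:E))%E).
  apply: ge0_le_integral => //.
  - by move=> t _; rewrite lee_fin sqr_ge0.
  - apply: emeasurable_funD => //; apply: measurable_funeM.
    exact: measurable_tail_sqr_bound.
  move=> t /=; rewrite in_itv/= => /andP[t0 tT].
  rewrite -EFinM -EFinD lee_fin.
  have l0 := laplace_ge0 H `[K, +oo[%classic t.
  have := err t; rewrite t0 tT => /(_ isT) le1.
  have := laplace_tail_sqr K0 t0; move: l0 le1; move: (laplace _ _ _) => l l0 le1 le2.
  have : (Gh t - G_frac H t) ^+ 2 <= (E + l) ^+ 2.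
    rewrite -[leLHS]real_normK ?num_real//.
    by rewrite lerXn2r ?nnegrE ?addr_ge0.
  by have := sqr_ge0 (E - l); nra.
rewrite ge0_integralD//; last 3 first.
- by move=> t _; rewrite lee_fin mulr_ge0 ?sqr_ge0.
- by move=> t _; rewrite mule_ge0.
- by apply: measurable_funeM; exact: measurable_tail_sqr_bound.
rewrite ge0_integralZl_EFin//; last exact: measurable_tail_sqr_bound.
rewrite [leRHS]EFinD; apply: leeD.
  rewrite integral_cst//= lebesgue_measure_itv/= lte_fin.
  case: ifPn => [_|]; last first.
    by rewrite -leNgt mule0 lee_fin => _; rewrite mulr_ge0 ?sqr_ge0// mulr_ge0.
  by rewrite oppr0 adde0 -EFinM lee_fin; lra.
rewrite -mulrA [leRHS]EFinM; apply: lee_wpmul2l => //.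
exact: integral_tail_sqr_bound.
Qed.

End kernel_error.

(** * The rate of the barycentric kernel *)

Section barycentric.
Context {R : realType}.
Local Notation mu := (@lebesgue_measure R).
Variable H : R.
Hypothesis H01 : 0 < H < 2^-1.
Local Notation p := (H + 2^-1).
Local Notation c := (c_ H).
Local Notation g := (Gamma (H + 2^-1))^-1.

Lemma laplace_split (K t : R) : 0 <= K -> 0 < t ->
  G_frac H t = laplace H `[0, K[ t + laplace H `[K, +oo[ t.
Proof.
move=> K0 t0; rewrite -laplaceE /laplace.
have U : `[0, +oo[%classic = `[0, K[%classic `|` `[K, +oo[%classic :> set R.
  by rewrite -itv_bndbnd_setU// bnd_simp.
rewrite [in LHS]U Rintegral_setU//; rewrite -?U.
- by apply: integrable_laplace.
- apply/disj_setPS => z [] /=; rewrite !in_itv/= andbT => /andP[_ zx] xz.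
  by move: (le_lt_trans xz zx); rewrite ltxx.
Qed.

(** The bound of [hatG_estimate] made uniform over ]0, T]. As 1 - p = 1/2 - H, its square is of
    order K^(5 - 2 H) n^(- 4). *)
Definition cell_error (T K : R) (n : nat) : R :=
  T ^+ 2 * (K / n%:R) ^+ 2 * (c * ((1 - p)^-1 * K `^ (1 - p))).

Lemma cell_error_ge0 (T K : R) n : 0 <= cell_error T K n.
Proof.
have p1 : 0 <= (1 - p)^-1 by rewrite invr_ge0 subr_ge0 ltW// p_lt1.
apply: mulr_ge0; first by apply: mulr_ge0; exact: sqr_ge0.
by rewrite mulr_ge0 ?c_ge0// mulr_ge0 ?powR_ge0.
Qed.

Lemma cell_error_sqr (T K : R) n : 0 < K -> (0 < n)%N ->
  cell_error T K n ^+ 2 =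
  (T ^+ 2 * c * (1 - p)^-1) ^+ 2 * (K `^ (5 - 2 * H) * n%:R `^ (- 4)).
Proof.
move=> K0 n0; have n0' : 0 < n%:R :> R by rewrite ltr0n.
have -> : K `^ (5 - 2 * H) = K ^+ 4 * (K `^ (1 - p)) ^+ 2.
  rewrite -powR_mulrn ?(ltW K0)// -[X in _ = _ * X]powR_mulrn ?powR_ge0// -powRrM.
  by rewrite -powRD ?(gt_eqF K0) ?implybT//; congr (_ `^ _); lra.
have -> : n%:R `^ (- 4) = (n%:R ^+ 4)^-1 :> R.
  by rewrite powRN powR_mulrn.
have := p_lt1 H01; rewrite /cell_error => p1.
by field; rewrite !gt_eqF//; lra.
Qed.

Lemma hatG_bounded_error (T K t : R) (n : nat) : 0 < K -> 0 < t <= T -> (0 < n)%N ->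
  `|hatG H K n t - laplace H `[0, K[ t| <= cell_error T K n.
Proof.
move=> K0 /andP[t0 tT] n0; rewrite distrC (le_trans (hatG_estimate H01 K0 t0 n0))//.
rewrite /cell_error ler_pM ?fine_ge0//; first by apply: mulr_ge0; exact: sqr_ge0.
  by rewrite ler_wpM2r ?sqr_ge0// lerXn2r ?nnegrE ?(ltW t0)// (le_trans (ltW t0)).
rewrite -lee_fin fineK; first exact: lambda_bounded_le.
by rewrite ge0_fin_numE// lambda_itv_lty.
Qed.

Lemma hatG_error (T : R) : 0 <= T -> exists2 C : R, 0 <= C &
  forall (K : R) (n : nat), 0 < K -> (0 < n)%N ->
  (\int[mu]_(t in `[0%R, T]) ((hatG H K n t - G_frac H t) ^+ 2)%:E <=
   (C * (K `^ (5 - 2 * H) * n%:R `^ (- 4) + K `^ (- (2 * H))))%:E)%E.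
Proof.
move=> T0; pose C1 := 2 * T * (T ^+ 2 * c * (1 - p)^-1) ^+ 2.
pose C2 := 2 * (g ^+ 2 / (2 * H) + c ^+ 2).
have C10 : 0 <= C1 by rewrite mulr_ge0 ?sqr_ge0// mulr_ge0.
have C20 : 0 <= C2.
  rewrite mulr_ge0// addr_ge0 ?sqr_ge0// divr_ge0 ?sqr_ge0// mulr_ge0//.
  by case/andP: H01 => /ltW.
exists (C1 + C2); first exact: addr_ge0.
move=> K n K0 n0.
have err t : 0 < t <= T -> `|hatG H K n t - G_frac H t| <=
    cell_error T K n + laplace H `[K, +oo[ t.
  move=> /[dup] tT /andP[t0 _]; rewrite (laplace_split (ltW K0) t0) opprD addrA.
  rewrite (le_trans (ler_normB _ _))// lerD ?hatG_bounded_error//.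
  by rewrite ger0_norm// laplace_ge0.
have := kernel_error H01 K0 T0 (cell_error_ge0 T K n)
  (@measurable_atomic_laplace _ (hat_lambda H K n) `[0, T]) err.
move=> /le_trans; apply; rewrite lee_fin cell_error_sqr// mulrA -/C1 -/C2.
have := powR_ge0 K (5 - 2 * H); have := powR_ge0 n%:R (- 4 : R).
have := powR_ge0 K (- (2 * H)).
move: (K `^ (- (2 * H))) (n%:R `^ (- 4)) (K `^ (5 - 2 * H)) => x y z x0 y0 z0.
by have := mulr_ge0 z0 y0; move: (z * y) => zy zy0; nra.
Qed.

Lemma hatG_rate (T : R) (K : nat -> R) : 0 <= T ->
  (forall n, (0 < n)%N -> 0 < K n) ->
  K n / n%:R `^ (4 / 5) @[n --> \oo] --> (1 : R) ->
  exists C : R, exists N : nat, forall n, (0 < n)%N -> (N <= n)%N ->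
  (\int[mu]_(t in `[0%R, T]) ((hatG H (K n) n t - G_frac H t) ^+ 2)%:E <=
   (C * n%:R `^ (- (2 * H * (4 / 5))))%:E)%E.
Proof.
move=> T0 K0 cK; have [C C0 CP] := hatG_error T0.
case/andP: (H01) => H0 H2.
(* Of the equivalence with x = n^(4/5), only x / 2 <= K_n <= 2 x for large n is kept. The exponents
   agree, as (4/5) (5 - 2 H) - 4 = - 2 H (4/5). *)
have /cvgrPdist_le /(_ _ (divr_gt0 ltr01 (ltr0n _ 2)))[N _ NP] := cK.
exists (C * (2 `^ (5 - 2 * H) + 2 `^ (2 * H))), N => n n0 Nn.
apply: (le_trans (CP (K n) n (K0 n n0) n0)).
rewrite lee_fin -mulrA ler_wpM2l//.
have n0' : 0 < n%:R :> R by rewrite ltr0n.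
pose x : R := n%:R `^ (4 / 5); have x0 : 0 < x by rewrite powR_gt0.
have := NP n Nn; rewrite /= -/x ler_norml => /andP[h1 h2].
have K1 : K n <= 2 * x.
  by rewrite -ler_pdivrMr//; move: h1 h2; move: (K n / x) => y; lra.
have K2 : x / 2 <= K n.
  by rewrite mulrC -ler_pdivlMr//; move: h1 h2; move: (K n / x) => y; lra.
have -> : n%:R `^ (- (2 * H * (4 / 5))) = x `^ (- (2 * H)).
  by rewrite /x -powRrM; congr (_ `^ _); lra.
rewrite [leRHS]mulrDl; apply: lerD.
  have -> : 2 `^ (5 - 2 * H) * x `^ (- (2 * H)) = (2 * x) `^ (5 - 2 * H) * n%:R `^ (- 4).
    rewrite powRM ?(ltW x0)// -mulrA; congr (_ * _).
    rewrite /x -!powRrM -powRD ?(gt_eqF n0') ?implybT//; congr (_ `^ _); lra.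
  rewrite ler_wpM2r ?powR_ge0// ge0_ler_powR ?nnegrE//; first lra.
    exact/ltW/K0.
  by rewrite mulr_ge0// ltW.
have -> : 2 `^ (2 * H) * x `^ (- (2 * H)) = (x / 2) `^ (- (2 * H)).
  rewrite powRM ?(ltW x0)// mulrC; congr (_ * _).
  by rewrite -powR_inv1// -powRrM; congr (_ `^ _); lra.
rewrite !powRN lef_pV2 ?posrE ?powR_gt0 ?K0//; last by rewrite divr_gt0.
rewrite ge0_ler_powR ?nnegrE//; first by rewrite mulr_ge0// ltW.
  by rewrite divr_ge0// ltW.
exact/ltW/K0.
Qed.

End barycentric.

(** * Newton-Cotes quadrature *)

Section newton_cotes.
Context {R : realType}.
Local Notation mu := (@lebesgue_measure R).

Definition poly_integral (q : {poly R}) : R := \int[mu]_(x in `[0, 1]) q.[x].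

Lemma continuous_horner_poly (q : {poly R}) : continuous (horner q).
Proof.
move=> x; apply: differentiable_continuous; apply/derivable1_diffP.
exact: derivable_horner.
Qed.

Lemma integrable_horner (q : {poly R}) :
  mu.-integrable `[0, 1] (EFin \o horner q).
Proof.
apply: continuous_compact_integrable; first exact: segment_compact.
by apply: continuous_subspaceT; exact: continuous_horner_poly.
Qed.

Lemma poly_integralD (q r : {poly R}) :
  poly_integral (q + r) = poly_integral q + poly_integral r.
Proof.
rewrite /poly_integral -(RintegralD _ (integrable_horner q) (integrable_horner r))//.
by apply: eq_Rintegral => x _; rewrite hornerD.
Qed.

Lemma poly_integralZ (k : R) (q : {poly R}) :
  poly_integral (k *: q) = k * poly_integral q.
Proof.
rewrite /poly_integral -(RintegralZl _ _ (integrable_horner q))//.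
by apply: eq_Rintegral => x _; rewrite hornerZ.
Qed.

Lemma poly_integral_sum (I : Type) (s : seq I) (F : I -> {poly R}) :
  poly_integral (\sum_(i <- s) F i) = \sum_(i <- s) poly_integral (F i).
Proof.
elim: s => [|i s IH]; last by rewrite !big_cons poly_integralD IH.
rewrite !big_nil /poly_integral; under eq_Rintegral do rewrite horner0.
by rewrite Rintegral_cst// mul0r.
Qed.

Variable J : nat.
Hypothesis J0 : (0 < J)%N.

Let Jn0 : J%:R != 0 :> R. Proof. by rewrite pnatr_eq0 -lt0n. Qed.

Local Notation node m := (m%:R / J%:R : R).

(** The Lagrange basis for the nodes m / J, scaled so that its values are literally the integrand of
    [newton_cotes_weight]. *)
Definition lagrange_poly (m : nat) : {poly R} :=
  \prod_(0 <= l < J.+1 | l != m) ((m%:R - l%:R)^-1 *: (J%:R *: 'X - l%:R%:P)).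

Lemma horner_lagrange_poly (m : nat) (x : R) : (lagrange_poly m).[x] =
  \prod_(0 <= l < J.+1 | l != m) ((J%:R * x - l%:R) / (m%:R - l%:R)).
Proof.
rewrite /lagrange_poly horner_prod; apply: eq_bigr => l _.
by rewrite !hornerE mulrC.
Qed.

Lemma newton_cotes_weightE (m : nat) :
  newton_cotes_weight J m = poly_integral (lagrange_poly m).
Proof. by apply: eq_Rintegral => x _; rewrite horner_lagrange_poly. Qed.

Lemma size_prod_linear (s : seq nat) (Q : pred nat) (F : nat -> {poly R}) :
  (forall l, (size (F l) <= 2)%N) ->
  (size (\prod_(l <- s | Q l) F l)%R <= (count Q s).+1)%N.
Proof.
move=> F2; elim: s => [|l s IH]; first by rewrite big_nil size_poly1.
rewrite big_cons /=; case: (Q l) => //=.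
rewrite (leq_trans (size_polyMleq _ _))//.
by rewrite -subn1 leq_subLR (leq_trans (leq_add (F2 l) IH)).
Qed.

Lemma size_lagrange_poly (m : nat) : (m <= J)%N -> (size (lagrange_poly m) <= J.+1)%N.
Proof.
move=> mJ; rewrite (leq_trans (size_prod_linear _ _ _))//.
  move=> l; rewrite (leq_trans (size_scale_leq _ _))//.
  rewrite (leq_trans (size_polyD _ _))// geq_max size_polyN.
  rewrite (leq_trans (size_scale_leq _ _)) ?size_polyX//=.
  by rewrite (leq_trans (size_polyC_leq1 _)).
rewrite ltnS; have := count_predC (pred1 m) (index_iota 0 J.+1).
rewrite count_uniq_mem ?iota_uniq// mem_index_iota/= ltnS mJ size_iota.
by rewrite (@eq_count _ (predC (pred1 m)) (fun l => l != m))//; lia.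
Qed.

Lemma lagrange_poly_node (m k : nat) : (m <= J)%N -> (k <= J)%N ->
  (lagrange_poly m).[node k] = (k == m)%:R.
Proof.
move=> mJ kJ; rewrite horner_lagrange_poly mulrC divfK//.
have [->|km] := eqVneq k m.
  rewrite big1// => l lm; rewrite divff// subr_eq0 eqr_nat eq_sym//.
rewrite big_mkord (bigD1 (Ordinal (kJ : (k < J.+1)%N)))//=.
by rewrite subrr !mul0r.
Qed.

Definition quadrature (f : R -> R) : R :=
  \sum_(0 <= m < J.+1) newton_cotes_weight J m * f (node m).

(** The difference has degree at most J and J + 1 distinct roots. *)
Lemma lagrange_interpolation (q : {poly R}) : (size q <= J.+1)%N ->
  q = \sum_(0 <= m < J.+1) q.[node m] *: lagrange_poly m.
Proof.
move=> sq; apply/eqP; rewrite -subr_eq0; apply/negPn/negP => d0.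
set D := q - _ in d0.
pose rs := [seq node m | m <- iota 0 J.+1].
have urs : uniq rs.
  rewrite map_inj_in_uniq ?iota_uniq// => x y _ _ /(mulIf (invr_neq0 Jn0)).
  by move/eqP; rewrite eqr_nat => /eqP.
have ars : all (root D) rs.
  apply/allP => _ /mapP[k + ->]; rewrite mem_iota/= add0n ltnS => kJ.
  rewrite /root /D hornerD hornerN horner_sum subr_eq0; apply/eqP.
  rewrite big_mkord (bigD1 (Ordinal (kJ : (k < J.+1)%N)))//= hornerZ.
  rewrite lagrange_poly_node// eqxx mulr1 big1 ?addr0// => l lk.
  rewrite hornerZ (lagrange_poly_node (leq_ord l) kJ).
  by rewrite (_ : (k == l) = false) ?mulr0//; apply/negP => /eqP kl; move/eqP: lk; apply; apply/val_inj.
have := max_poly_roots d0 ars urs; rewrite size_map size_iota ltnNge => /negP; apply.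
rewrite (leq_trans (size_polyD _ _))// geq_max sq size_polyN.
rewrite big_mkord; apply: (big_ind (fun r : {poly R} => (size r <= J.+1)%N)).
- by rewrite size_poly0.
- by move=> a b sa sb; rewrite (leq_trans (size_polyD _ _))// geq_max sa.
- by move=> i _; rewrite (leq_trans (size_scale_leq _ _))// size_lagrange_poly// leq_ord.
Qed.

Lemma quadrature_poly_low (q : {poly R}) : (size q <= J.+1)%N ->
  poly_integral q = quadrature (horner q).
Proof.
move=> sq; rewrite [in LHS](lagrange_interpolation sq) poly_integral_sum.
apply: eq_bigr => m _.
by rewrite poly_integralZ newton_cotes_weightE mulrC.
Qed.

Definition node_poly : {poly R} := \prod_(0 <= l < J.+1) ('X - (node l)%:P).

Lemma size_node_poly : size node_poly = J.+2.
Proof. by rewrite size_prod_XsubC size_iota subn0. Qed.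

Lemma node_poly_node k : (k <= J)%N -> node_poly.[node k] = 0.
Proof.
move=> kJ; rewrite /node_poly horner_prod big_mkord.
by rewrite (bigD1 (Ordinal (kJ : (k < J.+1)%N)))//= hornerXsubC subrr mul0r.
Qed.

(* There is an odd number of nodes, symmetric about [1 / 2]. *)
Lemma node_poly_onem (x : R) : ~~ odd J -> node_poly.[1 - x] = - node_poly.[x].
Proof.
move=> eJ; rewrite /node_poly !horner_prod !big_mkord (reindex_inj rev_ord_inj)/=.
transitivity (\prod_(i < J.+1) (- 1 * ('X - (node i)%:P).[x])).
  apply: eq_bigr => i _; rewrite !hornerXsubC subSS natrB ?leq_ord//.
  by field.
by rewrite big_split/= prodr_const card_ord -signr_odd/= eJ expr1 mulN1r.
Qed.

(** The substitution x -> 1 - x preserves the integral, while [node_poly_onem] makes it change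
    sign. *)
Lemma poly_integral_node_poly : ~~ odd J -> poly_integral node_poly = 0.
Proof.
move=> eJ; have E : poly_integral node_poly = - poly_integral node_poly.
  rewrite {1}/poly_integral Rintegration_by_substitution_onem//; last 2 first.
  - by rewrite ler01 lexx.
  - by apply: continuous_subspaceT; exact: continuous_horner_poly.
  rewrite /onem subrr -mulN1r -poly_integralZ; apply: eq_Rintegral => x _.
  by rewrite node_poly_onem// hornerZ mulN1r.
by move: E; lra.
Qed.

(** [node_poly] is monic of degree J + 1, vanishes at the nodes and has integral 0: subtracting a
    multiple of it lowers the degree of q and changes neither side. *)
Lemma quadrature_poly (q : {poly R}) : ~~ odd J -> (size q <= J.+2)%N ->
  poly_integral q = quadrature (horner q).
Proof.
move=> eJ sq; pose a := q`_J.+1; pose r := q - a *: node_poly.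
have sr : (size r <= J.+1)%N.
  apply/leq_sizeP => j Jj; rewrite coefB coefZ.
  move: Jj; rewrite leq_eqVlt => /predU1P[<-|Jj].
    have : lead_coef node_poly = 1.
      by apply/monicP; rewrite monic_prod_XsubC.
    by rewrite lead_coefE size_node_poly/= => ->; rewrite mulr1 subrr.
  rewrite !nth_default ?mulr0 ?subr0//; first by rewrite size_node_poly.
  by rewrite (leq_trans sq).
have -> : q = a *: node_poly + r by rewrite /r addrC subrK.
rewrite poly_integralD poly_integralZ poly_integral_node_poly// mulr0 add0r.
rewrite quadrature_poly_low//; apply: eq_big_nat => m /andP[_ mJ].
by rewrite [in RHS]hornerD [in RHS]hornerZ node_poly_node ?mulr0 ?add0r.
Qed.

End newton_cotes.

(** * Approximation by Taylor polynomials *)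

Section taylor.
Context {R : realType}.

(** Meant for k at least the size of q. The constant coefficient is a division by 0, hence 0. *)
Definition antiderivative (k : nat) (q : {poly R}) : {poly R} :=
  \poly_(i < k.+1) (q`_i.-1 / i%:R).

Lemma deriv_antiderivative (k : nat) (q : {poly R}) : (size q <= k)%N ->
  (antiderivative k q)^`() = q.
Proof.
move=> sq; apply/polyP => i; rewrite coef_deriv coef_poly ltnS/=.
case: ltnP => ik; last by rewrite mul0rn nth_default// (leq_trans sq).
by rewrite -[LHS]mulr_natr divfK// pnatr_eq0.
Qed.

Lemma is_derive_horner (q : {poly R}) (x : R) : is_derive x 1 (horner q) q^`().[x].
Proof.
by apply: DeriveDef; [exact: derivable_horner|rewrite derivE derive1E].
Qed.

(** Here g_i is the i-th derivative of g_0. By induction a polynomial close to g_1 is integrated,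
    its constant is adjusted at a, and the mean value theorem passes the bound to g_0. Only the size
    of q matters later, so its coefficients are not exhibited. *)
Lemma taylor_poly (k : nat) (g : nat -> R -> R) (a b M : R) :
  (forall i x, a <= x <= b -> is_derive x 1 (g i) (g i.+1 x)) ->
  (forall x, a <= x <= b -> `|g k x| <= M) ->
  exists2 q : {poly R}, (size q <= k)%N &
    forall x, a <= x <= b -> `|g 0%N x - q.[x]| <= M * (x - a) ^+ k.
Proof.
elim: k g => [|k IH] g dg gM.
  exists 0; first by rewrite size_poly0.
  by move=> x xab; rewrite horner0 subr0 expr0 mulr1 gM.
have [q sq qM] := IH (fun i => g i.+1) (fun i => dg i.+1) gM.
pose Q0 := antiderivative k q.
pose Q := Q0 + (g 0%N a - Q0.[a])%:P.
exists Q.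
  rewrite (leq_trans (size_polyD _ _))// geq_max size_poly/=.
  by rewrite (leq_trans (size_polyC_leq1 _)).
move=> x /andP[ax xb].
have ab := le_trans ax xb.
pose f y := g 0%N y - Q.[y].
have fa : f a = 0 by rewrite /f /Q hornerD hornerC; ring.
have df y : a <= y <= b -> is_derive y 1 f (g 1%N y - q.[y]).
  move=> yab; have h1 := dg 0%N y yab.
  have h2 := is_derive_horner Q y.
  have -> : q = Q^`() by rewrite derivD derivC addr0 deriv_antiderivative.
  exact: is_deriveB.
have [c cax] : exists2 c, c \in `[a, x] & f x - f a = (g 1%N c - q.[c]) * (x - a).
  apply: (MVT_segment (f := f) (df := fun y => g 1%N y - q.[y])) => //.
  - move=> y; rewrite in_itv/= => /andP[ay yx]; apply: df.
    by rewrite (ltW ay) (le_trans (ltW yx)).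
  - apply: derivable_within_continuous => y; rewrite in_itv/= => /andP[ay yx].
    have : a <= y <= b by rewrite ay (le_trans yx).
    by move=> /df [].
rewrite fa subr0 -/(f x) => ->.
move: cax; rewrite in_itv/= => /andP[ac cx].
rewrite normrM (ger0_norm (_ : 0 <= x - a)) ?subr_ge0// exprSr mulrA.
rewrite ler_wpM2r ?subr_ge0//.
rewrite (le_trans (qM c _)) ?ac ?(le_trans cx)//.
have M0 : 0 <= M by rewrite (le_trans _ (gM x _)) ?ax.
by rewrite ler_wpM2l// lerXn2r ?nnegrE ?subr_ge0// lerD2r.
Qed.

End taylor.

(** * The Newton-Cotes rule on one cell *)

Section cell.
Context {R : realType}.
Local Notation mu := (@lebesgue_measure R).
Variable J : nat.
Hypotheses (J0 : (0 < J)%N) (eJ : ~~ odd J).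

(** Bounds, for the supremum norm on [0, 1], the functional that maps f to its integral minus its
    quadrature. *)
Definition newton_cotes_norm : R :=
  1 + \sum_(0 <= m < J.+1) `|newton_cotes_weight J m|.

Lemma integral_itv_affine (f : R -> R) (a h : R) : 0 < h ->
  measurable_fun `[a, a + h] f -> (forall x, `[a, a + h]%classic x -> 0 <= f x) ->
  (\int[mu]_(x in `[a, (a + h)%R]) (f x)%:E =
   h%:E * \int[mu]_(y in `[0%R, 1%R]) (f (a + h * y))%:E)%E.
Proof.
move=> h0 mf f0.
pose F (x : R) := (((fun x => (f x)%:E) \_ `[a, (a + h)%R]) x : \bar R)%E.
have mF : measurable_fun setT F.
  by apply/(measurable_restrictT _ _).1 => //; exact/measurable_EFinP.
have F0 x : (0 <= F x)%E by apply: erestrict_ge0 => y /f0; rewrite lee_fin.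
have E : (\int[mu]_(y in `[0%R, 1%R]) (f (a + h * y)%R)%:E = \int[mu]_y F (a + h * y)%R)%E.
  rewrite integral_mkcond; apply: eq_integral => y _.
  rewrite /F !patchE !mem_setE !in_itv/= lerDl lerD2l.
  by rewrite pmulr_rge0// -[X in h * y <= X]mulr1 ler_pM2l.
by rewrite E ge0_integral_affine// muleA -EFinM divff ?gt_eqF// mul1e -integral_mkcond.
Qed.

(** The rule is exact on q, so the error on f is that on f - q. All is transported to [0, 1] by x =
    a + h y, which does not raise the degree of q. *)
Lemma newton_cotes_cell (f : R -> R) (q : {poly R}) (a h e : R) : 0 < h ->
  {within `[a, a + h], continuous f} ->
  (forall x, a <= x <= a + h -> 0 <= f x) ->
  (size q <= J.+2)%N ->
  (forall x, a <= x <= a + h -> `|f x - q.[x]| <= e) ->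
  `|\int[mu]_(x in `[a, a + h]) f x -
    h * \sum_(0 <= m < J.+1) newton_cotes_weight J m * f (a + h * (m%:R / J%:R))|
  <= h * (newton_cotes_norm * e).
Proof.
move=> h0 cf f0 sq fq.
have mf : measurable_fun `[a, a + h] f by exact: subspace_continuous_measurable_fun.
have f0' x : `[a, a + h]%classic x -> 0 <= f x by rewrite /= in_itv/=; exact: f0.
have sub y : `[0, 1]%classic y -> a <= a + h * y <= a + h.
  rewrite /= in_itv/= => /andP[y0 y1].
  by rewrite lerDl mulr_ge0 ?(ltW h0)//= lerD2l ler_piMr// ltW.
pose F y := f (a + h * y).
have iff : mu.-integrable `[0, 1] (EFin \o F).
  have mF : measurable_fun (`[0%R, 1%R]%classic : set R) F.
    apply: (measurable_comp (F := `[a, a + h])) => //.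
      by move=> _ [y /sub y01 <-]; rewrite /= in_itv/=.
    by apply: measurable_funTS; exact: measurable_affine.
  apply/integrableP; split; first exact/measurable_EFinP.
  under eq_integral => y.
    rewrite inE => /sub /f0 y0; rewrite /= ger0_norm//; over.
  have : (\int[mu]_(x in `[a, (a + h)%R]) (f x)%:E < +oo)%E.
    apply: integrable_lty => //.
    by apply: continuous_compact_integrable => //; exact: segment_compact.
  rewrite integral_itv_affine// => lt.
  rewrite ltey; apply/eqP => eqy; move: lt; rewrite /F in eqy; rewrite eqy.
  by rewrite gt0_muley ?lte_fin// ltxx.
have -> : \int[mu]_(x in `[a, a + h]) f x = h * \int[mu]_(y in `[0, 1]) F y.
  rewrite /Rintegral integral_itv_affine// fineM//.
  exact: (integrable_fin_num _ iff).
rewrite -mulrBr normrM (gtr0_norm h0) ler_pM2l//.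
pose Q := q \Po (a%:P + h *: 'X).
have QE y : Q.[y] = q.[a + h * y] by rewrite horner_comp !hornerE.
have sQ : (size Q <= J.+2)%N.
  rewrite (leq_trans (size_comp_poly_leq _ _))//.
  have s2 : (size (a%:P + h *: 'X)%R <= 2)%N.
    rewrite (leq_trans (size_polyD _ _))// geq_max.
    rewrite (leq_trans (size_polyC_leq1 _))//=.
    by rewrite (leq_trans (size_scale_leq _ _)) ?size_polyX.
  have : ((size q).-1 * (size (a%:P + h *: 'X)%R).-1 <= J.+1 * 1)%N.
    by apply: leq_mul; lia.
  by rewrite muln1 ltnS.
have FQ y : `[0, 1]%classic y -> `|F y - Q.[y]| <= e.
  by move=> /sub y01; rewrite QE fq.
have iQ := integrable_horner Q.
have -> : \sum_(0 <= m < J.+1) newton_cotes_weight J m * f (a + h * (m%:R / J%:R)) =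
  quadrature J F by [].
rewrite (_ : _ - _ = (\int[mu]_(y in `[0, 1]) F y - poly_integral Q) -
  (quadrature J F - quadrature J (horner Q))); last first.
  by rewrite (quadrature_poly J0 eJ sQ); ring.
rewrite (le_trans (ler_normB _ _))// /newton_cotes_norm mulrDl mul1r lerD//.
  rewrite /poly_integral -(RintegralB _ iff iQ)//.
  have iFQ : mu.-integrable `[0, 1] (EFin \o (fun y => F y - Q.[y])).
    exact: (integrableB _ iff iQ).
  rewrite (le_trans (le_normr_Rintegral _ iFQ))//.
  have := @Rintegral_cst _ _ _ mu `[0%R, 1%R]%classic (measurable_itv _) e.
  rewrite /= lebesgue_measure_itv/= lte_fin ltr01 oppr0 adde0/= mulr1 => <-.
  apply: le_Rintegral => //.
  - exact: (integrable_norm iFQ).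
  - apply: continuous_compact_integrable; first exact: segment_compact.
    by apply: continuous_subspaceT => x; exact: cvg_cst.
rewrite /quadrature -sumrB mulr_suml (le_trans (ler_norm_sum _ _ _))//.
rewrite big_nat_cond [leRHS]big_nat_cond; apply: ler_sum => m /andP[/andP[_ mJ] _].
rewrite -mulrBr normrM ler_wpM2l// FQ//= in_itv/= divr_ge0//=.
by rewrite ler_pdivrMr ?ltr0n// mul1r ler_nat -ltnS.
Qed.

End cell.

Section derivatives.
Context {R : realType}.

(** The k-th derivative in rho of exp (- rho t) rho^(- alpha). One derivative gives - t times the
    same function minus alpha times the one for alpha + 1; letting alpha vary in the recursion
    avoids a Leibniz sum. *)
Fixpoint exp_powR_deriv (k : nat) (alpha t rho : R) : R :=
  if k is k'.+1 then
    - t * exp_powR_deriv k' alpha t rho - alpha * exp_powR_deriv k' (alpha + 1) t rho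
  else expR (- rho * t) * rho `^ (- alpha).

Lemma is_derive_exp_powR (k : nat) (alpha t rho : R) : 0 < rho ->
  is_derive rho 1 (exp_powR_deriv k alpha t) (exp_powR_deriv k.+1 alpha t rho).
Proof.
move=> rho0; elim: k alpha => [|k IH] alpha.
  have h1 : is_derive rho 1 (fun x : R => expR (- x * t)) (- t * expR (- rho * t)).
    have h0 : is_derive rho 1 (fun x : R => - x * t) (- t).
      have -> : (fun x : R => - x * t) = (fun x : R => - t *: x).
        by apply/funext => x; rewrite /GRing.scale/=; ring.
      have := @is_deriveZ _ _ _ _ (- t) _ _ _ (is_derive_id rho (1 : R)).
      by move=> h; apply: (is_derive_eq h); rewrite /GRing.scale/= mulr1.
    have := @is_derive1_comp R expR (fun x : R => - x * t) rho _ _ (is_derive_expR _) h0.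
    by move=> h; apply: (is_derive_eq h); rewrite mulrC.
  have h2 := is_derive1_powR (- alpha) rho0.
  apply: (is_derive_eq (is_deriveM h1 h2)).
  by rewrite /= /GRing.scale/= opprD; ring.
have h1 := is_deriveZ (- t) (IH alpha).
have h2 := is_deriveZ alpha (IH (alpha + 1)).
exact: (is_deriveB h1 h2).
Qed.

(** For rho >= 1 the power with alpha + 1 is dominated by the one with alpha, so a single power
    bounds all terms. *)
Lemma exp_powR_deriv_bound (k : nat) (alpha T : R) : 0 <= alpha -> 0 <= T ->
  exists2 C : R, 0 <= C & forall t rho : R, 0 <= t <= T -> 1 <= rho ->
    `|exp_powR_deriv k alpha t rho| <= C * rho `^ (- alpha).
Proof.
move=> a0 T0; elim: k alpha a0 => [|k IH] alpha a0.
  exists 1 => // t rho /andP[t0 tT] rho1.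
  rewrite /= normrM !ger0_norm ?powR_ge0 ?expR_ge0// ler_wpM2r ?powR_ge0//.
  by rewrite expR_le1 mulNr oppr_le0 mulr_ge0// (le_trans _ rho1).
have [C1 C10 h1] := IH alpha a0.
have [C2 C20 h2] := IH (alpha + 1) (addr_ge0 a0 ler01).
exists (T * C1 + alpha * C2); first by rewrite addr_ge0// mulr_ge0.
move=> t rho tT rho1; have /andP[t0 tT'] := tT.
rewrite /= (le_trans (ler_normB _ _))// !normrM normrN (ger0_norm t0) (ger0_norm a0).
rewrite mulrDl; apply: lerD; rewrite -mulrA.
  by apply: ler_pM => //; exact: h1.
rewrite ler_wpM2l// (le_trans (h2 t rho tT rho1))// ler_wpM2l//.
by rewrite ler_powR//; lra.
Qed.

End derivatives.

(** * The composite rule on [L, K] *)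

Section composite.
Context {R : realType}.
Local Notation mu := (@lebesgue_measure R).
Variables (H : R) (J : nat).
Hypotheses (H01 : 0 < H < 2^-1) (J0 : (0 < J)%N) (eJ : ~~ odd J).
Local Notation p := (H + 2^-1).
Local Notation c := (c_ H).

Definition exp_powR (t rho : R) : R := expR (- rho * t) * rho `^ (- p).

Lemma within_continuous_exp_powR (t x y : R) : 0 < x ->
  {within `[x, y], continuous (exp_powR t)}.
Proof.
move=> x0; apply: derivable_within_continuous => r; rewrite in_itv/= => /andP[xr _].
by have [] := is_derive_exp_powR 0 p t (lt_le_trans x0 xr).
Qed.

Lemma laplace_itvE (x y t : R) : 0 < x -> 0 < t ->
  laplace H `[x, y[ t = c * \int[mu]_(r in `[x, y]) exp_powR t r.
Proof.
move=> x0 t0.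
have iw : mu.-integrable `[x, y] (EFin \o exp_powR t).
  apply: continuous_compact_integrable; first exact: segment_compact.
  exact: within_continuous_exp_powR.
rewrite -RintegralZl//; congr fine.
rewrite ge0_integral_lambda//; last 2 first.
- by move=> z /=; rewrite !in_itv/= andbT => /andP[+ _]; apply: le_trans; exact: ltW.
- by apply/measurable_EFinP; exact: measurable_expRNM.
rewrite integral_itv_bndo_bndc.
  by apply: eq_integral => r _; rewrite -EFinM; congr EFin; rewrite /exp_powR mulrCA.
apply: emeasurable_funM; first by apply/measurable_EFinP; exact: measurable_expRNM.
apply: measurable_funTS; apply/measurable_EFinP; apply: measurable_funM => //.
Qed.

(** L >= 1 gives access to [exp_powR_deriv_bound]. On each cell of width h the Taylor error is of
    order L^(- p) h^(J + 2) and is integrated over length h; finally n h = K - L <= K. *)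
Lemma newton_cotes_estimate (T : R) : 0 <= T -> exists2 C : R, 0 <= C &
  forall (L K t : R) (n : nat), 1 <= L -> L < K -> 0 < t <= T -> (0 < n)%N ->
  `|laplace H `[L, K[ t -
     atomic_laplace [seq (c * (K - L) / n%:R * newton_cotes_weight J m
          * nc_node K L J n i m `^ (- H - 2^-1),
        nc_node K L J n i m) | i <- iota 1 n, m <- iota 0 J.+1] t|
  <= C * (L `^ (- p) * (K / n%:R) ^+ J.+2 * K).
Proof.
move=> T0.
have [D D0 DP] := @exp_powR_deriv_bound R J.+2 p T (ltW (p_gt0 H01)) T0.
have N0 : 0 <= @newton_cotes_norm R J by rewrite addr_ge0 ?sumr_ge0.
have c0 := c_ge0 H.
exists (c * (newton_cotes_norm J * D)); first by rewrite !mulr_ge0.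
move=> L K t n L1 LK tT n0; have /andP[t0 _] := tT.
have L0 : 0 < L := lt_le_trans ltr01 L1.
have n0' : 0 < n%:R :> R by rewrite ltr0n.
set h := (K - L) / n%:R.
have h0 : 0 < h by rewrite divr_gt0// subr_gt0.
have hK : h <= K / n%:R by rewrite ler_wpM2r ?invr_ge0 ?(ltW n0')// gerBl ltW.
pose e := D * L `^ (- p) * h ^+ J.+2.
have cell i : `|\int[mu]_(x in `[L + h * i%:R, L + h * i%:R + h]) exp_powR t x -
    h * \sum_(0 <= m < J.+1) newton_cotes_weight J m *
      exp_powR t (L + h * i%:R + h * (m%:R / J%:R))| <= h * (newton_cotes_norm J * e).
  set x := L + h * i%:R.
  have xL : L <= x by rewrite lerDl mulr_ge0// ltW.
  have x0 := lt_le_trans L0 xL.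
  have ge_x y : x <= y <= x + h -> [/\ 0 < y, 1 <= y & L <= y].
    move=> /andP[xy _]; have Ly := le_trans xL xy.
    by split; [exact: lt_le_trans Ly|exact: le_trans Ly|].
  have dg k y : x <= y <= x + h ->
      is_derive y 1 (exp_powR_deriv k p t) (exp_powR_deriv k.+1 p t y).
    by move=> /ge_x[y0 _ _]; exact: is_derive_exp_powR.
  have gM y : x <= y <= x + h -> `|exp_powR_deriv J.+2 p t y| <= D * L `^ (- p).
    move=> /ge_x[y0 y1 Ly]; apply: (le_trans (DP t y _ y1)).
      by rewrite (ltW t0); case/andP: tT.
    rewrite ler_wpM2l// !powRN lef_pV2 ?posrE ?powR_gt0//.
    by rewrite ge0_ler_powR ?nnegrE ?(ltW (p_gt0 H01)) ?(ltW L0) ?(ltW y0).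
  have [q sq qP] := taylor_poly dg gM.
  apply: (newton_cotes_cell J0 eJ h0 _ _ sq).
  - exact: within_continuous_exp_powR.
  - by move=> y _; rewrite mulr_ge0 ?expR_ge0 ?powR_ge0.
  - move=> y /[dup] xyh /andP[xy yx]; apply: (le_trans (qP y xyh)).
    rewrite /e ler_wpM2l ?mulr_ge0 ?powR_ge0// lerXn2r ?nnegrE ?subr_ge0 ?(ltW h0)//.
    by rewrite lerBlDl.
(* Cells are numbered from 1 in the list of atoms and from 0 in the sums. *)
have atomE m : atomic_laplace [seq (c * (K - L) / n%:R * newton_cotes_weight J m0
        * nc_node K L J n i m0 `^ (- H - 2^-1), nc_node K L J n i m0)
      | i <- iota 1 m, m0 <- iota 0 J.+1] t =
    \sum_(0 <= i < m) c * (h * \sum_(0 <= m0 < J.+1) newton_cotes_weight J m0 *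
      exp_powR t (L + h * i%:R + h * (m0%:R / J%:R))).
  rewrite /atomic_laplace big_allpairs_dep/= (_ : iota 1 m = map S (iota 0 m)); last first.
    by rewrite -(iotaDl 1 0 m) addn0.
  have ioE k : iota 0 k = index_iota 0 k by rewrite /index_iota subn0.
  rewrite big_map !ioE.
  apply: eq_bigr => i _; rewrite mulr_sumr mulr_sumr.
  apply: eq_bigr => k _; rewrite /exp_powR powRNp.
  have -> : nc_node K L J n i.+1 k = L + h * i%:R + h * (k%:R / J%:R).
    by rewrite /nc_node -/h -natr1; ring.
  by rewrite -/h -(mulrA c) -/h; ring.
(* Partial sums over m cells of the fixed width h, so that the intervals are joined one at a
   time. *)
suff main m : (m <= n)%N -> `|laplace H `[L, L + h * m%:R[ t -
    \sum_(0 <= i < m) c * (h * \sum_(0 <= m0 < J.+1) newton_cotes_weight J m0 *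
      exp_powR t (L + h * i%:R + h * (m0%:R / J%:R)))|
    <= c * (h * (newton_cotes_norm J * e)) * m%:R.
  rewrite atomE; have := main n (leqnn n).
  have -> : L + h * n%:R = K by rewrite /h divfK ?gt_eqF// addrC subrK.
  move=> /le_trans; apply.
  have -> : c * (h * (newton_cotes_norm J * e)) * n%:R =
      c * (newton_cotes_norm J * D) * (L `^ (- p) * h ^+ J.+2 * (h * n%:R)).
    by rewrite /e; ring.
  rewrite ler_wpM2l ?mulr_ge0//; apply: ler_pM.
  - by rewrite mulr_ge0 ?powR_ge0// exprn_ge0// ltW.
  - by rewrite mulr_ge0 ?ler0n// ltW.
  - rewrite ler_wpM2l ?powR_ge0// lerXn2r ?nnegrE ?(ltW h0)//.
    by rewrite divr_ge0 ?(ltW n0')// ltW// (lt_trans L0).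
  - by rewrite -ler_pdivlMr.
elim: m => [_|m IH mn].
  by rewrite big_geq// mulr0 addr0 set_itvco0 /laplace Rintegral_set0 subr0 normr0 mulr0.
rewrite big_nat_recr//=.
set x := L + h * m%:R in IH *.
have -> : L + h * m.+1%:R = x + h by rewrite /x -natr1; ring.
have xL : L <= x by rewrite lerDl mulr_ge0// ltW.
have x0 := lt_le_trans L0 xL.
have U : `[L, x + h[%classic = `[L, x[%classic `|` `[x, x + h[%classic :> set R.
  by rewrite -itv_bndbnd_setU// bnd_simp// lerDl ltW.
have dis : [disjoint `[L, x[%classic & `[x, x + h[%classic : set R].
  apply/disj_setPS => z [] /=; rewrite !in_itv/= => /andP[_ zx] /andP[xz _].
  by move: (le_lt_trans xz zx); rewrite ltxx.
have sub : (`[L, x + h[%classic : set R) `<=` `[0, +oo[%classic.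
  by move=> z /=; rewrite !in_itv/= andbT => /andP[+ _]; apply: le_trans; exact: ltW.
have -> : laplace H `[L, (x + h)[ t = laplace H `[L, x[ t + laplace H `[x, (x + h)[ t.
  rewrite /laplace U Rintegral_setU//; rewrite -U.
  by apply: integrable_laplace.
rewrite opprD addrACA (le_trans (ler_normD _ _))// -natr1 mulrDr mulr1 lerD//.
  exact: IH (ltnW mn).
rewrite laplace_itvE// -mulrBr normrM (ger0_norm c0) ler_wpM2l//.
exact: cell.
Qed.

End composite.

(** * Balancing the exponents of the Newton-Cotes kernel *)

Section newton_cotes_rate.
Context {R : realType}.
Local Notation mu := (@lebesgue_measure R).
Variables (H : R) (J : nat).
Hypotheses (H01 : 0 < H < 2^-1) (J0 : (0 < J)%N) (eJ : ~~ odd J).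
Local Notation p := (H + 2^-1).
Local Notation c := (c_ H).
Local Notation g := (Gamma (H + 2^-1))^-1.

(** K = n^(D / D'), L = n^(N / D') and beta = N / D. The exponent identities below rest on D = N + J
    and D' = D + 3. *)
Let D : R := 5 * J%:R + 12 - 2 * H * J%:R.
Let D' : R := 5 * J%:R + 15 - 2 * H * J%:R.
Let N : R := 4 * J%:R + 12 - 2 * H * J%:R.

Let j0 : 0 < J%:R :> R. Proof. by rewrite ltr0n. Qed.

Let Hj : 0 < H * J%:R < 2^-1 * J%:R.
Proof. by case/andP: H01 => H0 H2; rewrite mulr_gt0//= ltr_pM2r. Qed.

Let D_gt0 : 0 < D. Proof. by case/andP: Hj; rewrite /D; have := j0; lra. Qed.
Let D'_gt0 : 0 < D'. Proof. by case/andP: Hj; rewrite /D'; have := j0; lra. Qed.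
Let N_gt0 : 0 < N. Proof. by case/andP: Hj; rewrite /N; have := j0; lra. Qed.

Lemma K_NC_exponent : 4 / (5 * beta_ H J + 2 * H * (1 - beta_ H J)) = D / D'.
Proof.
have Dn : D != 0 by rewrite gt_eqF.
have D'n : D' != 0 by rewrite gt_eqF.
have -> : 5 * beta_ H J + 2 * H * (1 - beta_ H J) = 4 * D' / D.
  by rewrite /beta_ -/D; apply: (mulIf Dn); rewrite divfK// /D' /D; field; exact: Dn.
by field; rewrite Dn D'n.
Qed.

Lemma K_NCE n : K_NC H J n = n%:R `^ (D / D').
Proof. by rewrite /K_NC K_NC_exponent. Qed.

Lemma K_NC_beta n : K_NC H J n `^ beta_ H J = n%:R `^ (N / D').
Proof.
rewrite K_NCE -powRrM; congr (_ `^ _); rewrite /beta_ -/D -/N.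
by field; rewrite !gt_eqF.
Qed.

(** For n = 1 one has K = L = 1, and the interval [L, K] degenerates. For n >= 2 the three
    contributions to the squared error are multiples of the same power of n. *)
Lemma hatG_NC_rate (T : R) : 0 <= T -> exists C : R, forall n, (2 <= n)%N ->
  (\int[mu]_(t in `[0%R, T]) ((hatG_NC H J n t - G_frac H t) ^+ 2)%:E <=
   (C * n%:R `^ (- (2 * H * (D / D'))))%:E)%E.
Proof.
move=> T0; have [C C0 CP] := newton_cotes_estimate H01 J0 eJ T0.
pose A := (T ^+ 2 * c * (1 - p)^-1) ^+ 2.
pose B := 2 * (g ^+ 2 / (2 * H) + c ^+ 2).
exists (2 * T * (2 * A + 2 * C ^+ 2) + B) => n n2.
have n0 : (0 < n)%N by lia.
have n0' : 0 < n%:R :> R by rewrite ltr0n.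
have n1 : 1 <= n%:R :> R by rewrite ler1n.
have n1' : 1 < n%:R :> R by rewrite ltr1n.
set K := K_NC H J n; set L := K `^ beta_ H J.
have KE : K = n%:R `^ (D / D') := K_NCE n.
have LE : L = n%:R `^ (N / D') := K_NC_beta n.
have NCE t : hatG_NC H J n t = hatG H L n t + atomic_laplace
    [seq (c * (K - L) / n%:R * newton_cotes_weight J m *
            nc_node K L J n i m `^ (- H - 2^-1),
          nc_node K L J n i m) | i <- iota 1 n, m <- iota 0 J.+1] t.
  by rewrite /hatG_NC /hat_lambda_NC -/K -/L /atomic_laplace big_cat.
have mNC : measurable_fun `[0, T] (hatG_NC H J n) by exact: measurable_atomic_laplace.
clearbody L; clearbody K.
have L1 : 1 <= L.
  by rewrite LE -[leLHS](powRr0 n%:R) ler_powR// divr_ge0// ltW.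
have L0 := lt_le_trans ltr01 L1.
have LK : L < K.
  have d0 : 0 < D / D' - N / D'.
    by rewrite -mulrBl divr_gt0// /N /D; have := j0; lra.
  have -> : K = L * n%:R `^ (D / D' - N / D').
    by rewrite KE LE -powRD ?(gt_eqF n0') ?implybT// addrC subrK.
  rewrite ltr_pMr//.
  have h := @gt0_ltr_powR R _ d0 1 n%:R; rewrite powR1 in h.
  by apply: h; rewrite ?nnegrE ?ler0n ?ler01.
have K0 := lt_trans L0 LK.
pose q := L `^ (- p) * (K / n%:R) ^+ J.+2 * K.
have q0 : 0 <= q.
  by rewrite /q mulr_ge0 ?(ltW K0)// mulr_ge0 ?powR_ge0// exprn_ge0// divr_ge0 ?(ltW K0)// ltW.
have E0 : 0 <= cell_error H T L n + C * q.
  by apply: addr_ge0; [exact: cell_error_ge0 | exact: mulr_ge0].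
have err t : 0 < t <= T -> `|hatG_NC H J n t - G_frac H t| <=
    (cell_error H T L n + C * q) + laplace H `[K, +oo[ t.
  move=> /[dup] tT /andP[t0 _].
  have split2 : laplace H `[L, +oo[ t = laplace H `[L, K[ t + laplace H `[K, +oo[ t.
    have sL := laplace_split H01 (ltW L0) t0.
    have sK := laplace_split H01 (ltW K0) t0.
    have U : `[0, K[%classic = `[0, L[%classic `|` `[L, K[%classic :> set R.
      by rewrite -itv_bndbnd_setU// bnd_simp// ltW.
    have : laplace H `[0, K[ t = laplace H `[0, L[ t + laplace H `[L, K[ t.
      rewrite /laplace [in LHS]U Rintegral_setU//; rewrite -?U.
      - by apply: integrable_laplace => // z /=; rewrite !in_itv/= andbT => /andP[].
      - apply/disj_setPS => z [] /=; rewrite !in_itv/= => /andP[_ zx] /andP[xz _].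
        by move: (le_lt_trans xz zx); rewrite ltxx.
    by move=> s0; apply: (addrI (laplace H `[0, L[ t)); rewrite addrA -s0 -sK sL.
  rewrite (laplace_split H01 (ltW L0) t0) split2.
  rewrite NCE.
  have h1 := hatG_bounded_error H01 L0 tT n0.
  have h2 := CP L K t n L1 LK tT n0.
  have h3 := laplace_ge0 H `[K, +oo[%classic t.
  move: h1 h2 h3; rewrite -/q !ler_norml.
  set x1 := hatG _ _ _ _; set x2 := laplace _ `[0, L[ _; set x3 := laplace _ `[L, K[ _.
  set x4 := atomic_laplace _ _; set x5 := laplace _ _ _.
  by move=> /andP[? ?] /andP[? ?] ?; apply/andP; split; lra.
have := kernel_error H01 K0 T0 E0 mNC err.
move=> /le_trans; apply; rewrite lee_fin.
set z := n%:R `^ (- (2 * H * (D / D'))).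
have z0 : 0 <= z by exact: powR_ge0.
have D'n : D' != 0 by rewrite gt_eqF.
have nn : (n%:R == 0 :> R) = false by rewrite gt_eqF.
(* N (5 - 2 H) - 4 D' = - 2 H D. *)
have e1 : cell_error H T L n ^+ 2 = A * z.
  rewrite cell_error_sqr//; congr (_ * _).
  rewrite LE -powRrM -powRD ?nn ?implybT//; congr (_ `^ _).
  by apply: (mulIf D'n); rewrite /N /D /D'; field; exact: D'n.
(* As D - D' = - 3, the exponent of q times D' is - N p - 3 (J + 2) + D = - H (N + J) = - H D. *)
have e2 : q ^+ 2 = z.
  have -> : q = n%:R `^ (N / D' * - p + (D / D' - 1) * J.+2%:R + D / D').
    rewrite /q LE KE -powRrM.
    have -> : n%:R `^ (D / D') / n%:R = n%:R `^ (D / D' - 1).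
      by rewrite powRD ?nn ?implybT// powR_inv1// ltW.
    rewrite -powR_mulrn ?powR_ge0// -powRrM -!powRD ?nn ?implybT//.
  rewrite -powR_mulrn ?powR_ge0// -powRrM; congr (_ `^ _).
  by apply: (mulIf D'n); rewrite -(natr1 J.+1) -(natr1 J) /N /D /D'; field; exact: D'n.
have e3 : K `^ (- (2 * H)) = z.
  by rewrite KE -powRrM; congr (_ `^ _); ring.
rewrite e3 -/B [leRHS]mulrDl lerD2r -[leRHS]mulrA ler_wpM2l ?mulr_ge0//.
have e4 : (C * q) ^+ 2 = C ^+ 2 * z by rewrite exprMn e2.
have := sqr_ge0 (cell_error H T L n - C * q).
by move: e1 e4; move: (cell_error H T L n) (C * q) => x y; nra.
Qed.

End newton_cotes_rate.

Unset Implicit Arguments.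

Theorem proposition5p3 (R : realType) (d : measure_display)
    (Omega : measurableType d) (P : probability Omega R)
    (F : R -> set (set Omega)) (W : R -> Omega -> R)
    (x0 : R) (b sigma : R -> R) (H T : R) (X : R -> Omega -> R) :
  filtration F -> brownian_motion P F W ->
  lipschitz b -> lipschitz sigma ->
  0 < H < 2^-1 -> 0 < T ->
  volterra_solution P F W x0 b sigma (G_frac H) (G_frac H) X ->
  [/\ (* the kernel *)
      forall t : R, 0 < t -> G_frac H t = t `^ (H - 2^-1) / Gamma (H + 2^-1),
      (* (1) *)
      forall K : nat -> R, (forall n, (0 < n)%N -> 0 < K n) ->
        K n / n%:R `^ (4 / 5) @[n --> \oo] --> (1 : R) ->
        exists2 C : R, 0 < C &
          forall (n : nat) (Xhat : R -> Omega -> R), (0 < n)%N ->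
          volterra_solution P F W x0 b sigma
            (hatG H (K n) n) (hatG H (K n) n) Xhat ->
          forall t : R, 0 <= t <= T ->
          ('E_P[fun w => (`|Xhat t w - X t w| ^+ 2)%R]
             <= (C * n%:R `^ (- (2 * H * (4 / 5))))%:E)%E,
      (* (2) *)
      forall J : nat, (2 <= J)%N -> ~~ odd J ->
        exists2 C : R, 0 < C &
          forall (n : nat) (Xhat : R -> Omega -> R), (0 < n)%N ->
          volterra_solution P F W x0 b sigma
            (hatG_NC H J n) (hatG_NC H J n) Xhat ->
          forall t : R, 0 <= t <= T ->
          ('E_P[fun w => (`|Xhat t w - X t w| ^+ 2)%R]
             <= (C * n%:R `^ (- (2 * H *
                   ((5 * J%:R + 12 - 2 * H * J%:R) /
                    (5 * J%:R + 15 - 2 * H * J%:R)))))%:E)%E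
    & (* (2) for Simpson's rule *)
      exists2 C : R, 0 < C &
        forall (n : nat) (Xhat : R -> Omega -> R), (0 < n)%N ->
        volterra_solution P F W x0 b sigma
          (hatG_NC H 2 n) (hatG_NC H 2 n) Xhat ->
        (ereal_sup [set 'E_P[fun w => (`|Xhat t w - X t w| ^+ 2)%R]
                   | t in [set t : R | (0 <= t <= T)%R]]
           <= (C * n%:R `^ (- (2 * H * ((22 - 4 * H) / (25 - 4 * H)))))%:E)%E].
Proof.
move=> fF bW Lb Ls H01 T0 solX.
have T0' := ltW T0.
have H0 : 0 < H by case/andP: H01.
have mG : measurable_fun `[0, T] (G_frac H) by exact: measurable_G_frac.
have Goo := integral_G_frac_sqr_lty H01 T.
have part2 (J : nat) : (2 <= J)%N -> ~~ odd J ->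
    exists2 C : R, 0 < C & forall (n : nat) (Xhat : R -> Omega -> R), (0 < n)%N ->
      volterra_solution P F W x0 b sigma (hatG_NC H J n) (hatG_NC H J n) Xhat ->
      forall t : R, 0 <= t <= T ->
      ('E_P[fun w => (`|Xhat t w - X t w| ^+ 2)%R] <=
       (C * n%:R `^ (- (2 * H * ((5 * J%:R + 12 - 2 * H * J%:R) /
                                 (5 * J%:R + 15 - 2 * H * J%:R)))))%:E)%E.
  move=> J2 eJ; have J0 : (0 < J)%N by exact: ltnW.
  have [C CP] := hatG_NC_rate H01 J0 eJ T0'.
  have Hj : 0 < J%:R - 2 * H * J%:R :> R.
    rewrite -[X in X - _]mul1r -mulrBl mulr_gt0 ?ltr0n//.
    by case/andP: H01 => _; lra.
  have j0 : 0 < J%:R :> R by rewrite ltr0n.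
  (* The threshold 2 leaves n = 1 to the treatment of single kernels in [volterra_rate]. *)
  apply: (volterra_rate fF bW T0' mG Goo solX Lb Ls (C0 := C) (n0 := 2)).
  - by rewrite mulr_gt0 ?divr_gt0 ?mulr_gt0//; lra.
  - by move=> n _; exact: measurable_atomic_laplace.
  - by move=> n _; exact: atomic_laplace_sqr_lty.
  - by move=> n _; exact: CP.
split.
- by move=> t; exact: G_fracE.
- move=> K K0 cK; have [C [N CP]] := hatG_rate H01 T0' K0 cK.
  apply: (volterra_rate fF bW T0' mG Goo solX Lb Ls (C0 := C) (n0 := N)) CP.
  - by rewrite !mulr_gt0.
  - by move=> n _; exact: measurable_atomic_laplace.
  - by move=> n _; exact: atomic_laplace_sqr_lty.
- exact: part2.
- have [C C0 CP] := part2 2%N isT isT; exists C => // n Xhat n0 sol.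
  (* The constant of part (2) does not depend on t, so it also bounds the supremum. *)
  apply: ge_ereal_sup => _ [t tT <-]; move: (CP n Xhat n0 sol t tT).
  have -> : 5 * 2 + 12 - 2 * H * 2 = 22 - 4 * H by ring.
  by have -> : 5 * 2 + 15 - 2 * H * 2 = 25 - 4 * H by ring.
Qed.
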